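(* Let $G$ be a hyperbolic uniform disk graph with radius $r$ on $n$ vertices. It is possible to compute, in $\mathcal{O}(n\log n)$ time, a tree decomposition $\mathcal{T}$ of $G$ with $|\mathcal{T}|\le 2n$ and a layering $(V_1,V_2,\ldots)$ of $G$ witnessing layered tree-independence number $6\left\lceil\frac{r}{\tanh r}\right\rceil$. In particular, $G$ has layered tree-independence number at most $6\left\lceil\frac{r}{\tanh r}\right\rceil$.
   Context: All graphs are finite and simple; $\alpha$ denotes the independence number. For $r>0$, a hyperbolic uniform disk graph with radius $r$ is the intersection graph of a finite collection of closed disks of the same radius $r$ in the hyperbolic plane $\mathbb{H}^2$ of curvature $-1$ (vertices are the disks, two distinct ones adjacent iff they intersect). For the algorithmic part, $G$ is given together with a geometric realization consisting of the polar coordinates of the disk centers: with respect to a pole $o\in\mathbb{H}^2$ and a polar axis (a ray from $o$), a point $p$ is identified with $(b(p),\theta(p))$, where $b(p)$ is the hyperbolic distance from $o$ to $p$ and $\theta(p)\in[0,2\pi)$ is the angle from the polar axis to the ray from $o$ through $p$. It is assumed that for a disk $O$, computing $\inf_{x\in O}\theta(x)$ and $\sup_{x\in O}\theta(x)$ takes constant time. A tree decomposition of $G$ is a pair $\mathcal{T}=(T,\{X_t\}_{t\in V(T)})$ with $T$ a tree and bags $X_t\subseteq V(G)$ such that every vertex is in some bag, both endpoints of every edge lie in a common bag, and for each $u\in V(G)$ the nodes $t$ with $u\in X_t$ induce a connected subgraph of $T$; $|\mathcal{T}|=|V(T)|$. A layering of $G$ is an ordered partition $(V_1,V_2,\ldots)$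 of $V(G)$ (parts may be empty, all but finitely many are) such that for each edge $uv$ with $u\in V_i$, $v\in V_j$ we have $|i-j|\le 1$. They witness layered tree-independence number $\ell$ if $\alpha(G[X_t\cap V_i])\le\ell$ for every bag $X_t$ and layer $V_i$. The layered tree-independence number of $G$ is the minimum $\ell$ witnessed by some tree decomposition and layering of $G$. *)

(* Defs.v *)
From HB Require Import structures.
From mathcomp Require Import all_boot all_order all_algebra.
From mathcomp Require Import all_classical all_reals all_analysis.

Set Implicit Arguments.
Unset Strict Implicit.
Unset Printing Implicit Defensive.

Import Order.TTheory GRing.Theory Num.Theory.

Local Open Scope classical_set_scope.
Local Open Scope ring_scope.

(** * Graphs *)

Record sgraph := SGraph {
  vertex :> finType;
  adj : rel vertex;
  adj_sym : symmetric adj;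
  adj_irr : irreflexive adj }.

Definition stable (G : sgraph) (A : {set G}) : bool :=
  [forall u in A, forall v in A, ~~ adj u v].

Definition alpha (G : sgraph) : nat := \max_(A : {set G} | stable A) #|A|.

Section Induced.
Variables (G : sgraph) (S : {set G}).

Definition induced_adj : rel {x : G | x \in S} :=
  [rel u v | adj (val u) (val v)].

Fact induced_sym : symmetric induced_adj.
Proof. by move=> u v; rewrite /induced_adj /= adj_sym. Qed.

Fact induced_irr : irreflexive induced_adj.
Proof. by move=> u; rewrite /induced_adj /= adj_irr. Qed.

Definition induced : sgraph := SGraph induced_sym induced_irr.
End Induced.

Definition gconnected (G : sgraph) : Prop := forall x y : G, connect (@adj G) x y.

(* In a symmetric relation, [:: x; y] is a [ucycle] as soon as x and y are
   adjacent; the cycles of the graph are the [ucycle]s of size at least 3. *)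
Definition acyclic (G : sgraph) : Prop :=
  forall c : seq G, ucycle (@adj G) c -> (size c <= 2)%N.

Definition is_tree (T : sgraph) : Prop :=
  [/\ (0 < #|T|)%N, gconnected T & acyclic T].

Definition is_tree_decomposition (G T : sgraph) (X : T -> {set G}) : Prop :=
  [/\ is_tree T,
      forall u : G, exists t : T, u \in X t,
      forall u v : G, adj u v -> exists t : T, (u \in X t) && (v \in X t)
    & forall u : G, gconnected (induced [set t : T | u \in X t]%SET)].

(* Layers are numbered from 0. Since G is finite, all but finitely many layers
   are automatically empty. *)
Definition is_layering (G : sgraph) (V : nat -> {set G}) : Prop :=
  (forall u : G, exists! i : nat, u \in V i) /\
  (forall (u v : G) (i j : nat), adj u v -> u \in V i -> v \in V j ->
     (i <= j.+1)%N && (j <= i.+1)%N).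

Definition witness_ltin (G T : sgraph) (X : T -> {set G}) (V : nat -> {set G})
    (l : nat) : Prop :=
  forall (t : T) (i : nat), (alpha (induced (X t :&: V i)%SET) <= l)%N.

Definition has_ltin_witness (G : sgraph) (l : nat) : Prop :=
  exists (T : sgraph) (X : T -> {set G}) (V : nat -> {set G}),
    [/\ is_tree_decomposition X, is_layering V & witness_ltin X V l].

Fact has_ltin_witness_ex (G : sgraph) :
  exists l : nat, `[< has_ltin_witness G l >].
Proof.
pose e : rel unit := fun _ _ => false.
have es : symmetric e by [].
have ei : irreflexive e by [].
exists #|G|; apply/asboolP.
exists (SGraph es ei), (fun _ => [set: G]%SET).
exists (fun i => if i == 0%N then [set: G]%SET else finset.set0).
split.
- split.
  + split; first by rewrite card_unit.
    * by move=> [] []; exact: connect0.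
    * by move=> [|x [|y c]] //; rewrite /ucycle /= andbF.
  + by move=> u; exists tt; rewrite /= finset.in_setT.
  + by move=> u v _; exists tt; rewrite /= !finset.in_setT.
  + by move=> u [[] p] [[] q]; rewrite (bool_irrelevance p q); exact: connect0.
- split=> [u|u v i j _].
  + by exists 0%N; split=> [|[|i]] //=; rewrite finset.in_set0.
  + by case: i => [|i]; case: j => [|j] //=; rewrite finset.in_set0.
- move=> t i; apply/bigmax_leqP => A _.
  by rewrite (leq_trans (max_card _)) // card_sig max_card.
Qed.

(* the layered tree-independence number *)
Definition ltin (G : sgraph) : nat := ex_minn (has_ltin_witness_ex G).

(** * The hyperbolic plane of curvature -1 (hyperboloid model) *)

Section Hyperbolic.
Variable R : realType.

Definition cosh (x : R) : R := (expR x + expR (- x)) / 2.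
Definition sinh (x : R) : R := (expR x - expR (- x)) / 2.
Definition tanh (x : R) : R := sinh x / cosh x.
Definition arcosh (x : R) : R := ln (x + Num.sqrt (x ^+ 2 - 1)).

Definition mdot (x y : 'rV[R]_3) : R :=
  - (x 0 0 * y 0 0) + x 0 1 * y 0 1 + x 0 2%:R * y 0 2%:R.

Record H2 := HPoint {
  hcoord :> 'rV[R]_3;
  _ : mdot hcoord hcoord = -1;
  _ : 0 < hcoord 0 0 }.

Definition hdist (p q : H2) : R := arcosh (- mdot p q).

Definition disk (r : R) (p : H2) : set H2 := [set x | hdist p x <= r].

Definition disks_meet (r : R) (p q : H2) : Prop :=
  disk r p `&` disk r q !=set0.

Section DiskGraph.
Variables (r : R) (V : finType) (p : V -> H2).

Definition disk_adj : rel V :=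
  [rel u v | (u != v) && `[< disks_meet r (p u) (p v) >]].

Fact disk_adj_sym : symmetric disk_adj.
Proof.
by move=> u v; rewrite /disk_adj /= eq_sym; congr (_ && `[< _ >]);
  rewrite /disks_meet setIC.
Qed.

Fact disk_adj_irr : irreflexive disk_adj.
Proof. by move=> u; rewrite /disk_adj /= eqxx. Qed.

Definition disk_graph : sgraph := SGraph disk_adj_sym disk_adj_irr.
End DiskGraph.

Definition hyperbolic_uniform_disk_graph (r : R) (G : sgraph) : Prop :=
  exists p : G -> H2,
    forall u v : G, adj u v <-> (u != v /\ disks_meet r (p u) (p v)).

(* A pole together with an orthonormal basis of its tangent plane: the polar
   axis is the ray issued from [pole] in the direction [axis], and [side] tells
   in which of the two directions angles increase. *)
Record polar_frame := PolarFrame {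
  pole : H2;
  axis : 'rV[R]_3;
  side : 'rV[R]_3;
  _ : mdot pole axis = 0;
  _ : mdot pole side = 0;
  _ : mdot axis axis = 1;
  _ : mdot side side = 1;
  _ : mdot axis side = 0 }.

(* The geodesic issued from o with unit tangent vector w is
   b |-> cosh b *: o + sinh b *: w. The pole has coordinates (0, theta) for
   every theta. *)
Definition polar (F : polar_frame) (p : H2) (b theta : R) : Prop :=
  [/\ 0 <= b, 0 <= theta < 2 * pi
    & hcoord p = cosh b *: hcoord (pole F)
        + sinh b *: (cos theta *: axis F + sin theta *: side F)].

Definition angles (F : polar_frame) (O : set H2) : set R :=
  [set theta | exists (x : H2) (b : R), O x /\ polar F x b theta].

End Hyperbolic.

(** * A real RAM

   Two unbounded memories, one of natural numbers and one of real numbers, with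
   direct and indirect addressing. Every instruction and every test has cost 1.
   There is no conversion from reals to integers (no floor function); the
   bounds of the angular range of the i-th input disk are available through the
   instruction [AngleBound]. *)

Inductive addr :=
| Dir of nat     (* the cell a *)
| Ind of nat.    (* the cell whose address is stored in integer cell a *)

Inductive iarg := ICst of nat | ICell of addr.
Inductive rarg := RCst of nat | RCell of addr.

Inductive iop := IAdd | ISub.
Inductive rop := RAdd | RSub | RMul | RDiv.

Inductive instr :=
| ISet of addr & iop & iarg & iarg
| RSet of addr & rop & rarg & rarg
| AngleBound of addr & bool & iarg.  (* true: supremum; false: infimum *)

Inductive test :=
| ILe of iarg & iarg
| ILt of iarg & iarg
| IEq of iarg & iarg
| RLe of rarg & rarg
| RLt of rarg & rarg.

Inductive cmd :=
| Instr of instr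
| Seq of cmd & cmd
| If of test & cmd & cmd
| While of test & cmd.

Section Machine.
Variable R : realType.

Record state := State { ints : nat -> nat; reals : nat -> R }.

Definition address (s : state) (a : addr) : nat :=
  match a with Dir k => k | Ind k => ints s k end.

Definition ival (s : state) (x : iarg) : nat :=
  match x with ICst k => k | ICell a => ints s (address s a) end.

Definition rval (s : state) (x : rarg) : R :=
  match x with RCst k => k%:R | RCell a => reals s (address s a) end.

Definition iop_val (o : iop) (x y : nat) : nat :=
  match o with IAdd => (x + y)%N | ISub => (x - y)%N end.

Definition rop_val (o : rop) (x y : R) : R :=
  match o with
  | RAdd => x + y | RSub => x - y | RMul => x * y | RDiv => x / y
  end.

Definition upd (T : Type) (f : nat -> T) (k : nat) (v : T) : nat -> T :=
  fun j => if j == k then v else f j.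

Definition set_int (s : state) (a : addr) (v : nat) : state :=
  State (upd (ints s) (address s a) v) (reals s).

Definition set_real (s : state) (a : addr) (v : R) : state :=
  State (ints s) (upd (reals s) (address s a) v).

Definition test_val (s : state) (q : test) : bool :=
  match q with
  | ILe x y => (ival s x <= ival s y)%N
  | ILt x y => (ival s x < ival s y)%N
  | IEq x y => ival s x == ival s y
  | RLe x y => rval s x <= rval s y
  | RLt x y => rval s x < rval s y
  end.

Variable oracle : bool -> nat -> R.

Definition step (s : state) (c : instr) : state :=
  match c with
  | ISet d o x y => set_int s d (iop_val o (ival s x) (ival s y))
  | RSet d o x y => set_real s d (rop_val o (rval s x) (rval s y))
  | AngleBound d up i => set_real s d (oracle up (ival s i))
  end.

(* [exec c s t s'] : started in [s], [c] halts in [s'] after time [t]. *)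
Inductive exec : cmd -> state -> nat -> state -> Prop :=
| ExecInstr c s : exec (Instr c) s 1 (step s c)
| ExecSeq c1 c2 s1 t1 s2 t2 s3 :
    exec c1 s1 t1 s2 -> exec c2 s2 t2 s3 ->
    exec (Seq c1 c2) s1 (t1 + t2)%N s3
| ExecIf q c1 c2 s t s' :
    exec (if test_val s q then c1 else c2) s t s' ->
    exec (If q c1 c2) s t.+1 s'
| ExecWhileEnd q c s :
    test_val s q = false -> exec (While q c) s 1 s
| ExecWhile q c s t1 s1 t2 s2 :
    test_val s q = true -> exec c s t1 s1 -> exec (While q c) s1 t2 s2 ->
    exec (While q c) s (t1 + t2).+1 s2.

End Machine.

Section InputOutput.
Variables (R : realType) (n : nat).

Definition at_index (f : 'I_n -> R) (i : nat) : R := oapp f 0 (insub i).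

(* Integer cell 0 holds n, real cell 0 holds r, real cells 2i+1 and 2i+2 hold
   the polar coordinates of the i-th center; all other cells hold 0. *)
Definition input (r : R) (b theta : 'I_n -> R) : state R :=
  State (fun k => if k == 0%N then n else 0%N)
        (fun k => if k == 0%N then r
                  else if odd k then at_index b k.-1./2
                  else at_index theta k.-1./2).

Definition angle_oracle (F : polar_frame R) (r : R) (p : 'I_n -> H2 R)
    (up : bool) : nat -> R :=
  at_index (fun i => (if up then sup else inf) (angles F (disk r (p i)))).

(* Output format, in the integer memory N:
   - N[0] is the number m of nodes of the tree, which are 0, ..., m-1;
   - the m-1 edges of the tree are the pairs (N[a+2e], N[a+2e+1]), a = N[1];
   - N[2] is a number k, and the bags are given by the k triples
     (u, lo, hi) = (N[c+3j], N[c+3j+1], N[c+3j+2]), c = N[3], each meaning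
     that u belongs to the bags of all nodes t with lo <= t <= hi
     (listing the bags element by element is the case lo = hi);
   - the layer of u is N[l+u], l = N[4]. *)
Variable s : state R.
Local Notation N := (ints s).

Local Open Scope nat_scope.

Definition out_size : nat := N 0.

Definition out_edge (i j : nat) : bool :=
  [exists e : 'I_out_size.-1,
    (N (N 1 + 2 * e) == i) && (N (N 1 + 2 * e).+1 == j)].

Definition out_adj : rel 'I_out_size :=
  [rel i j : 'I_out_size | (i != j) && (out_edge i j || out_edge j i)].

Fact out_adj_sym : symmetric out_adj.
Proof. by move=> i j; rewrite /out_adj /= eq_sym orbC. Qed.

Fact out_adj_irr : irreflexive out_adj.
Proof. by move=> i; rewrite /out_adj /= eqxx. Qed.

Definition out_tree : sgraph := SGraph out_adj_sym out_adj_irr.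

Definition in_bag (u t : nat) : bool :=
  [exists j : 'I_(N 2),
    (N (N 3 + 3 * j) == u)
    && (N (N 3 + 3 * j).+1 <= t <= N (N 3 + 3 * j).+2)].

Definition out_bag (t : 'I_out_size) : {set 'I_n} :=
  [set u : 'I_n | in_bag u t]%SET.

Definition out_layer (i : nat) : {set 'I_n} :=
  [set u : 'I_n | N (N 4 + u) == i]%SET.

End InputOutput.

(* Main.v *)
(* Sort the 2n endpoints of the angular ranges [inf, sup] of the disks; they are
   the nodes of a path, and a disk belongs to the bags between its endpoints. Two
   intersecting disks share an angle, hence a bag. A disk that does not contain
   the pole and is in the bag of angle a meets the ray at angle a, or it crosses
   the polar axis. The layers are [rho, rho + 2r) in the distance b to the pole,
   opened greedily in increasing order of b, the first one at rho = 0: so either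
   rho = 0 or rho >= 2r.

   It remains to bound the number k of disjoint disks of one layer that meet a
   given ray and have their centers on a given side of it; let K be the ceiling
   of r / tanh r, so that K >= 2 and r < K. Use Fermi coordinates (s, d) along
   the ray, where 0 <= d <= r, and exp s for s. If cosh r <= 5/2, then two
   centers satisfy |s - s'| >= r, which gives k <= 2 if rho = 0 and k <= 3
   otherwise. If cosh r >= 5/2, then exp |s - s'| >= 5, and the gap below the
   center with the largest s is larger, since this center either is close to the
   ray or has b well above s; comparing with the width 2r of the layer gives
   2k < 3K if rho = 0 and 2k <= 3K otherwise. There are two rays with two sides
   each, and at most one disk contains the pole, whence the bound 6K. *)

Require Import Defs.
From HB Require Import structures.
From mathcomp Require Import all_boot all_order all_algebra.
From mathcomp Require Import all_classical all_reals all_analysis.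
From mathcomp Require Import ring lra zify.

Set Implicit Arguments.
Unset Strict Implicit.
Unset Printing Implicit Defensive.

Import Order.TTheory GRing.Theory Num.Theory.

Local Open Scope ring_scope.

(** * Hyperbolic functions *)

(** The threshold 5/2 for c = cosh r comes from two centers on the same side, both at distance r
    from the ray. With H = cosh (s - s'), their disks meet iff c^2 H - (c^2 - 1) <= cosh (2r) = 2
    c^2 - 1, that is, iff H <= 3 - 2 / c^2. The value H = c satisfies this up to c = 1 + sqrt 3, and
    H = 13/5, where |s - s'| = ln 5, satisfies it from c = sqrt 5 on; 5/2 lies between the two. The
    special treatment of the top center is essential. In a layer with rho >= 2r, s ranges from about
    rho - r to rho + 2r, and gaps of ln 5 alone would admit about 1.86 r centers, more than 3K/2 for
    large r. All centers but the top one have s below about rho + r, which leaves about 1.24 r. The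
    machine has no recursion, and its integer arithmetic only adds and subtracts. Sorting therefore
    uses a tournament tree whose parent pointers are kept in a table. *)

Section HyperbolicFunctions.
Import numFieldNormedType.Exports.
Variable R : realType.
Implicit Types (x y : R).
Local Notation cosh := (@cosh R).
Local Notation sinh := (@sinh R).
Local Notation tanh := (@tanh R).

Lemma expR_cosh_sinh x : expR x = cosh x + sinh x.
Proof. by rewrite /Defs.cosh /Defs.sinh; lra. Qed.

Lemma coshE x : cosh x = (expR x + (expR x)^-1) / 2.
Proof. by rewrite /Defs.cosh expRN. Qed.

Lemma cosh0 : cosh 0 = 1.
Proof. by rewrite coshE expR0 invr1; lra. Qed.

Lemma cosh2Bsinh2 x : cosh x ^+ 2 - sinh x ^+ 2 = 1.
Proof.
have := expRxMexpNx_1 x; rewrite /Defs.cosh /Defs.sinh => h.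
by apply: etrans h; field.
Qed.

Lemma coshB x y : cosh (x - y) = cosh x * cosh y - sinh x * sinh y.
Proof.
rewrite /Defs.cosh /Defs.sinh opprB !expRD.
by field.
Qed.

Lemma cosh_double x : cosh (2 * x) = 2 * cosh x ^+ 2 - 1.
Proof.
have h := expRxMexpNx_1 x.
have -> : 2 * x = x + x by ring.
rewrite /Defs.cosh opprD !expRD.
apply/eqP; rewrite -subr_eq0; apply/eqP.
transitivity (1 - expR x * expR (- x)); last by rewrite h subrr.
by field.
Qed.

(** Monotonicity of x + 1/x on [1, oo). It replaces that of cosh for quantities that are given as
    exponentials, such as [fermi_exp]. *)
Lemma le_addV (a b : R) : 1 <= a -> a <= b -> a + a^-1 <= b + b^-1.
Proof.
move=> a1 ab.
have a0 : 0 < a by lra.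
have b0 : 0 < b by lra.
rewrite -subr_ge0.
have -> : b + b^-1 - (a + a^-1) = (b - a) * (a * b - 1) / (a * b).
  by field; rewrite !gt_eqF.
apply: mulr_ge0; last by rewrite invr_ge0 mulr_ge0 // ltW.
by apply: mulr_ge0; [lra | nra].
Qed.

Lemma le_of_addV (a b : R) : 0 < a -> 1 <= b -> a + a^-1 <= b + b^-1 -> a <= b.
Proof.
move=> a0 b1; apply: contraTT; rewrite -!ltNge => ba.
have b0 : 0 < b by lra.
rewrite -subr_gt0.
have -> : a + a^-1 - (b + b^-1) = (a - b) * (a * b - 1) / (a * b).
  by field; rewrite !gt_eqF.
apply: divr_gt0; last by rewrite mulr_gt0.
by apply: mulr_gt0; [lra | nra].
Qed.

Lemma ler_cosh x y : 0 <= x -> 0 <= y -> (cosh x <= cosh y) = (x <= y).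
Proof.
move=> x0 y0; rewrite -[RHS]ler_expR !coshE ler_pM2r ?invr_gt0 //.
have e1 (z : R) : 0 <= z -> 1 <= expR z by move=> z0; have := expR_ge1Dx z; lra.
apply/idP/idP; last exact: (le_addV (e1 x x0)).
by apply: le_of_addV; rewrite ?expR_gt0 ?e1.
Qed.

Lemma cosh_ge1 x : 1 <= cosh x.
Proof.
rewrite coshE; have e0 := expR_gt0 x.
rewrite -subr_ge0.
have -> : (expR x + (expR x)^-1) / 2 - 1 = (expR x - 1) ^+ 2 / (2 * expR x).
  by field; rewrite gt_eqF.
by rewrite divr_ge0 ?sqr_ge0 // mulr_ge0 // ltW.
Qed.

Lemma sinh_ge0 x : 0 <= x -> 0 <= sinh x.
Proof.
move=> x0; rewrite /Defs.sinh divr_ge0 // subr_ge0 ler_expR; lra.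
Qed.

Lemma sinh_gt0 x : 0 < x -> 0 < sinh x.
Proof.
move=> x0; rewrite /Defs.sinh divr_gt0 // subr_gt0 ltr_expR; lra.
Qed.

Lemma coshN x : cosh (- x) = cosh x.
Proof. by rewrite /Defs.cosh opprK addrC. Qed.

Lemma cosh_abs x : cosh `|x| = cosh x.
Proof. by case: (ger0P x) => _ //; rewrite coshN. Qed.

Lemma arcoshP x : 1 <= x -> 0 <= arcosh x /\ cosh (arcosh x) = x.
Proof.
move=> x1; rewrite /arcosh.
set s := Num.sqrt _.
have s0 : 0 <= s by exact: sqrtr_ge0.
have s2 : s ^+ 2 = x ^+ 2 - 1 by rewrite sqr_sqrtr //; nra.
have xs : 1 <= x + s by lra.
have xs0 : 0 < x + s by lra.
split; first exact: ln_ge0.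
rewrite coshE lnK ?posrE //.
have -> : (x + s)^-1 = x - s.
  apply: (mulfI (lt0r_neq0 xs0)); rewrite mulfV ?lt0r_neq0 //; nra.
lra.
Qed.

Lemma tanh_lt1 x : tanh x < 1.
Proof.
rewrite /Defs.tanh; have := cosh_ge1 x => c1.
rewrite ltr_pdivrMr ?mul1r; last lra.
rewrite /Defs.sinh /Defs.cosh; have := expR_gt0 (- x); lra.
Qed.

Lemma tanh_gt0 x : 0 < x -> 0 < tanh x.
Proof.
by move=> x0; rewrite /Defs.tanh divr_gt0 ?sinh_gt0 //; have := cosh_ge1 x; lra.
Qed.

Lemma is_derive_mul_cosh_sub_sinh x :
  is_derive x 1 (fun t => t * cosh t - sinh t) (x * sinh x).
Proof.
rewrite /Defs.cosh /Defs.sinh.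
apply: is_derive_eq.
rewrite /GRing.scale /=.
by field.
Qed.

(** The function x cosh x - sinh x vanishes at 0 and has the positive derivative x sinh x, so the
    mean value theorem applies. *)
Lemma tanh_lt x : 0 < x -> tanh x < x.
Proof.
move=> x0; rewrite /Defs.tanh.
have c1 := cosh_ge1 x.
rewrite ltr_pdivrMr; last lra.
have [||c] := @MVT R (fun t => t * cosh t - sinh t) (fun t => t * sinh t) 0 x x0.
- by move=> t _; exact: is_derive_mul_cosh_sub_sinh.
- apply: continuous_subspaceT => t.
  apply: differentiable_continuous; apply/derivable1_diffP.
  by case: (is_derive_mul_cosh_sub_sinh t).
rewrite in_itv /= => /andP[c0 cx].
have -> : sinh 0 = 0 by rewrite /Defs.sinh oppr0 subrr mul0r.
rewrite mul0r !subr0 => h.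
have : 0 < c * sinh c * x by apply: mulr_gt0 => //; apply: mulr_gt0 => //; exact: sinh_gt0.
by rewrite -h; lra.
Qed.

(** For e = exp (1/8), the inequality tanh (1/8) < 1/8 reads e^2 < 9/7, hence exp 2 < (9/7)^8 <
    7.47. The precision matters in [exp_le_5], where the cube of this bound has to stay below
    421.25. *)
Lemma expR2_le : expR 2 <= 747 / 100 :> R.
Proof.
have h := @tanh_lt (1 / 8) ltac:(lra).
have c1 := cosh_ge1 (1 / 8).
move: h; rewrite /Defs.tanh ltr_pdivrMr; last lra.
rewrite /Defs.cosh /Defs.sinh expRN.
set e := expR _ => h.
have e0 : 0 < e by exact: expR_gt0.
have ee : e * e^-1 = 1 by rewrite mulfV // gt_eqF.
have e2 : e ^+ 2 < 9 / 7 by nra.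
have -> : expR 2 = (((e ^+ 2) ^+ 2) ^+ 2) ^+ 2.
  by rewrite -!exprM -expRM_natl; congr expR; lra.
have sq_le (a b : R) : 0 <= a -> a <= b -> a ^+ 2 <= b ^+ 2.
  by move=> a0 ab; rewrite ler_sqr ?nnegrE //; exact: le_trans ab.
have := sq_le _ _ (sqr_ge0 e) (ltW e2).
move=> /(sq_le _ _ (sqr_ge0 _)) /(sq_le _ _ (sqr_ge0 _)) h4.
apply: (le_trans h4); lra.
Qed.

End HyperbolicFunctions.

(** * The hyperboloid model in polar coordinates *)

Lemma ord3P (i : 'I_3) : [\/ i = 0, i = 1 | i = 2%:R].
Proof.
case: i => [[|[|[|//]]] h]; [apply: Or31|apply: Or32|apply: Or33]; exact: val_inj.
Qed.

Section HyperbolicPlane.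
Variable R : realType.
Local Notation cosh := (@cosh R).
Local Notation sinh := (@sinh R).
Local Notation cos := (@trigo.cos R).
Local Notation sin := (@trigo.sin R).
Implicit Types (x y z : 'rV[R]_3) (p q : H2 R) (F : polar_frame R).

Lemma mdotC x y : mdot x y = mdot y x.
Proof. by rewrite /mdot; ring. Qed.

Lemma mdotDl x y z : mdot (x + y) z = mdot x z + mdot y z.
Proof. by rewrite /mdot !mxE; ring. Qed.

Lemma mdotZl a x y : mdot (a *: x) y = a * mdot x y.
Proof. by rewrite /mdot !mxE; ring. Qed.

Lemma mdotDr x y z : mdot z (x + y) = mdot z x + mdot z y.
Proof. by rewrite !(mdotC z) mdotDl. Qed.

Lemma mdotZr a x y : mdot y (a *: x) = a * mdot y x.
Proof. by rewrite !(mdotC y) mdotZl. Qed.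

Lemma H2_mdot p : mdot p p = -1.
Proof. by case: p. Qed.

Lemma H2_gt0 p : 0 < hcoord p 0 0.
Proof. by case: p. Qed.

(** The reversed Cauchy-Schwarz inequality on the hyperboloid. Once squared it is an identity of
    Lagrange type, and the positive first coordinates settle the sign. *)
Lemma mdot_ge1 p q : 1 <= - mdot p q.
Proof.
have := H2_mdot p; have := H2_mdot q; have := H2_gt0 p; have := H2_gt0 q.
rewrite /mdot.
move: (hcoord p 0 0) (hcoord p 0 1) (hcoord p 0 2%:R) => p0 p1 p2.
move: (hcoord q 0 0) (hcoord q 0 1) (hcoord q 0 2%:R) => q0 q1 q2 hq hp eq ep.
have : (p1 * q1 + p2 * q2 + 1) ^+ 2 <= (p0 * q0) ^+ 2.
  rewrite -subr_ge0.
  have -> : (p0 * q0) ^+ 2 - (p1 * q1 + p2 * q2 + 1) ^+ 2 =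
     (p1 * q2 - p2 * q1) ^+ 2 + (p1 - q1) ^+ 2 + (p2 - q2) ^+ 2.
    have -> : (p0 * q0) ^+ 2 = (1 + p1 ^+ 2 + p2 ^+ 2) * (1 + q1 ^+ 2 + q2 ^+ 2).
      rewrite exprMn; congr (_ * _); lra.
    by ring.
  by rewrite !addr_ge0 ?sqr_ge0.
move=> h.
have pq0 : 0 <= p0 * q0 by rewrite mulr_ge0 // ltW.
case: (lerP (p1 * q1 + p2 * q2 + 1) (p0 * q0)) => [|lt]; first lra.
by nra.
Qed.

Lemma hdist_le p q r : 0 <= r -> (hdist p q <= r) = (- mdot p q <= cosh r).
Proof.
move=> r0; have [h0 he] := arcoshP (mdot_ge1 p q).
by rewrite /hdist -{2}he ler_cosh.
Qed.

Lemma mdot_scale_H2 (v : 'rV[R]_3) (k : R) : 0 < k -> mdot v v = - k ^+ 2 -> 0 < v 0 0 ->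
  exists p, hcoord p = k^-1 *: v.
Proof.
move=> k0 vv v0.
have h1 : mdot (k^-1 *: v) (k^-1 *: v) = -1.
  by rewrite mdotZl mdotZr vv; field; rewrite gt_eqF.
have h2 : 0 < (k^-1 *: v) 0 0 by rewrite mxE mulr_gt0 // invr_gt0.
by exists (HPoint h1 h2).
Qed.

(* The midpoint of p and q lies in both disks. *)
Lemma disks_meet_of_mdot p q r : 0 <= r -> - mdot p q <= cosh (2 * r) -> disks_meet r p q.
Proof.
move=> r0; rewrite cosh_double => h.
have a1 := mdot_ge1 p q; have c1 := cosh_ge1 r.
pose k := Num.sqrt (2 - 2 * mdot p q).
have k2 : k ^+ 2 = 2 - 2 * mdot p q by rewrite sqr_sqrtr //; lra.
have k0 : 0 < k by rewrite sqrtr_gt0; lra.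
have [||m me] := @mdot_scale_H2 (hcoord p + hcoord q) k k0.
- by rewrite mdotDl !mdotDr !H2_mdot (mdotC q) k2; lra.
- by rewrite mxE addr_gt0 // H2_gt0.
have kc : (2 - 2 * mdot p q) / 2 <= cosh r * k.
  rewrite -k2; have : k <= 2 * cosh r.
    rewrite -ler_sqr ?nnegrE; [|lra..].
    rewrite k2; nra.
  nra.
exists m; split; rewrite /disk /= hdist_le // me mdotZr mdotDr H2_mdot.
- rewrite -mulrN ler_pdivrMl // mulrC; nra.
- rewrite (mdotC q p) -mulrN ler_pdivrMl // mulrC; nra.
Qed.

(** Orthonormality of the frame says [M] J [M]^T = J, so J [M]^T J is a right inverse of [M], hence
    a left inverse. This gives [M]^T J [M] = J, whose entries express completeness of the frame. *)
Lemma frame_decomp F x :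
  x = - mdot (pole F) x *: hcoord (pole F)
      + (mdot (axis F) x *: axis F + mdot (side F) x *: side F).
Proof.
case: F => o a s /= oa os aa ss as0.
have oo := H2_mdot o.
pose J : 'M[R]_3 := diag_mx (\row_j (if j == 0 then -1 else 1)).
pose M : 'M[R]_3 := \matrix_(i, j) (if i == 0 then hcoord o 0 j
                   else if i == 1 then a 0 j else s 0 j).
have JJ : J *m J = 1%:M.
  apply/matrixP => i j; rewrite /J mul_diag_mx !mxE.
  by case: (i == j); case: (_ == 0); rewrite ?mulr1n ?mulr0n; ring.
have MJM : M *m (J *m M^T) = J.
  apply/matrixP => i j; rewrite mxE !big_ord_recl big_ord0 !mul_diag_mx !mxE /=.
  have -> : lift ord0 (lift ord0 ord0) = 2%:R :> 'I_3 by apply: val_inj.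
  have -> : lift ord0 ord0 = 1 :> 'I_3 by apply: val_inj.
  rewrite (_ : ord0 = 0) //.
  move: oo oa os aa ss as0; rewrite /mdot.
  case: (ord3P i) => ->; case: (ord3P j) => -> /=; rewrite ?mulr1n ?mulr0n; lra.
have MJ : (J *m M^T *m J) *m M = 1%:M.
  by apply: mulmx1C; rewrite mulmxA MJM JJ.
have MJM' : M^T *m J *m M = J.
  by rewrite -[RHS]mulmx1 -MJ !mulmxA JJ mul1mx.
apply/rowP => j.
have E i : - (o 0 i * o 0 j) + a 0 i * a 0 j + s 0 i * s 0 j = J i j.
  rewrite -MJM' mxE !big_ord_recl big_ord0 /J mul_mx_diag !mxE /=.
  ring.
transitivity (- x 0 0 * J 0 j + x 0 1 * J 1 j + x 0 2%:R * J 2%:R j).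
  rewrite /J !mxE.
  by case: (ord3P j) => -> /=; rewrite ?mulr1n ?mulr0n; ring.
by rewrite -!E !mxE /mdot; ring.
Qed.

Lemma mdot_frame F (x y z x' y' z' : R) :
  mdot (x *: hcoord (pole F) + (y *: axis F + z *: side F))
       (x' *: hcoord (pole F) + (y' *: axis F + z' *: side F))
  = - (x * x') + y * y' + z * z'.
Proof.
case: F => o a s /= oa os aa ss as0.
rewrite !(mdotDl, mdotDr, mdotZl, mdotZr) H2_mdot (mdotC a o) (mdotC s o) (mdotC s a).
rewrite oa os aa ss as0; ring.
Qed.

Lemma polarE F p b t : polar F p b t ->
  hcoord p = cosh b *: hcoord (pole F)
     + ((sinh b * cos t) *: axis F + (sinh b * sin t) *: side F).
Proof. by case=> _ _ ->; rewrite scalerDr !scalerA. Qed.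

Lemma polar_mdot F p q b t b' t' : polar F p b t -> polar F q b' t' ->
  - mdot p q = cosh b * cosh b' - sinh b * sinh b' * cos (t - t').
Proof.
move=> /polarE -> /polarE ->; rewrite mdot_frame cosB; ring.
Qed.

Lemma angle_exists (u v : R) : u ^+ 2 + v ^+ 2 = 1 ->
  exists2 t, 0 <= t < 2 * pi & cos t = u /\ sin t = v.
Proof.
move=> uv.
have u1 : -1 <= u <= 1.
  by apply/andP; split; nra.
have up : u \in `[(-1), 1] by rewrite in_itv.
have p0 := @pi_gt0 R; have a0 := acos_ge0 u1; have ap := acos_lepi u1.
have sv : Num.sqrt (1 - u ^+ 2) = `|v| by rewrite -sqrtr_sqr; congr Num.sqrt; lra.
case: (ger0P v) => v0.
  exists (acos u); first by apply/andP; split; lra.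
  by rewrite acosK // sin_acos // sv ger0_norm.
have u1' : u < 1 by nra.
have a0' : 0 < acos u by apply: acos_gt0; case/andP: u1 => -> _.
exists (2 * pi - acos u); first by apply/andP; split; lra.
have -> : 2 * pi - acos u = - acos u + pi *+ 2 by rewrite mulr2n; ring.
by rewrite cosD2pi sinD2pi cosN sinN acosK // sin_acos // sv ltr0_norm // opprK.
Qed.

Lemma polar_exists F p : exists b t, polar F p b t.
Proof.
have d := frame_decomp F p.
have X1 := mdot_ge1 (pole F) p.
move: d X1; set X := - mdot _ _; set Y := mdot _ _; set Z := mdot _ _ => d X1.
have e : - (X * X) + Y * Y + Z * Z = -1 by rewrite -(H2_mdot p) {1 2}d mdot_frame.
have [b0 cb] := arcoshP X1.
have sb0 := sinh_ge0 b0.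
have := cosh2Bsinh2 (arcosh X); rewrite cb => s2.
exists (arcosh X).
(* At the pole every angle is admissible, and 0 is taken. *)
case: (eqVneq (sinh (arcosh X)) 0) => s0.
  exists 0; split => //; first by have := @pi_gt0 R; rewrite lexx /=; lra.
  have Y0 : Y = 0 by rewrite s0 in s2; nra.
  have Z0 : Z = 0 by rewrite s0 in s2; nra.
  by rewrite {1}d cb s0 Y0 Z0 !scale0r addr0.
have unit_norm (S : R) : S != 0 -> X ^+ 2 - S ^+ 2 = 1 -> (Y / S) ^+ 2 + (Z / S) ^+ 2 = 1.
  move=> S0 XS; rewrite !expr_div_n -mulrDl (_ : Y ^+ 2 + Z ^+ 2 = S ^+ 2); last lra.
  by rewrite divff ?expf_neq0.
have [t t0 [ct st]] := angle_exists (unit_norm _ s0 s2).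
exists t; split=> //.
by rewrite {1}d cb ct st scalerDr !scalerA !(mulrC (sinh _)) !divfK.
Qed.

Lemma disk_radius F p q b t b' t' r : 0 <= r -> polar F p b t -> polar F q b' t' ->
  disk r p q -> `|b - b'| <= r.
Proof.
move=> r0 pp pq; rewrite /disk /= hdist_le // (polar_mdot pp pq) => h.
rewrite -ler_cosh // cosh_abs coshB; apply: le_trans h.
have s0 : 0 <= sinh b * sinh b'.
  by case: pp => b0 _ _; case: pq => b0' _ _; rewrite mulr_ge0 // sinh_ge0.
by have := cos_le1 (t - t'); nra.
Qed.

Lemma disks_meet_radius F p q b t b' t' r : 0 <= r ->
  polar F p b t -> polar F q b' t' -> disks_meet r p q -> `|b - b'| <= 2 * r.
Proof.
move=> r0 pp pq [x [xp xq]]; have [c [u px]] := polar_exists F x.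
have := disk_radius r0 pp px xp; have := disk_radius r0 pq px xq.
rewrite !ler_norml => /andP[h1 h2] /andP[h3 h4]; apply/andP; split; lra.
Qed.

(* For a point at distance b > r from the pole and at angle t from a ray, this
   says that the disk of radius r around the point meets the ray. *)
Definition near_ray (r b t : R) : Prop :=
  0 < cos t /\ (sinh b * sin t) ^+ 2 <= sinh r ^+ 2.

(** If the angle at the pole were not acute, [x] would be at distance at least [b > r] from [p].
    Otherwise the distance d from [p] to the line carrying the ray satisfies sinh d = sinh b |sin
    (t' - t)|, and d is at most the distance from [p] to [x]. *)
Lemma disk_near_ray F p (x : H2 R) b t b' t' r : 0 <= r -> r < b ->
  polar F p b t -> polar F x b' t' -> disk r p x -> near_ray r b (t' - t).
Proof.
move=> r0 rb pp px; rewrite /disk /= hdist_le // (polar_mdot pp px) -(opprB t' t) cosN.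
have [b0 _ _] := pp; have [b0' _ _] := px.
have sb := sinh_ge0 b0; have sb' := sinh_ge0 b0'.
have rb' : cosh r < cosh b by rewrite ltNge ler_cosh // -ltNge.
have c1 := cosh_ge1 b'; have c1r := cosh_ge1 r.
have := cosh2Bsinh2 b; have := cosh2Bsinh2 b'; have := cosh2Bsinh2 r.
have := cos2Dsin2 (t' - t).
have := mdot_ge1 p x; rewrite (polar_mdot pp px) -(opprB t' t) cosN.
rewrite /near_ray; move: (cos _) (sin _) => c s w1 cs er eb' eb h.
have ss0 : 0 <= sinh b * sinh b' by rewrite mulr_ge0.
have c0 : 0 < c.
  case: (ltrP 0 c) => // c0.
  have : sinh b * sinh b' * c <= 0 by nra.
  have : cosh b <= cosh b * cosh b' by nra.
  lra.
split=> //.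
(* A square is completed in [b']. As cosh^2 b' - sinh^2 b' = 1, the second summand is cosh^2 of the
   distance from [p] to the line. *)
have e : (cosh b * cosh b' - sinh b * sinh b' * c) ^+ 2
    = (cosh b * sinh b' - sinh b * c * cosh b') ^+ 2
      + (cosh b ^+ 2 - sinh b ^+ 2 * c ^+ 2) * (cosh b' ^+ 2 - sinh b' ^+ 2) by ring.
have : (cosh b * cosh b' - sinh b * sinh b' * c) ^+ 2 <= cosh r ^+ 2.
  by rewrite ler_sqr ?nnegrE //; lra.
have s2 : s ^+ 2 = 1 - c ^+ 2 by lra.
rewrite e eb' mulr1 [(sinh b * s) ^+ 2]exprMn s2.
have := sqr_ge0 (cosh b * sinh b' - sinh b * c * cosh b').
lra.
Qed.

(** The directions in which the disk is met form an arc centered at the direction of its center, of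
    half-width acos k with k^2 = 1 - (sinh r / sinh b)^2. *)
Lemma near_ray_cos r b : 0 < r -> r < b -> exists2 k, 0 < k <= 1 &
  forall t, near_ray r b t <-> k <= cos t.
Proof.
move=> r0 rb.
have sr := sinh_gt0 r0; have sb := sinh_gt0 (lt_trans r0 rb).
have srb : sinh r < sinh b.
  rewrite /Defs.sinh ltr_pM2r ?invr_gt0 //.
  have : expR r < expR b by rewrite ltr_expR.
  have : expR (- b) < expR (- r) by rewrite ltr_expR ltrN2.
  lra.
pose q := sinh r / sinh b.
have q0 : 0 < q by rewrite divr_gt0.
have q1 : q < 1 by rewrite ltr_pdivrMr // mul1r.
have k2 : Num.sqrt (1 - q ^+ 2) ^+ 2 = 1 - q ^+ 2 by rewrite sqr_sqrtr //; nra.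
have k0 : 0 < Num.sqrt (1 - q ^+ 2) by rewrite sqrtr_gt0; nra.
exists (Num.sqrt (1 - q ^+ 2)); first by apply/andP; split=> //; nra.
move=> t; have cs := cos2Dsin2 t.
have qe : sinh r = q * sinh b by rewrite divfK // gt_eqF.
have aux (S z w : R) : 0 < S -> ((S * z) ^+ 2 <= (w * S) ^+ 2) = (z ^+ 2 <= w ^+ 2).
  by move=> S0; rewrite mulrC !exprMn ler_pM2r // exprn_gt0.
rewrite /near_ray qe aux //; move: (q) q0 q1 k2 k0 => {qe}q q0 q1.
set k := Num.sqrt _ => k2 k0; split=> [[c0 s2]|h].
  by rewrite -ler_sqr ?nnegrE ?(ltW k0) ?(ltW c0) //; lra.
have c0 : 0 < cos t by apply: lt_le_trans h.
have : k ^+ 2 <= cos t ^+ 2 by rewrite ler_sqr ?nnegrE ?(ltW k0) ?(ltW c0).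
by split=> //; lra.
Qed.

(** The difference of two angles of [0, 2 pi) ranges over (-2 pi, 2 pi), so that being close modulo
    2 pi has a second, wrapped form. *)
Lemma cos_ge_acos (k x : R) : 0 < k <= 1 -> - (2 * pi) < x < 2 * pi -> k <= cos x ->
  `|x| <= acos k \/ 2 * pi - acos k <= `|x|.
Proof.
move=> k01 xp kx.
have ki : k \in `[(-1), 1].
  by case/andP: k01 => k0 k1; rewrite in_itv /=; apply/andP; split; lra.
have k1 : -1 <= k <= 1 by move: ki; rewrite in_itv.
have p0 := @pi_gt0 R; have a0 := acos_ge0 k1; have ap := acos_lepi k1.
have xn : `|x| < 2 * pi by rewrite ltr_norml.
have x0 := normr_ge0 x.
rewrite -cos_norm in kx.
have ai : acos k \in `[0, pi] by rewrite in_itv /= a0 ap.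
case: (lerP `|x| pi) => xpi.
  left; rewrite leNgt; apply/negP => h.
  have : cos `|x| < cos (acos k) by rewrite ltr_cos // in_itv /= x0 xpi.
  by rewrite acosK // ltNge kx.
right; rewrite leNgt; apply/negP => h.
have : cos (2 * pi - `|x|) < cos (acos k).
  by rewrite ltr_cos //; [lra | rewrite in_itv /=; apply/andP; split; lra].
have -> : 2 * pi - `|x| = - `|x| + pi *+ 2 by rewrite mulr2n; ring.
by rewrite cosD2pi cosN acosK // ltNge kx.
Qed.

Lemma cos_le_acos (k x : R) : 0 < k <= 1 -> `|x| <= acos k -> k <= cos x.
Proof.
move=> k01 xk.
have ki : k \in `[(-1), 1].
  by case/andP: k01 => k0 k1; rewrite in_itv /=; apply/andP; split; lra.
have k1 : -1 <= k <= 1 by move: ki; rewrite in_itv.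
have a0 := acos_ge0 k1; have ap := acos_lepi k1.
rewrite -cos_norm leNgt -{1}(acosK ki) ltr_cos ?in_itv /= ?a0 //.
  by rewrite -leNgt.
by rewrite normr_ge0 (le_trans xk).
Qed.

Local Open Scope classical_set_scope.

Lemma angles_le2pi F (O : set (H2 R)) a : angles F O a -> 0 <= a < 2 * pi.
Proof. by case=> x [b [_ []]]. Qed.

(** If the arc of the disk contains the direction 0, the interval from inf to sup may be nearly all
    of [0, 2 pi), but then the disk meets the polar axis. Otherwise the arc does not wrap around,
    and [t - acos k, t + acos k] contains the inf, the sup and all that lies between. *)
Lemma near_ray_of_angle F p b t r a : 0 < r -> r < b -> polar F p b t ->
  inf (angles F (disk r p)) <= a <= sup (angles F (disk r p)) ->
  near_ray r b (a - t) \/ near_ray r b (0 - t).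
Proof.
move=> r0 rb pp /andP[ia sa].
have [k k01 kP] := near_ray_cos r0 rb.
have [kt|tk] := lerP k (cos t).
  by right; apply/kP; rewrite sub0r cosN.
left; apply/kP.
have p0 := @pi_gt0 R.
have rg : [set u | angles F (disk r p) u] `<=` [set u | t - acos k <= u <= t + acos k].
  move=> u [x [c [xp px]]] /=.
  have /kP ku := disk_near_ray (ltW r0) rb pp px xp.
  have [_ /andP[t0 t2] _] := pp; have [_ /andP[u0 u2] _] := px.
  have [|hle|h] := cos_ge_acos k01 _ ku; first by apply/andP; split; lra.
    by move: hle; rewrite ler_norml => /andP[h1 h2]; apply/andP; split; lra.
  (* The wrapped case would put the direction 0 on the arc, against [tk]. *)
  suff : k <= cos t by rewrite leNgt tk.
  have [tu|ut] := lerP t u.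
    apply: cos_le_acos => //; rewrite ger0_norm //.
    by move: h; rewrite ger0_norm ?subr_ge0 //; lra.
  have -> : t = - (2 * pi - t) + pi *+ 2 by rewrite mulr2n; ring.
  rewrite cosD2pi cosN; apply: cos_le_acos => //.
  move: h; rewrite ltr0_norm ?subr_lt0 // => h.
  by rewrite ger0_norm; lra.
have ne : angles F (disk r p) !=set0.
  exists t, p, b; split=> //=; rewrite /disk /= hdist_le ?(ltW r0) // H2_mdot opprK.
  exact: cosh_ge1.
apply: cos_le_acos => //; rewrite ler_norml; apply/andP; split.
  have : t - acos k <= inf (angles F (disk r p)).
    by apply: lb_le_inf => // u /rg /andP[].
  lra.
have : sup (angles F (disk r p)) <= t + acos k.
  by apply: ge_sup => // u /rg /andP[].
lra.
Qed.

Lemma angles_inf_sup F p b t r : 0 <= r -> polar F p b t ->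
  forall u, angles F (disk r p) u ->
  inf (angles F (disk r p)) <= u <= sup (angles F (disk r p)).
Proof.
move=> r0 pp u au.
have l : lbound (angles F (disk r p)) 0 by move=> v /angles_le2pi /andP[].
have h : ubound (angles F (disk r p)) (2 * pi).
  by move=> v /angles_le2pi /andP[_ /ltW].
apply/andP; split; first by apply: ge_inf => //; exists 0.
by apply: ub_le_sup => //; exists (2 * pi).
Qed.

Lemma disks_meet_angle F p q r : disks_meet r p q ->
  exists2 u, angles F (disk r p) u & angles F (disk r q) u.
Proof.
move=> [x [xp xq]]; have [b [t px]] := polar_exists F x.
by exists t; exists x, b.
Qed.

Lemma disks_meet_pole F p q b t b' t' r : 0 <= r -> polar F p b t -> polar F q b' t' ->
  b <= r -> b' <= r -> disks_meet r p q.
Proof.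
move=> r0 pp pq br br'.
have [b0 _ _] := pp; have [b0' _ _] := pq.
have po : polar F (pole F) 0 0.
  split=> //; first by rewrite lexx mulr_gt0 // pi_gt0.
  by rewrite cosh0 scale1r /Defs.sinh oppr0 subrr mul0r scale0r addr0.
have s0 : sinh 0 = 0 by rewrite /Defs.sinh oppr0 subrr mul0r.
exists (pole F); split; rewrite /disk /= hdist_le // mdotC ?(polar_mdot po pp) ?(polar_mdot po pq);
  by rewrite cosh0 s0 !mul0r subr0 mul1r ler_cosh.
Qed.
End HyperbolicPlane.

(** * Counting disjoint disks that meet a ray *)

(** Removing the maximum and inducting: in increasing order, each value is at least [q] times the
    one before. *)
Lemma card_geometric (R : realFieldType) (V : finType) (A : {set V}) (f : V -> R) (q m : R) (k : nat) :
  0 <= q -> #|A| = k.+1 ->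
  (forall u v, u \in A -> v \in A -> u != v -> f u <= f v -> q * f u <= f v) ->
  (forall u, u \in A -> m <= f u) ->
  exists u, [/\ u \in A, forall v, v \in A -> f v <= f u & q ^+ k * m <= f u].
Proof.
move=> q0; elim: k A => [|k IH] A cA gap mA.
  have /cards1P[u Au] : #|A| == 1%N by rewrite cA.
  exists u; rewrite Au set11; split=> // [v|]; first by rewrite inE => /eqP ->.
  by rewrite expr0 mul1r mA // Au set11.
have [u0 u0A] : exists u, u \in A by apply/card_gt0P; rewrite cA.
have [u uA umax] : exists2 u, u \in A & forall v, v \in A -> f v <= f u.
  by case: (Order.TotalTheory.arg_maxP f u0A) => u uA h; exists u.
have cA' : #|A :\ u| = k.+1 by move: (cardsD1 u A); rewrite uA cA; case.
have [v [vA vmax vm]] : exists v, [/\ v \in A :\ u, forall w, w \in A :\ u -> f w <= f v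
     & q ^+ k * m <= f v].
  apply: IH => // [x y|x]; rewrite !inE.
    by move=> /andP[_ xA] /andP[_ yA]; exact: gap.
  by move=> /andP[_ xA]; exact: mA.
exists u; split=> //.
move: vA; rewrite !inE => /andP[vu vA].
apply: le_trans (gap v u vA uA vu (umax v vA)).
by rewrite exprS -mulrA ler_wpM2l.
Qed.

(** * Fermi coordinates along a ray and the gaps between disjoint disks *)

Section Separation.
Variable R : realType.
Implicit Types (c H D Z X Y r b t : R).

(* D = sqrt (1 + Z^2) is convex in Z, so the left-hand side is at most its
   largest value over Z, Z' in {0, sqrt (c^2 - 1)}. *)
Lemma chord_bound c H M D Z D' Z' : 1 < c -> 0 <= H -> H <= M -> c * H <= M ->
  c ^+ 2 * H - (c ^+ 2 - 1) <= M ->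
  0 < D -> 0 <= Z -> D ^+ 2 = 1 + Z ^+ 2 -> D <= c ->
  0 < D' -> 0 <= Z' -> D' ^+ 2 = 1 + Z' ^+ 2 -> D' <= c ->
  D * D' * H - Z * Z' <= M.
Proof.
move=> c1 H0 M0 M1 M2 D0 Z0 DZ Dc D0' Z0' DZ' Dc'.
pose z := Num.sqrt (c ^+ 2 - 1).
have z2 : z ^+ 2 = c ^+ 2 - 1 by rewrite sqr_sqrtr //; nra.
have z0 : 0 < z by rewrite sqrtr_gt0; nra.
have chord d y : 0 < d -> 0 <= y -> d ^+ 2 = 1 + y ^+ 2 -> d <= c ->
    exists2 s, 0 <= s <= 1 & y = z * s /\ d <= 1 + (c - 1) * s.
  move=> d0 y0 dy dc.
  have s0 : 0 <= y / z by rewrite divr_ge0 // ltW.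
  have s1 : y / z <= 1 by rewrite ler_pdivrMr // mul1r -ler_sqr ?nnegrE ?(ltW z0) //; nra.
  exists (y / z); first by rewrite s0.
  split; first by rewrite mulrC divfK // gt_eqF.
  have ye : y = z * (y / z) by rewrite mulrC divfK // gt_eqF.
  move: (y / z) s0 s1 ye => s s0 s1 ye.
  rewrite -ler_sqr ?nnegrE ?(ltW d0) //; last by nra.
  rewrite dy ye exprMn z2 -subr_ge0.
  have -> : (1 + (c - 1) * s) ^+ 2 - (1 + (c ^+ 2 - 1) * s ^+ 2)
    = 2 * ((c - 1) * (s * (1 - s))) by ring.
  by rewrite !mulr_ge0 //; lra.
have [s /andP[s0 s1] [-> hD]] := chord D Z D0 Z0 DZ Dc.
have [s' /andP[s0' s1'] [-> hD']] := chord D' Z' D0' Z0' DZ' Dc'.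
have DD : D * D' <= (1 + (c - 1) * s) * (1 + (c - 1) * s').
  by apply: ler_pM => //; exact: ltW.
have := ler_wpM2r H0 DD.
have -> : z * s * (z * s') = (c ^+ 2 - 1) * (s * s') by rewrite -z2; ring.
(* The bound is bilinear in [s] and [s'], with corner values H, c H and c^2 H - (c^2 - 1), so it is
   an average of these with the weights below. *)
move=> h; apply: (@le_trans _ _ ((1 - s) * (1 - s') * H
   + (s * (1 - s') + s' * (1 - s)) * (c * H)
   + s * s' * (c ^+ 2 * H - (c ^+ 2 - 1)))); first by lra.
have -> : M = (1 - s) * (1 - s') * M + (s * (1 - s') + s' * (1 - s)) * M + s * s' * M by ring.
have w (a x y : R) : 0 <= a -> x <= y -> a * x <= a * y by move=> ? ?; exact: ler_wpM2l.
by apply: lerD; [apply: lerD|]; apply: w => //; rewrite ?addr_ge0 ?mulr_ge0 //; lra.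
Qed.

Definition fermi_dist Z := Num.sqrt (1 + Z ^+ 2).

(* For a point with coordinates (X, Y, Z) on the hyperboloid, let s be the
   signed distance from the pole to its projection on the line Z = 0, and d its
   distance to that line: this is exp s, and [fermi_dist] is cosh d. *)
Definition fermi_exp X Y Z := (X + Y) / fermi_dist Z.

Lemma fermi_dist_gt0 Z : 0 < fermi_dist Z.
Proof. by rewrite sqrtr_gt0; have := sqr_ge0 Z; lra. Qed.

Lemma fermi_dist_sqr Z : fermi_dist Z ^+ 2 = 1 + Z ^+ 2.
Proof. by rewrite sqr_sqrtr //; have := sqr_ge0 Z; lra. Qed.

Lemma fermi_dist_ge1 Z : 1 <= fermi_dist Z.
Proof.
have := fermi_dist_sqr Z; have := fermi_dist_gt0 Z; have := sqr_ge0 Z; nra.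
Qed.

Lemma fermi_expD X Y Z : fermi_exp X Y Z * fermi_dist Z = X + Y.
Proof. by rewrite divfK // gt_eqF // fermi_dist_gt0. Qed.

(** Since (X + Y)(X - Y) = 1 + Z^2 = cosh^2 d, this is X - Y = exp (-s) cosh d, the counterpart of
    [fermi_expD]. *)
Lemma fermi_expV X Y Z : X ^+ 2 = 1 + Y ^+ 2 + Z ^+ 2 -> 0 < X -> 0 <= Y ->
  fermi_dist Z / fermi_exp X Y Z = X - Y.
Proof.
move=> XYZ X0 Y0; rewrite /fermi_exp invf_div mulrA -expr2 fermi_dist_sqr.
apply: (@mulIf _ (X + Y)); first by rewrite gt_eqF //; lra.
rewrite divfK ?gt_eqF //; lra.
Qed.

Lemma fermi_exp_ge1 X Y Z : X ^+ 2 = 1 + Y ^+ 2 + Z ^+ 2 -> 0 < X -> 0 <= Y ->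
  1 <= fermi_exp X Y Z.
Proof.
move=> XYZ X0 Y0; rewrite /fermi_exp ler_pdivlMr ?fermi_dist_gt0 // mul1r.
rewrite -ler_sqr ?nnegrE ?(ltW (fermi_dist_gt0 _)) ?addr_ge0 ?(ltW X0) //.
rewrite fermi_dist_sqr; nra.
Qed.

Lemma fermi_X X Y Z : X ^+ 2 = 1 + Y ^+ 2 + Z ^+ 2 -> 0 < X -> 0 <= Y ->
  2 * X = fermi_dist Z * (fermi_exp X Y Z + (fermi_exp X Y Z)^-1).
Proof.
by move=> h X0 Y0; rewrite mulrDr fermi_expV // (mulrC (fermi_dist Z)) fermi_expD; ring.
Qed.

(** With q = exp (s' - s), the right-hand side is cosh d cosh d' cosh (s' - s): the coordinate along
    the ray enters only through its difference. *)
Lemma fermi_ratio X Y Z X' Y' Z' :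
  X ^+ 2 = 1 + Y ^+ 2 + Z ^+ 2 -> 0 < X -> 0 <= Y ->
  X' ^+ 2 = 1 + Y' ^+ 2 + Z' ^+ 2 -> 0 < X' -> 0 <= Y' ->
  let q := fermi_exp X' Y' Z' / fermi_exp X Y Z in
  X * X' - Y * Y' = fermi_dist Z * fermi_dist Z' * ((q + q^-1) / 2).
Proof.
move=> h X0 Y0 h' X0' Y0' q.
have e1 := fermi_expV h X0 Y0; have e2 := fermi_expV h' X0' Y0'.
have e3 := fermi_expD X Y Z; have e4 := fermi_expD X' Y' Z'.
have -> : fermi_dist Z * fermi_dist Z' * ((q + q^-1) / 2) =
  ((fermi_exp X' Y' Z' * fermi_dist Z') * (fermi_dist Z / fermi_exp X Y Z)
  + (fermi_exp X Y Z * fermi_dist Z) * (fermi_dist Z' / fermi_exp X' Y' Z')) / 2.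
  rewrite /q; move: (fermi_exp X' Y' Z') (fermi_exp X Y Z) => a b'.
  by rewrite invf_div; ring.
by rewrite e1 e2 e3 e4; field.
Qed.

Lemma cosh_sub_expR r : 0 < r -> [/\ 1 < expR r, 1 < cosh r & 2 * cosh r = expR r + (expR r)^-1].
Proof.
move=> r0; have e1 : 1 < expR r by rewrite expR_gt1.
have e : 2 * cosh r = expR r + (expR r)^-1 by rewrite coshE; field; rewrite gt_eqF ?expR_gt0.
split=> //.
have e0 : 0 < expR r by lra.
have ee : expR r * (expR r)^-1 = 1 by rewrite mulfV // gt_eqF.
move: e e1 e0 ee; move: (expR r) (expR r)^-1 => E F; nra.
Qed.

Lemma fermi_gap_small r X Y Z X' Y' Z' :
  0 < r -> 2 * cosh r <= 5 ->
  X ^+ 2 = 1 + Y ^+ 2 + Z ^+ 2 -> 0 < X -> 0 <= Y -> 0 <= Z -> fermi_dist Z <= cosh r ->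
  X' ^+ 2 = 1 + Y' ^+ 2 + Z' ^+ 2 -> 0 < X' -> 0 <= Y' -> 0 <= Z' -> fermi_dist Z' <= cosh r ->
  cosh (2 * r) < X * X' - Y * Y' - Z * Z' ->
  fermi_exp X Y Z <= fermi_exp X' Y' Z' ->
  expR r * fermi_exp X Y Z <= fermi_exp X' Y' Z'.
Proof.
move=> r0 c5 h X0 Y0 Z0 dZ h' X0' Y0' Z0' dZ'.
rewrite (fermi_ratio h X0 Y0 h' X0' Y0') cosh_double => far le_s.
have [e1 c1 ce] := cosh_sub_expR r0.
have s1 := fermi_exp_ge1 h X0 Y0.
have s0 : 0 < fermi_exp X Y Z by lra.
rewrite -ler_pdivlMr // leNgt; apply/negP => q_lt.
have q1 : 1 <= fermi_exp X' Y' Z' / fermi_exp X Y Z by rewrite ler_pdivlMr // mul1r.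
have := le_addV q1 (ltW q_lt).
move: (_ / fermi_exp X Y Z) q1 q_lt far => q q1 q_lt far hq.
have Vq : 0 < q^-1 by rewrite invr_gt0; lra.
have Hc : (q + q^-1) / 2 <= cosh r by lra.
have H0 : 0 <= (q + q^-1) / 2 by lra.
move: ((q + q^-1) / 2) Hc H0 far => H Hc H0; apply/negP; rewrite -leNgt.
move: (cosh r) c1 Hc c5 dZ dZ' => c c1 Hc c5 dZ dZ'.
have c0 : 0 <= c by lra.
have cH := ler_wpM2l c0 Hc; have ccH := ler_wpM2l (mulr_ge0 c0 c0) Hc.
have c2 : 1 <= c * c by nra.
(* The tight corner: 2 c^2 - 1 - (c^3 - (c^2 - 1)) = (c - 1)(2 c + 2 - c^2). *)
have c3 : 0 <= (c - 1) * (2 * c + 2 - c * c) by apply: mulr_ge0; nra.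
apply: (@chord_bound c) => //; rewrite ?fermi_dist_sqr ?fermi_dist_gt0 ?expr2 //; nra.
Qed.

Lemma fermi_gap_large r X Y Z X' Y' Z' :
  0 < r -> 5 <= 2 * cosh r ->
  X ^+ 2 = 1 + Y ^+ 2 + Z ^+ 2 -> 0 < X -> 0 <= Y -> 0 <= Z -> fermi_dist Z <= cosh r ->
  X' ^+ 2 = 1 + Y' ^+ 2 + Z' ^+ 2 -> 0 < X' -> 0 <= Y' -> 0 <= Z' -> fermi_dist Z' <= cosh r ->
  cosh (2 * r) < X * X' - Y * Y' - Z * Z' ->
  fermi_exp X Y Z <= fermi_exp X' Y' Z' ->
  5 * fermi_exp X Y Z <= fermi_exp X' Y' Z'.
Proof.
move=> r0 c5 h X0 Y0 Z0 dZ h' X0' Y0' Z0' dZ'.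
rewrite (fermi_ratio h X0 Y0 h' X0' Y0') cosh_double => far le_s.
have s1 := fermi_exp_ge1 h X0 Y0.
have s0 : 0 < fermi_exp X Y Z by lra.
rewrite -ler_pdivlMr // leNgt; apply/negP => q_lt.
have q1 : 1 <= fermi_exp X' Y' Z' / fermi_exp X Y Z by rewrite ler_pdivlMr // mul1r.
have := le_addV q1 (ltW q_lt).
move: (_ / fermi_exp X Y Z) q1 q_lt far => q q1 q_lt far hq.
have Vq : 0 < q^-1 by rewrite invr_gt0; lra.
have H0 : 0 <= (q + q^-1) / 2 by lra.
(* A ratio below 5 gives H <= (5 + 1/5) / 2 = 13/5. *)
have Hc : 10 * ((q + q^-1) / 2) <= 26 by lra.
move: ((q + q^-1) / 2) Hc H0 far => H Hc H0; apply/negP; rewrite -leNgt.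
move: (cosh r) c5 dZ dZ' => c c5 dZ dZ'.
have c0 : 0 <= c by lra.
have cH := ler_wpM2l c0 Hc; have ccH := ler_wpM2l (mulr_ge0 c0 c0) Hc.
have c2 : 25 <= 4 * (c * c) by nra.
apply: (@chord_bound c) => //; rewrite ?fermi_dist_sqr ?fermi_dist_gt0 ?expr2 //; nra.
Qed.

(* exp b <= exp s * exp d, the triangle inequality through the foot of the
   perpendicular to the ray. *)
Lemma fermi_triangle r b X Y Z : 0 < r -> 0 <= b -> X = cosh b ->
  X ^+ 2 = 1 + Y ^+ 2 + Z ^+ 2 -> 0 < X -> 0 <= Y -> 0 <= Z -> fermi_dist Z <= cosh r ->
  expR b <= expR r * fermi_exp X Y Z.
Proof.
move=> r0 b0 Xb h X0 Y0 Z0 dZ.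
have [e1 c1 ce] := cosh_sub_expR r0.
have s1 := fermi_exp_ge1 h X0 Y0.
have D1 := fermi_dist_ge1 Z; have D2 := fermi_dist_sqr Z.
have d1 : 1 <= fermi_dist Z + Z by lra.
have dV : (fermi_dist Z + Z)^-1 = fermi_dist Z - Z.
  apply: (@mulfI _ (fermi_dist Z + Z)); first by rewrite gt_eqF //; lra.
  by rewrite mulfV ?gt_eqF //; lra.
have dE : fermi_dist Z + Z <= expR r.
  by apply: le_of_addV; [lra | exact: ltW | rewrite dV -ce; lra].
have Xe := fermi_X h X0 Y0.
have bP : expR b <= (fermi_dist Z + Z) * fermi_exp X Y Z.
  apply: le_of_addV; [exact: expR_gt0 | nra|].
  have -> : expR b + (expR b)^-1 = 2 * X by rewrite Xb coshE; field; rewrite gt_eqF ?expR_gt0.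
  rewrite Xe (invfM (fermi_dist Z + Z)) dV.
  have : (fermi_exp X Y Z)^-1 <= 1 by rewrite invf_le1 //; lra.
  have : 0 < (fermi_exp X Y Z)^-1 by rewrite invr_gt0; lra.
  move: (fermi_exp X Y Z) (fermi_exp X Y Z)^-1 (fermi_dist Z) s1 Z0 => a a' d ? ? ? ?.
  rewrite -subr_ge0.
  have -> : (d + Z) * a + (d - Z) * a' - d * (a + a') = Z * (a - a') by ring.
  by rewrite mulr_ge0 //; lra.
apply: (le_trans bP); apply: ler_wpM2r; lra.
Qed.

End Separation.

(** * Numerical estimates, by induction in steps of two because 3K/2 then grows by the integer 3 *)

Lemma two_step_ind (P : nat -> Prop) : P 2 -> P 3 -> (forall K, 1 < K -> P K -> P K.+2)%N ->
  forall K, (1 < K)%N -> P K.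
Proof.
move=> p2 p3 pS K; elim/ltn_ind: K => -[|[|[|[|K]]]] // IH _.
by apply: pS => //; apply: IH.
Qed.

Section NumericBounds.
Variable R : realFieldType.
Variable y : R.
Hypotheses (y0 : 0 <= y) (y_le : y <= 747 / 100).

Let y2_le : y ^+ 2 <= 56.
Proof. by rewrite expr2; have := ler_pM y0 y0 y_le y_le; lra. Qed.

Let y3_le : y ^+ 3 <= 417.
Proof.
have h : y * y <= 747 / 100 * (747 / 100) by exact: ler_pM.
by rewrite exprS expr2; have := ler_pM y0 (mulr_ge0 y0 y0) y_le h; lra.
Qed.

Let ler_X (q : R) (j k : nat) : 1 <= q -> (j <= k)%N -> q ^+ j <= q ^+ k.
Proof. by move=> q1 jk; exact: ler_weXn2l. Qed.

(** With y = exp 2, this refutes the inequality 529 * 25^k < 169 y^K that [card_side_first] derives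
    from k + 2 centers, since 529/169 > 3. *)
Lemma exp_le_25 K : (1 < K)%N -> forall k, (3 * K <= 2 * k.+2)%N ->
  y ^+ K <= 3 * 25 ^+ k.
Proof.
move: K; apply: two_step_ind => [k hk|k hk|K K1 IH k hk].
- have : 25 ^+ 1 <= 25 ^+ k :> R by apply: ler_X; [lra | lia].
  by rewrite expr1; have := y2_le; lra.
- have : 25 ^+ 3 <= 25 ^+ k :> R by apply: ler_X; [lra | lia].
  have := y2_le; have := y3_le; lra.
- have [j kE] : exists j, k = (j + 3)%N by exists (k - 3)%N; lia.
  have := IH j ltac:(lia); rewrite kE exprD.
  have e : y ^+ K.+2 = y ^+ K * y ^+ 2 by rewrite -exprD addn2.
  rewrite e.
  have p0 : 0 <= y ^+ K by exact: exprn_ge0.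
  have := ler_wpM2l p0 y2_le.
  lra.
Qed.

(** The factor 337/100 is just below 46 * 81 / (13 * 85), the constant that arises in [card_side].
    The tight case is K = 3, k = 3, where 100 y^3 <= 41700 meets 337 * 125 = 42125. *)
Lemma exp_le_5 K : (1 < K)%N -> forall k, (3 * K < 2 * k.+2)%N ->
  100 * y ^+ K <= 337 * 5 ^+ k.
Proof.
move: K; apply: two_step_ind => [k hk|k hk|K K1 IH k hk].
- have : 5 ^+ 2 <= 5 ^+ k :> R by apply: ler_X; [lra | lia].
  have := y2_le; have := y3_le; lra.
- have : 5 ^+ 3 <= 5 ^+ k :> R by apply: ler_X; [lra | lia].
  have := y2_le; have := y3_le; lra.
- have [j kE] : exists j, k = (j + 3)%N by exists (k - 3)%N; lia.
  have := IH j ltac:(lia); rewrite kE exprD.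
  have e : y ^+ K.+2 = y ^+ K * y ^+ 2 by rewrite -exprD addn2.
  rewrite e.
  have p0 : 0 <= y ^+ K by exact: exprn_ge0.
  have := ler_wpM2l p0 y2_le.
  lra.
Qed.

End NumericBounds.

Lemma card_split_first (K n : nat) : (1 < K)%N -> (3 * K <= 2 * n)%N ->
  exists k, n = (k + 2).+1.
Proof. by move=> K1 h; exists (n - 3)%N; lia. Qed.

Lemma card_split (K n : nat) : (1 < K)%N -> (3 * K < 2 * n)%N ->
  exists k, n = (k + 3).+1.
Proof. by move=> K1 h; exists (n - 4)%N; lia. Qed.

(** As cosh r >= exp r / 2, the factor cosh r from [top_gap] cancels one power of E = exp r: in the
    first layer, all s but the largest share a range of length about r. *)
Lemma square_root_step (R : realFieldType) (E c p : R) :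
  46 * c * p < 13 * E ^+ 2 -> E <= 2 * c -> 0 < E -> 0 <= p -> 23 * p < 13 * E.
Proof.
move=> h Ec E0 p0; have := ler_wpM2r p0 Ec.
rewrite -(ltr_pM2r E0); lra.
Qed.

(** * Disks of one layer on one side of one ray *)

Section OneSide.
Variables (R : realType) (V : finType) (A : {set V}) (r rho : R) (K : nat).
Variables (b Y Z : V -> R).
Local Notation X u := (cosh (b u)).
Hypotheses (r0 : 0 < r) (K1 : (1 < K)%N) (rK : r < K%:R).
Hypothesis b_ge0 : forall u, u \in A -> 0 <= b u.
Hypothesis hyperboloid : forall u, u \in A -> X u ^+ 2 = 1 + Y u ^+ 2 + Z u ^+ 2.
Hypothesis Y_ge0 : forall u, u \in A -> 0 <= Y u.
Hypothesis Z_ge0 : forall u, u \in A -> 0 <= Z u.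
Hypothesis near : forall u, u \in A -> fermi_dist (Z u) <= cosh r.
Hypothesis far : forall u v, u \in A -> v \in A -> u != v ->
  cosh (2 * r) < X u * X v - Y u * Y v - Z u * Z v.
Hypothesis layer : forall u, u \in A -> rho <= b u < rho + 2 * r.

Local Notation s u := (fermi_exp (X u) (Y u) (Z u)).

Let X_gt0 u : 0 < X u. Proof. by have := cosh_ge1 (b u); lra. Qed.

Let s_ge1 u : u \in A -> 1 <= s u.
Proof. by move=> uA; apply: fermi_exp_ge1; rewrite ?hyperboloid ?Y_ge0. Qed.

Let XY_le u : u \in A -> X u + Y u <= expR (b u).
Proof.
move=> uA; rewrite expR_cosh_sinh lerD2l.
rewrite -ler_sqr ?nnegrE ?Y_ge0 ?sinh_ge0 ?b_ge0 //.
have := cosh2Bsinh2 (b u); have := hyperboloid uA; have := sqr_ge0 (Z u); lra.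
Qed.

Let s_le u : u \in A -> s u <= expR (b u).
Proof.
move=> uA; apply: le_trans (XY_le uA); rewrite -(fermi_expD _ _ (Z u)).
have := s_ge1 uA; have := fermi_dist_ge1 (Z u); nra.
Qed.

Let expR_b_lt u : u \in A -> expR (b u) < expR rho * expR r ^+ 2.
Proof.
move=> uA; rewrite -expRM_natl -expRD ltr_expR.
by case/andP: (layer uA).
Qed.

Let expR_2r_lt : expR r ^+ 2 <= expR 2 ^+ K.
Proof. by rewrite -!expRM_natl ler_expR; move: rK; lra. Qed.

Let gap_small u v : 2 * cosh r <= 5 -> u \in A -> v \in A -> u != v -> s u <= s v ->
  expR r * s u <= s v.
Proof.
move=> c5 uA vA uv; apply: fermi_gap_small => //;
  by rewrite ?hyperboloid ?Y_ge0 ?Z_ge0 ?near ?far.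
Qed.

Let gap_large u v : 5 <= 2 * cosh r -> u \in A -> v \in A -> u != v -> s u <= s v ->
  5 * s u <= s v.
Proof.
move=> c5 uA vA uv; apply: (fermi_gap_large r0) => //;
  by rewrite ?hyperboloid ?Y_ge0 ?Z_ge0 ?near ?far.
Qed.

(** Write c = cosh r, D for [fermi_dist], and q >= 5 for the ratio of the two [s]. Dropping the
    nonnegative [Z v * Z u] and using 25 <= 4 c^2, one gets (46/25) c^2 <= 2 c^2 - 1 < D_v D_u (q +
    1/q) / 2 <= (13/25) c D_u q. Finally D_u [s u] = X + Y <= exp (b u). *)
Let top_gap u v : 5 <= 2 * cosh r -> u \in A -> v \in A -> v != u -> s v <= s u ->
  46 * cosh r * s v < 13 * expR (b u).
Proof.
move=> c5 uA vA uv le_s.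
have h5 := gap_large c5 vA uA uv le_s.
have f := far vA uA uv.
have sv0 : 0 < s v by have := s_ge1 vA; lra.
have ZZ : 0 <= Z v * Z u by rewrite mulr_ge0 ?Z_ge0.
have fr := fermi_ratio (hyperboloid vA) (X_gt0 v) (Y_ge0 vA) (hyperboloid uA) (X_gt0 u) (Y_ge0 uA).
have xy := XY_le uA.
rewrite -(fermi_expD _ _ (Z u)) in xy.
rewrite cosh_double fr in f.
have qE : s u = s u / s v * s v by rewrite divfK // gt_eqF.
have q5 : 5 <= s u / s v by rewrite ler_pdivlMr.
rewrite qE in xy.
move: f fr q5 xy; move: (s u / s v) => q f _ q5 xy.
have qV : q^-1 <= q / 25.
  rewrite -[q^-1]div1r ler_pdivrMr; last lra.
  nra.
have Dv := near vA; have Du0 := fermi_dist_gt0 (Z u); have Dv0 := fermi_dist_gt0 (Z v).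
have hq : (q + q^-1) / 2 <= 13 / 25 * q by lra.
move: f xy Dv Du0 Dv0 sv0 c5.
move: (fermi_dist (Z v)) (fermi_dist (Z u)) (s v) (cosh r) (expR (b u)) => d d' t c e.
move=> f xy Dv Du0 Dv0 sv0 c5.
have c0 : 0 < c by lra.
have h1 : d * d' * ((q + q^-1) / 2) <= d * d' * (13 / 25 * q) by apply: ler_wpM2l => //; nra.
have h2 : d * (d' * q) <= c * (d' * q) by apply: ler_wpM2r => //; rewrite mulr_ge0 //; lra.
have c2 : 25 <= 4 * (c * c) by nra.
have h3 : 46 * c * c < 13 * c * (d' * q) by lra.
have h4 : 46 * c < 13 * (d' * q) by rewrite -(ltr_pM2r c0); lra.
have : 46 * c * t < 13 * (d' * q) * t by rewrite ltr_pM2r.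
lra.
Qed.

(** Below the top center the values [s] grow by factors of 5; [top_gap] then leads from the second
    largest to the outer end of the layer. *)
Let large_top (m : R) k : 5 <= 2 * cosh r -> #|A| = k.+2 -> (forall u, u \in A -> m <= s u) ->
  46 * cosh r * (5 ^+ k * m) < 13 * (expR rho * expR r ^+ 2).
Proof.
move=> c5 cA mA.
have [u0 u0A] : exists u, u \in A by apply/card_gt0P; rewrite cA.
have [u uA umax] : exists2 u, u \in A & forall v, v \in A -> s v <= s u.
  by case: (Order.TotalTheory.arg_maxP (fun u => s u) u0A) => u uA h; exists u.
have cA' : #|A :\ u| = k.+1 by move: (cardsD1 u A); rewrite uA cA; case.
have [||||v [vA vmax vm]] := @card_geometric R V (A :\ u) (fun u => s u) 5 m k.
- by [].
- by [].
- by move=> x y; rewrite !inE => /andP[_ xA] /andP[_ yA]; exact: gap_large.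
- by move=> x; rewrite !inE => /andP[_ xA]; exact: mA.
move: vA; rewrite !inE => /andP[vu vA].
have h1 := top_gap c5 uA vA vu (umax v vA).
have h2 := expR_b_lt uA.
have c0 : 0 <= 46 * cosh r by lra.
have := ler_wpM2l c0 vm; lra.
Qed.

Lemma card_side_first : rho = 0 -> (2 * #|A| < 3 * K)%N.
Proof.
move=> rho0; rewrite ltnNge; apply/negP => hA.
have [e1 c1 ce] := cosh_sub_expR r0.
case: (lerP (2 * cosh r) 5) => c5.
  (* As K >= 2 there are at least three centers, so the largest [s] is at least exp (2r), which is
     the outer end of the layer. *)
  have [k cA] := card_split_first K1 hA.
  have [||||u [uA _ us]] := @card_geometric R V A (fun u => s u) (expR r) 1 (k + 2).
  - exact: expR_ge0.
  - exact: cA.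
  - by move=> u v; exact: gap_small.
  - exact: s_ge1.
  have := s_le uA; have := expR_b_lt uA; rewrite rho0 expR0 mul1r => h1 h2.
  have : expR r ^+ 2 <= expR r ^+ (k + 2) by apply: ler_weXn2l; [exact: ltW | exact: leq_addl].
  lra.
have [k cA] : exists k, #|A| = k.+2.
  by have [k ->] := card_split_first K1 hA; exists k.+1; rewrite addn2.
have := large_top (ltW c5) cA s_ge1; rewrite rho0 expR0 mul1r mulr1 => h.
have e2 := @expR2_le R.
have hk := exp_le_25 (ltW (expR_gt0 2)) e2 K1 (k := k) ltac:(by rewrite -cA).
have E0 := expR_gt0 r.
have p0 : 0 <= 5 ^+ k :> R by exact: exprn_ge0.
have h1 : 23 * 5 ^+ k < 13 * expR r.
  apply: (square_root_step h) => //.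
  have : 0 < (expR r)^-1 by rewrite invr_gt0.
  lra.
have h2 : (23 * 5 ^+ k) ^+ 2 < (13 * expR r) ^+ 2 by rewrite ltr_sqr ?nnegrE //; lra.
move: h2; rewrite !exprMn -exprM mulnC exprM.
have -> : 5 ^+ 2 = 25 :> R by lra.
have -> : 23 ^+ 2 = 529 :> R by lra.
have -> : 13 ^+ 2 = 169 :> R by lra.
have := le_trans expR_2r_lt hk; move: (25 ^+ k) (exprn_ge0 k (ler0n R 25)) => q q0.
lra.
Qed.

Lemma card_side : 2 * r <= rho -> (2 * #|A| <= 3 * K)%N.
Proof.
move=> r_rho; rewrite leqNgt; apply/negP => hA.
have [e1 c1 ce] := cosh_sub_expR r0.
have E0 := expR_gt0 r; have P0 := expR_gt0 rho.
case: (lerP (2 * cosh r) 5) => c5.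
  (* There are at least four centers. By [fermi_triangle] the smallest [s] is at least exp (rho -
     r), so the largest is at least exp (rho + 2r). *)
  have [k cA] := card_split K1 hA.
  have [||||u [uA _ us]] :=
    @card_geometric R V A (fun u => s u) (expR r) (expR rho / expR r) (k + 3).
  - exact: expR_ge0.
  - exact: cA.
  - by move=> u v; exact: gap_small.
  - move=> u uA; rewrite ler_pdivrMr // mulrC.
    have := fermi_triangle r0 (b_ge0 uA) erefl (hyperboloid uA) (X_gt0 u) (Y_ge0 uA) (Z_ge0 uA) (near uA).
    by apply: le_trans; rewrite ler_expR; case/andP: (layer uA).
  have h1 := s_le uA; have h2 := expR_b_lt uA.
  have h3 : expR r ^+ 3 <= expR r ^+ (k + 3) by apply: ler_weXn2l; [exact: ltW | exact: leq_addl].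
  have m0 : 0 <= expR rho / expR r by rewrite divr_ge0 // ltW.
  have := ler_wpM2r m0 h3.
  have -> : expR r ^+ 3 * (expR rho / expR r) = expR rho * expR r ^+ 2.
    by field; rewrite gt_eqF.
  lra.
have [k cA] : exists k, #|A| = k.+2.
  by have [k ->] := card_split K1 hA; exists k.+2; rewrite addn3.
have c0 : 0 < cosh r by lra.
have E45 : 9 / 2 <= expR r.
  rewrite leNgt; apply/negP => h.
  have := le_addV (ltW e1) (ltW h); lra.
(* From 2 X <= c (s + 1/s) and X >= cosh (2r) follows s >= exp r >= 9/2. Hence 1/s <= (4/81) s and
   exp rho <= 2 X <= (85/81) c s. *)
have mA u : u \in A -> 81 * expR rho / (85 * cosh r) <= s u.
  have c85 : 0 < 85 * cosh r by lra.
  move=> uA; rewrite ler_pdivrMr //.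
  have Xe := fermi_X (hyperboloid uA) (X_gt0 u) (Y_ge0 uA).
  have s1 := s_ge1 uA; have dr := near uA.
  have sV0 : 0 < (s u)^-1 by rewrite invr_gt0; lra.
  have Xle : 2 * X u <= cosh r * (s u + (s u)^-1) by rewrite Xe; apply: ler_wpM2r => //; lra.
  have Xge : 2 * cosh r ^+ 2 - 1 <= X u.
    rewrite -cosh_double ler_cosh ?b_ge0 //; last by move: r0; lra.
    by case/andP: (layer uA); lra.
  have sE : expR r <= s u.
    apply: le_of_addV => //; rewrite -ce -(ler_pM2l c0).
    move: c1 Xge Xle; move: (cosh r) => c; nra.
  have s2 : (s u)^-1 <= 4 / 81 * s u.
    rewrite -[(s u)^-1]div1r ler_pdivrMr; last lra.
    nra.
  have eX : expR (b u) <= 2 * X u.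
    by rewrite coshE; have := expR_gt0 (b u); rewrite -invr_gt0; lra.
  have : expR rho <= expR (b u) by rewrite ler_expR; case/andP: (layer uA).
  have : cosh r * (s u + (s u)^-1) <= cosh r * (85 / 81 * s u) by apply: ler_wpM2l; lra.
  lra.
have := large_top (ltW c5) cA mA.
have -> : 46 * cosh r * (5 ^+ k * (81 * expR rho / (85 * cosh r)))
   = (46 * 81 / 85 * 5 ^+ k) * expR rho by field; rewrite gt_eqF.
have -> : 13 * (expR rho * expR r ^+ 2) = (13 * expR r ^+ 2) * expR rho by ring.
rewrite ltr_pM2r // => h.
have hk := exp_le_5 (ltW (expR_gt0 2)) (@expR2_le R) K1 (k := k) ltac:(by rewrite -cA).
have p0 : 0 <= 5 ^+ k :> R by exact: exprn_ge0.
move: expR_2r_lt h hk p0; move: (5 ^+ k) (expR 2 ^+ K) => p q; lra.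
Qed.

End OneSide.

(** * Disks of one layer in one bag *)

Section Bag.
Variables (R : realType) (V : finType) (F : polar_frame R) (p : V -> H2 R) (b t : V -> R).
Variables (A : {set V}) (r rho : R) (K : nat).
Hypotheses (r0 : 0 < r) (K1 : (1 < K)%N) (rK : r < K%:R).
Hypothesis polar_p : forall u, polar F (p u) (b u) (t u).
Hypothesis disjoint_disks : forall u v, u \in A -> v \in A -> u != v -> ~ disks_meet r (p u) (p v).
Hypothesis layer : forall u, u \in A -> rho <= b u < rho + 2 * r.

Definition ray_side (a : R) (e : bool) : {set V} :=
  [set u in A | `[< near_ray r (b u) (a - t u) >] && (0 <= (-1) ^+ e * trigo.sin (a - t u))].

Lemma card_ray_side a e :
  (rho = 0 -> (2 * #|ray_side a e| < 3 * K)%N) /\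
  (2 * r <= rho -> (2 * #|ray_side a e| <= 3 * K)%N).
Proof.
pose Y u := sinh (b u) * trigo.cos (a - t u).
(* The sign makes [Z] nonnegative on the chosen side and cancels in [Z u * Z v], so that [far] still
   speaks of the Minkowski product. *)
pose Z u := (-1) ^+ e * (sinh (b u) * trigo.sin (a - t u)).
have b0 u : 0 <= b u by case: (polar_p u).
have inS u : u \in ray_side a e -> [/\ u \in A, near_ray r (b u) (a - t u)
    & 0 <= (-1) ^+ e * trigo.sin (a - t u)].
  by rewrite inE => /andP[-> /andP[/asboolP]].
have Z2 u : Z u ^+ 2 = (sinh (b u) * trigo.sin (a - t u)) ^+ 2.
  by rewrite exprMn sqrr_sign mul1r.
have Y0 u : u \in ray_side a e -> 0 <= Y u.
  by move=> /inS[_ [c0 _] _]; rewrite mulr_ge0 ?sinh_ge0 // ltW.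
have Z0 u : u \in ray_side a e -> 0 <= Z u.
  by move=> /inS[_ _ s0]; rewrite /Z mulrCA mulr_ge0 ?sinh_ge0.
have hyp u : cosh (b u) ^+ 2 = 1 + Y u ^+ 2 + Z u ^+ 2.
  rewrite Z2 /Y; have := cosh2Bsinh2 (b u); have := cos2Dsin2 (a - t u).
  move: (cosh _) (sinh _) (trigo.cos _) (trigo.sin _) => c s c' s' e1 e2.
  have -> : (s * c') ^+ 2 = s ^+ 2 * c' ^+ 2 by ring.
  have -> : (s * s') ^+ 2 = s ^+ 2 * (1 - c' ^+ 2) by rewrite -e1; ring.
  by lra.
have near u : u \in ray_side a e -> fermi_dist (Z u) <= cosh r.
  move=> /inS[_ [_ s2] _].
  rewrite -ler_sqr ?nnegrE ?(ltW (fermi_dist_gt0 _)) //; last by have := cosh_ge1 r; lra.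
  by rewrite fermi_dist_sqr Z2; have := cosh2Bsinh2 r; lra.
have far u v : u \in ray_side a e -> v \in ray_side a e -> u != v ->
    cosh (2 * r) < cosh (b u) * cosh (b v) - Y u * Y v - Z u * Z v.
  move=> /inS[uA _ _] /inS[vA _ _] uv.
  have -> : cosh (b u) * cosh (b v) - Y u * Y v - Z u * Z v = - mdot (p u) (p v).
    rewrite (polar_mdot (polar_p u) (polar_p v)).
    have -> : t u - t v = (a - t v) - (a - t u) by ring.
    have zz : Z u * Z v = (sinh (b u) * trigo.sin (a - t u)) * (sinh (b v) * trigo.sin (a - t v)).
      by rewrite /Z mulrACA -expr2 sqrr_sign mul1r.
    by rewrite zz /Y (cosB (a - t v)); ring.
  rewrite ltNge; apply/negP => h.
  exact: (disjoint_disks uA vA uv) (disks_meet_of_mdot (ltW r0) h).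
have lay u : u \in ray_side a e -> rho <= b u < rho + 2 * r by move=> /inS[/layer].
split=> h.
  by apply: (card_side_first r0 K1 rK (b := b) (Y := Y) (Z := Z) _ _ _ _ _ _ lay).
by apply: (card_side r0 K1 rK (b := b) (Y := Y) (Z := Z) _ _ _ _ _ _ lay).
Qed.

Lemma card_bag a : rho = 0 \/ 2 * r <= rho ->
  (forall u, u \in A -> r < b u -> near_ray r (b u) (a - t u) \/ near_ray r (b u) (0 - t u)) ->
  (#|A| <= 6 * K)%N.
Proof.
move=> rho_cases near.
pose P := [set u in A | b u <= r].
have cover : A \subset P :|: (ray_side a true :|: ray_side a false
    :|: (ray_side 0 true :|: ray_side 0 false)).
  apply/fintype.subsetP => u uA; rewrite !inE uA /=.
  case: (lerP (b u) r) => //= rb.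
  have sgn x : (0 <= (-1) ^+ true * trigo.sin x :> R) || (0 <= (-1) ^+ false * trigo.sin x).
    by rewrite expr0 mul1r expr1 mulN1r oppr_ge0; case: (lerP (trigo.sin x) 0) => //= /ltW.
  by case: (near u uA rb) => h; have /asboolP -> := h; rewrite /= sgn ?orbT.
have [a1 a2] := card_ray_side a true; have [b1 b2] := card_ray_side a false.
have [c1 c2] := card_ray_side 0 true; have [d1 d2] := card_ray_side 0 false.
have := subset_leq_card cover.
have cU (X Y : {set V}) : (#|X :|: Y| <= #|X| + #|Y|)%N by rewrite cardsU leq_subr.
have := cU P (ray_side a true :|: ray_side a false :|: (ray_side 0 true :|: ray_side 0 false)).
have := cU (ray_side a true :|: ray_side a false) (ray_side 0 true :|: ray_side 0 false).
have := cU (ray_side a true) (ray_side a false).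
have := cU (ray_side 0 true) (ray_side 0 false).
(* For rho = 0 the four strict bounds add up to at most 6K - 2, which leaves room for the disk
   around the pole. For rho >= 2r no center is within r of the pole. *)
case: rho_cases => hrho.
  have P1 : (#|P| <= 1)%N.
    apply/card_le1_eqP => u v; rewrite !inE => /andP[uA ur] /andP[vA vr].
    apply/eqP/negPn/negP => uv; apply: (disjoint_disks vA uA uv).
    exact: (disks_meet_pole (ltW r0) (polar_p v) (polar_p u) vr ur).
  have := a1 hrho; have := b1 hrho; have := c1 hrho; have := d1 hrho; lia.
have P0 : #|P| = 0%N.
  apply/eqP; rewrite cards_eq0; apply/eqP/setP => u; rewrite !inE; apply/negP => /andP[uA].
  by have /andP[] := layer uA; move: r0 hrho; lra.
have := a2 hrho; have := b2 hrho; have := c2 hrho; have := d2 hrho; lia.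
Qed.

End Bag.

(** The quotient exceeds r because tanh r < 1, and exceeds 1 because tanh r < r. *)
Lemma ceil_bounds (R : realType) (r : R) : 0 < r ->
  let K := `|Num.ceil (r / tanh r)|%N in (1 < K)%N /\ r < K%:R.
Proof.
move=> r0 K.
have t0 := tanh_gt0 r0; have t1 := tanh_lt1 r; have tr := tanh_lt r0.
have q1 : 1 < r / tanh r by rewrite ltr_pdivlMr // mul1r.
have rq : r < r / tanh r by rewrite ltr_pdivlMr //; nra.
have c0 : (0 <= Num.ceil (r / tanh r))%R by rewrite ceil_ge0; lra.
have KE : K%:R = (Num.ceil (r / tanh r))%:~R :> R.
  by rewrite /K natr_absz ger0_norm.
have le : r / tanh r <= K%:R by rewrite KE ceil_ge.
split; last exact: lt_le_trans le.
by rewrite -(ltr_nat R); apply: lt_le_trans le.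
Qed.

(** * Graphs *)

Lemma alpha_induced_le (G : sgraph) (S : {set G}) (l : nat) :
  (forall A : {set G}, A \subset S -> stable A -> (#|A| <= l)%N) ->
  (alpha (Defs.induced S) <= l)%N.
Proof.
move=> h; apply/bigmax_leqP => A /forall_inP stA.
rewrite -(card_imset _ val_inj); apply: h.
  by apply/fintype.subsetP => _ /imsetP[x _ ->]; exact: valP.
apply/forall_inP => _ /imsetP[x xA ->]; apply/forall_inP => _ /imsetP[y yA ->].
exact: (forall_inP (stA x xA)).
Qed.

Lemma card_stable_le_alpha (G : sgraph) (S A : {set G}) :
  A \subset S -> stable A -> (#|A| <= alpha (Defs.induced S))%N.
Proof.
move=> /fintype.subsetP AS /forall_inP stA.
pose B : {set Defs.induced S} := [set x | val x \in A].
have <- : #|B| = #|A|.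
  rewrite -(card_imset _ val_inj); apply: eq_card => x.
  apply/imsetP/idP => [[y yB ->]|xA]; first by rewrite inE in yB.
  by exists (Sub x (AS x xA)); rewrite ?inE SubK.
apply: (leq_bigmax_cond (F := fun B : {set Defs.induced S} => #|B|)).
apply/forall_inP => x; rewrite inE => xA; apply/forall_inP => y; rewrite inE => yA.
exact: (forall_inP (stA _ xA)).
Qed.

(** The values of [h] are consecutive integers but need not start at 0: besides the whole path, this
    serves the subpath of nodes whose bags contain a given vertex. *)
Lemma gconnected_line (T : sgraph) (h : T -> nat) :
  injective h -> (forall u v, (h u).+1 = h v -> adj u v) ->
  (forall u v k, h u <= k <= h v -> exists w, h w = k)%N ->
  gconnected T.
Proof.
move=> h_inj h_adj h_conv.
have up d u v : h v = (h u + d)%N -> connect (@adj T) u v.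
  elim: d u v => [|d IH] u v e; first by rewrite (h_inj u v) ?e ?addn0.
  have [w hw] := h_conv u v (h u).+1 ltac:(lia).
  apply: (connect_trans (y := w)); first by apply/connect1/h_adj.
  by apply: IH; lia.
move=> u v; case: (leqP (h u) (h v)) => [uv|/ltnW vu].
  by apply: (up (h v - h u)%N); lia.
rewrite (sym_connect_sym (@adj_sym T)).
by apply: (up (h u - h v)%N); lia.
Qed.

Lemma acyclic_line (T : sgraph) (h : T -> nat) :
  injective h -> (forall u v, adj u v -> (h u).+1 = h v \/ (h v).+1 = h u) -> acyclic T.
Proof.
move=> h_inj h_adj c /andP[cyc uc].
case: (posnP (size c)) => [->//|c0].
have [x0 x0c] : exists x, x \in c by case: (c) c0 => // x; exists x; rewrite mem_head.
(* Both neighbours in the cycle of a vertex of maximal height are one step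
   below it, hence equal. *)
have [x xc xmax] : exists2 x, x \in c & forall y, y \in c -> (h y <= h x)%N.
  by case: (arg_maxnP (fun x => h x) x0c) => x xc xm; exists x.
have [i s e] := rot_to xc.
have cy : cycle (@adj T) (x :: s) by rewrite -e rot_cycle.
have us : uniq (x :: s) by rewrite -e rot_uniq.
have mx y : y \in x :: s -> (h y <= h x)%N by rewrite -e mem_rot; exact: xmax.
rewrite -(size_rot i) e.
case: s {e} cy us mx => [//|y s]; case: s => [//|z s].
rewrite /= rcons_path => /andP[xy /andP[_ /andP[_ lx]]] us mx.
have below w : adj w x || adj x w -> w \in x :: y :: z :: s -> (h w).+1 = h x.
  by move=> ad /mx le_wx; case/orP: ad => /h_adj[] // e; rewrite -e ltnn in le_wx.
have hy := below y; have hl := below (last z s).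
suff yl : y = last z s.
  have yin : y \in z :: s by rewrite yl mem_last.
  by case/andP: us => _ /andP[/negP yn _]; case: yn.
apply: h_inj; apply: succn_inj; rewrite hy ?hl ?lx ?xy ?orbT //.
  by rewrite 2!in_cons mem_last !orbT.
by rewrite !inE eqxx orbT.
Qed.

Definition is_line (T : sgraph) (h : T -> nat) (m : nat) : Prop :=
  [/\ injective h, forall u v, adj u v = ((h u).+1 == h v) || ((h v).+1 == h u),
      forall u, (h u < m)%N & forall k, (k < m)%N -> exists u, h u = k].

(** By symmetry of [adj], the condition on edges gives both [lo u <= hi v] and [lo v <= hi u]; the
    two intervals then share the larger of their left ends. *)
Lemma interval_decomposition (G T : sgraph) (h : T -> nat) (m : nat) (lo hi : G -> nat)
    (X : T -> {set G}) :
  is_line h m -> (0 < m)%N ->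
  (forall t u, (u \in X t) = (lo u <= h t <= hi u)%N) ->
  (forall u, lo u <= hi u < m)%N ->
  (forall u v, adj u v -> lo u <= hi v)%N ->
  is_tree_decomposition X.
Proof.
move=> [h_inj h_adj h_lt h_onto] m0 inX lohi adj_lohi.
have adjS u v : (h u).+1 = h v -> adj u v by move=> e; rewrite h_adj e eqxx.
split.
- split.
  + by have [t _] := h_onto 0%N m0; apply/card_gt0P; exists t.
  + apply: (gconnected_line h_inj adjS) => u v k /andP[_ kv].
    exact/h_onto/(leq_ltn_trans kv).
  + apply: (acyclic_line h_inj) => u v; rewrite h_adj.
    by case/orP => /eqP; [left|right].
- move=> u; have /andP[lh hm] := lohi u.
  by have [t ht] := h_onto _ hm; exists t; rewrite inX ht lh leqnn.
- move=> u v uv; have /andP[lu hu] := lohi u; have /andP[lv hv] := lohi v.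
  have uv' := adj_lohi _ _ uv; rewrite adj_sym in uv; have vu' := adj_lohi _ _ uv.
  have [|t ht] := h_onto (maxn (lo u) (lo v)); first by lia.
  by exists t; rewrite !inX ht; lia.
- move=> u.
  apply: (@gconnected_line _ (fun t : Defs.induced _ => h (val t))).
  + by move=> s t /h_inj /val_inj.
  + by move=> s t; exact: adjS.
  + move=> s t k /andP[sk kt].
    have [w hw] := h_onto k (leq_ltn_trans kt (h_lt _)).
    have wS : w \in [set t : T | u \in X t]%SET.
      have := valP s; have := valP t; rewrite !inE !inX hw => /andP[_ h1] /andP[h2 _].
      by rewrite (leq_trans h2 sk) (leq_trans kt h1).
    by exists (Sub w wS); rewrite SubK.
Qed.

Lemma ltin_le (G : sgraph) (l : nat) : has_ltin_witness G l -> (ltin G <= l)%N.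
Proof. by move=> w; rewrite /ltin; case: ex_minnP => m _; apply; apply/asboolP. Qed.

(** Pulls a witness back along an embedding, in order to pass from the disk graph on an ordinal to
    an abstract graph. *)
Lemma has_ltin_witness_inj (G G' : sgraph) (f : G -> G') (l : nat) :
  injective f -> (forall u v, adj (f u) (f v) = adj u v) ->
  has_ltin_witness G' l -> has_ltin_witness G l.
Proof.
move=> f_inj f_adj [T [X [V [[treeT cov covE conn] [lay1 lay2] wit]]]].
exists T, (fun t => f @^-1: X t), (fun i => f @^-1: V i); split.
- split=> //.
  + by move=> u; have [t tX] := cov (f u); exists t; rewrite inE.
  + by move=> u v; rewrite -f_adj => /covE[t]; exists t; rewrite !inE.
  + move=> u; rewrite (_ : [set _ | _]%SET = [set t : T | f u \in X t]%SET) //.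
    by apply/setP => t; rewrite !inE.
- split.
  + move=> u; have [i [iV iu]] := lay1 (f u).
    by exists i; split=> [|j]; rewrite inE //; exact: iu.
  + by move=> u v i j; rewrite -f_adj !inE; exact: lay2.
- move=> t i; apply: alpha_induced_le => A /fintype.subsetP AS /forall_inP stA.
  rewrite -(card_imset _ f_inj); apply: leq_trans (wit t i).
  apply: card_stable_le_alpha.
    by apply/fintype.subsetP => _ /imsetP[u /AS uS ->]; move: uS; rewrite !inE.
  apply/forall_inP => _ /imsetP[u uA ->]; apply/forall_inP => _ /imsetP[v vA ->].
  by rewrite f_adj; exact: (forall_inP (stA u uA)).
Qed.

Lemma has_ltin_witness_empty (G : sgraph) (l : nat) : #|G| = 0%N -> has_ltin_witness G l.
Proof.
move=> G0; have [k /asboolP[T [X [V [dec lay _]]]]] := has_ltin_witness_ex G.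
exists T, X, V; split=> // t i; apply: alpha_induced_le => A _ _.
by rewrite (leq_trans (max_card _)) // G0.
Qed.

(** * The sorting program *)

Section RealRAM.
Local Open Scope nat_scope.

(** * Total correctness of programs with a bound on the time *)

Section Run.
Variables (R : realType) (orc : bool -> nat -> R).
Implicit Types (s : state R) (Q : state R -> Prop).

Definition run (c : cmd) s (T : nat) Q : Prop :=
  exists t s', [/\ exec orc c s t s', t <= T & Q s'].

Lemma run_weaken c s T T' Q Q' : run c s T Q -> T <= T' -> (forall s', Q s' -> Q' s') ->
  run c s T' Q'.
Proof.
by move=> [t [s' [e tT q]]] TT qq; exists t, s'; split; [|exact: leq_trans TT|exact: qq].
Qed.

Lemma run_le c s T T' Q : T <= T' -> run c s T Q -> run c s T' Q.
Proof. by move=> TT h; apply: run_weaken h TT _. Qed.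

Lemma run_instr i s T Q : Q (step orc s i) -> run (Instr i) s T.+1 Q.
Proof. by move=> q; exists 1, (step orc s i); split=> //; constructor. Qed.

Lemma run_seq c1 c2 s T1 T2 Q :
  run c1 s T1 (fun s1 => run c2 s1 T2 Q) -> run (Seq c1 c2) s (T1 + T2) Q.
Proof.
move=> [t1 [s1 [e1 h1 [t2 [s2 [e2 h2 q]]]]]].
by exists (t1 + t2), s2; split=> //; [exact: ExecSeq e1 e2 | exact: leq_add].
Qed.

Lemma run_if q c1 c2 s T Q :
  (test_val s q -> run c1 s T Q) -> (~~ test_val s q -> run c2 s T Q) ->
  run (If q c1 c2) s T.+1 Q.
Proof.
move=> h1 h2.
have [t [s' [e tT qs]]] : run (if test_val s q then c1 else c2) s T Q.
  by case: ifP => h; [exact: h1 | apply: h2; rewrite h].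
by exists t.+1, s'; split=> //; constructor.
Qed.

(** The number [m] bounds the iterations that remain. Each costs the body and one test, and the last
    test fails. *)
Lemma run_while q c (Inv : nat -> state R -> Prop) T m s Q :
  Inv m s ->
  (forall m s, Inv m s -> test_val s q -> 0 < m /\ run c s T (Inv m.-1)) ->
  (forall m s, Inv m s -> ~~ test_val s q -> Q s) ->
  run (While q c) s (m * T.+1).+1 Q.
Proof.
move=> i0 step fin; elim: m s i0 => [|m IH] s i0.
  case tq: (test_val s q); first by have [] := step _ _ i0 tq.
  by exists 1, s; split=> //; [exact: ExecWhileEnd | apply: fin i0 _; rewrite tq].
case tq: (test_val s q); last first.
  by exists 1, s; split=> //; [exact: ExecWhileEnd | apply: fin i0 _; rewrite tq].
have [_ [t1 [s1 [e1 h1 i1]]]] := step _ _ i0 tq.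
have [t2 [s2 [e2 h2 q2]]] := IH s1 i1.
exists (t1 + t2).+1, s2; split=> //; first exact: ExecWhile tq e1 e2.
by rewrite mulSn; lia.
Qed.

Fixpoint block (i : instr) (l : seq instr) : cmd :=
  if l is j :: l' then Seq (Instr i) (block j l') else Instr i.

Lemma run_block i l s T Q : size l < T -> Q (foldl (step orc) s (i :: l)) ->
  run (block i l) s T Q.
Proof.
elim: l i s T => [|j l IH] i s [|T] // lT q; first exact: run_instr.
rewrite -add1n; apply: run_seq; apply: run_instr; exact: IH.
Qed.
End Run.
Arguments block : simpl never.

(** * Sorting with a tournament tree *)

Coercion ICst : nat >-> iarg.
Coercion Dir : nat >-> addr.
Notation cell k := (ICell (Dir k)).
Notation at_ k := (ICell (Ind k)).
Notation addi d x y := (ISet d IAdd x y).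
Notation movi d x := (ISet d IAdd x (ICst 0)).

(** Cells 12 and 13 hold two keys, possibly dummies, and cell 14 receives the winner. Keys lie two
    cells apart, so each index is added twice to the base address. *)
Definition compare : cmd :=
  If (IEq (cell 12) (cell 5)) (Instr (movi 14 (cell 13)))
  (If (IEq (cell 13) (cell 5)) (Instr (movi 14 (cell 12)))
  (Seq (block (addi 15 (cell 6) (cell 12)) [:: addi 15 (cell 15) (cell 12);
     addi 16 (cell 6) (cell 13); addi 16 (cell 16) (cell 13)])
  (If (RLt (RCell (Ind 15)) (RCell (Ind 16))) (Instr (movi 14 (cell 12)))
  (If (RLt (RCell (Ind 16)) (RCell (Ind 15))) (Instr (movi 14 (cell 13)))
  (If (ILe (cell 12) (cell 13)) (Instr (movi 14 (cell 12))) (Instr (movi 14 (cell 13)))))))).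

(** Recomputes the tree entry of the node v in cell 11 from those of its children 2v and 2v + 1. *)
Definition node : cmd :=
  Seq (block (addi 15 (cell 7) (cell 11)) [:: addi 15 (cell 15) (cell 11);
    movi 12 (at_ 15); addi 15 (cell 15) 1; movi 13 (at_ 15)])
  (Seq compare (block (addi 15 (cell 7) (cell 11)) [:: movi (Ind 15) (cell 14)])).

(** Climbs from the node in cell 11 to the root, whose recorded parent 0 ends the loop. *)
Definition update : cmd :=
  While (ILt 0 (cell 11)) (Seq node (block (addi 15 (cell 8) (cell 11)) [:: movi 11 (at_ 15)])).

Section Best.
Variables (R : realType) (key : nat -> R) (N : nat).

(** The lexicographic order on (key, index), with the dummy [N] on top in the role of infinity. *)
Definition ple (x y : nat) : bool :=
  (y == N) || (x != N) && ((key x < key y)%R || (key x == key y) && (x <= y)).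

Definition best (x y : nat) : nat := if ple x y then x else y.

Lemma ple_refl : reflexive ple.
Proof. by move=> x; rewrite /ple eqxx leqnn andbT orbT andbT orbN. Qed.

Lemma ple_total : total ple.
Proof.
move=> x y; rewrite /ple.
case: (x =P N) => [_|_] /=; first by rewrite orbT.
case: (y =P N) => [_|_] //=.
by case: (ltgtP (key x) (key y)) => //= _; exact: leq_total.
Qed.

Lemma ple_trans : transitive ple.
Proof.
move=> y x z; rewrite /ple.
case: (z =P N) => [_ //|_] /=.
case: (y =P N) => [_ //|_] /=.
case: (x =P N) => [_ //|_] /=.
case: (ltgtP (key x) (key y)) => [xy|//|xy] /=; last rewrite xy.
  move=> _; case: (ltgtP (key y) (key z)) => [yz|//|yz] /=.
    by rewrite (lt_trans xy yz).
  by rewrite -yz xy.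
move=> le_xy; case: (ltgtP (key y) (key z)) => //= _.
exact: leq_trans.
Qed.

Lemma best_le x y : ple (best x y) x /\ ple (best x y) y.
Proof.
rewrite /best; case: ifP => [->|h]; first by rewrite ple_refl.
by rewrite ple_refl; have := ple_total x y; rewrite h.
Qed.

Definition balanced (tr : nat -> nat) (v : nat) : Prop := tr v = best (tr (v + v)) (tr (v + v).+1).

Lemma root_le tr : (forall v, 0 < v < N -> balanced tr v) ->
  forall u, 0 < u < N + N -> ple (tr 1) (tr u).
Proof.
move=> ok; elim/ltn_ind => u IH /andP[u0 uN].
case: (leqP u 1) => [u1|u1]; first by rewrite (_ : u = 1) ?ple_refl //; lia.
have hu : 0 < u./2 < N by lia.
have /IH h : u./2 < u by lia.
have {}h := h ltac:(lia).
apply: (ple_trans h); rewrite (ok _ hu).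
have [l1 l2] := best_le (tr (u./2 + u./2)) (tr (u./2 + u./2).+1).
have [e|e] : u = u./2 + u./2 \/ u = (u./2 + u./2).+1 by lia.
  by have -> : tr u = tr (u./2 + u./2) by rewrite -e.
by have -> : tr u = tr (u./2 + u./2).+1 by rewrite -e.
Qed.

(** Descending from the root to the child that won ends at a leaf with the same entry. *)
Lemma root_leaf tr : (forall v, 0 < v < N -> balanced tr v) -> 0 < N ->
  exists2 x, x < N & tr 1 = tr (N + x).
Proof.
move=> ok N0.
have gen d v : N + N - v <= d -> 0 < v < N + N -> exists2 x, x < N & tr v = tr (N + x).
  elim: d v => [|d IH] v; first by move=> *; exfalso; lia.
  move=> vd v0; case: (ltnP v N) => vN; last by exists (v - N); [lia | rewrite subnKC].
  have -> := ok v ltac:(lia).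
  by rewrite /best; case: ifP => _; apply: IH; lia.
by apply: gen (leqnn _) _; lia.
Qed.

Variable orc : bool -> nat -> R.
Lemma run_compare (s : state R) :
  ints s 5 = N -> (forall x, key x = reals s (ints s 6 + x + x)) ->
  run orc compare s 10 (fun s' =>
  [/\ ints s' 14 = best (ints s 12) (ints s 13), reals s' = reals s
    & forall a, ~ (14 <= a < 17) -> ints s' a = ints s a]).
Proof.
move=> N5 keyE; rewrite /compare.
have fr v : forall a : nat, ~ (14 <= a < 17) -> (if a == 14 then v else ints s a) = ints s a.
  by move=> a ha; case: eqP => // ?; lia.
apply: run_if => /= e1.
  apply: run_instr; rewrite /= addn0; split=> //=; last exact: fr.
  rewrite /upd /= /best /ple (eqP e1) N5 eqxx /= orbF.
  by case: eqP => // ->.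
apply: run_if => /= e2.
  apply: run_instr; rewrite /= addn0; split=> //=; last exact: fr.
  by rewrite /upd /= /best /ple (eqP e2) N5 eqxx.
apply: (@run_seq _ _ _ _ _ 4 4).
apply: run_block => //=; rewrite /set_int /= /upd /=.
set s1 := State _ _.
have fr1 v : forall a : nat, ~ (14 <= a < 17) -> (if a == 14 then v else ints s1 a) = ints s a.
  by move=> a ha; rewrite /=; do 5 (case: eqP => [?|?] //=; try lia).
have bE : best (ints s 12) (ints s 13) = if (key (ints s 12) < key (ints s 13))%R then ints s 12
    else if (key (ints s 13) < key (ints s 12))%R then ints s 13
    else if ints s 12 <= ints s 13 then ints s 12 else ints s 13.
  rewrite /best /ple -N5 (negbTE e1) (negbTE e2) /=.
  by case: ltgtP.
rewrite bE !keyE.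
apply: run_if => /= e3.
  apply: run_instr; split=> //=; last exact: fr1.
  by rewrite /upd /= addn0 e3.
apply: run_if => /= e4.
  apply: run_instr; split=> //=; last exact: fr1.
  by rewrite /upd /= addn0 (negbTE e3) e4.
rewrite (negbTE e3) (negbTE e4).
apply: run_if => /= e5; apply: run_instr; split=> //=; try exact: fr1.
  by rewrite /upd /= addn0 e5.
by rewrite /upd /= addn0 (negbTE e5).
Qed.

Variables (kb TB : nat) (rmem : nat -> R).
Hypothesis TB_ge : 40 <= TB.
Hypothesis keyE : forall x, key x = rmem (kb + x + x).

Lemma work_neq_low x k : k < 40 -> (TB + x == k) = false.
Proof. by lia. Qed.

Lemma low_neq_work x k : k < 40 -> (k == TB + x) = false.
Proof. by lia. Qed.

Lemma low_out x k : k < 40 -> ~ (TB < k < x).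
Proof. by lia. Qed.

Definition env (s : state R) : Prop :=
  [/\ ints s 5 = N, ints s 6 = kb, ints s 7 = TB & reals s = rmem].

Lemma run_node s : env s ->
  run orc node s 17 (fun s' => reals s' = reals s /\ forall a, ~ (12 <= a < 17) ->
    ints s' a = if a == TB + ints s 11
      then best (ints s (TB + (ints s 11 + ints s 11))) (ints s (TB + (ints s 11 + ints s 11).+1))
      else ints s a).
Proof.
move=> [e5 e6 e7 em]; rewrite /node.
apply: (@run_seq _ _ _ _ _ 5 12).
apply: run_block => //=; rewrite /set_int /= /upd /=.
set s1 := State _ _.
apply: (@run_seq _ _ _ _ _ 10 2).
have c := @run_compare s1 e5 _.
have {}c := c ltac:(by move=> x; rewrite keyE /= e6 em).
apply: (run_weaken c) => // s2 [h14 hr hf].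
apply: run_block => //=; rewrite /set_int /= /upd /=; split; first by rewrite hr.
move=> a ha.
have h11 : ints s1 11 = ints s 11 by [].
have h7 : ints s1 7 = TB by rewrite /= e7.
have h12 : ints s1 12 = ints s (TB + (ints s 11 + ints s 11)).
  by rewrite /= e7 addn0 -!addnA !work_neq_low.
have h13 : ints s1 13 = ints s (TB + (ints s 11 + ints s 11).+1).
  by rewrite /= e7 !addn0 -!addnA !work_neq_low // addn1 addnS.
have -> : ints s2 7 = TB by rewrite hf.
have -> : ints s2 11 = ints s 11 by rewrite hf.
rewrite h14 h12 h13 addn0.
case: eqP => // _; case: eqP => [a15|_]; first by lia.
have ds : (14 <= a < 17) = false by lia.
rewrite hf ?ds //= /s1 /=.
have -> : (a == 13) = false by lia.
have -> : (a == 15) = false by lia.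
by have -> : (a == 12) = false by lia.
Qed.

(** Only the node in cell 11 may be out of balance, and repairing it can disturb only its parent.
    Halving a number below 2^m reaches 0 within m steps; 0 is not a node, so then the whole tree is
    balanced. *)
Lemma run_update m s : env s -> ints s 11 < N -> ints s 11 < 2 ^ m ->
  (forall v, 0 < v < N -> ints s (TB + (N + N) + v) = v./2) ->
  ints s 8 = TB + (N + N) ->
  (forall v, 0 < v < N -> v != ints s 11 -> balanced (fun u => ints s (TB + u)) v) ->
  run orc update s (m * 20).+1 (fun s' =>
  [/\ forall v, 0 < v < N -> balanced (fun u => ints s' (TB + u)) v, reals s' = reals s
    & forall a, ~ (11 <= a < 17) -> ~ (TB < a < TB + N) -> ints s' a = ints s a]).
Proof.
move=> env0 v0 v0m par e8 bal0.
pose Inv m s1 := [/\ env s1, ints s1 11 < N, ints s1 11 < 2 ^ m,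
  forall v, 0 < v < N -> v != ints s1 11 -> balanced (fun u => ints s1 (TB + u)) v
  & forall a, ~ (11 <= a < 17) -> ~ (TB < a < TB + N) -> ints s1 a = ints s a].
rewrite /update; apply: (@run_while _ _ _ _ Inv).
- by split.
- move=> k s1 [env1 v1 v1k bal1 fr1] /= vpos.
  split; first by rewrite lt0n; apply: contraTneq v1k => ->; rewrite expn0 -leqNgt.
  apply: (@run_seq _ _ _ _ _ 17 2).
  apply: (run_weaken (run_node env1)) => // s2 [hr hf].
  apply: run_block => //=; rewrite /set_int /= /upd /=.
  have [e5 e6 e7 em] := env1.
  have h8 : ints s2 8 = TB + (N + N) by rewrite hf // low_neq_work // fr1 //; exact: low_out.
  have h11 : ints s2 11 = ints s1 11 by rewrite hf // low_neq_work.
  have hp : ints s2 (TB + (N + N) + ints s1 11) = (ints s1 11)./2.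
    rewrite hf; last by lia.
    by rewrite ifF; [rewrite fr1 ?par //; lia | lia].
  rewrite h8 h11 (_ : (TB + (N + N) + ints s1 11 == 15) = false) ?hp ?addn0; last by lia.
  set s3 := State _ _.
  have hg a : ~ (11 <= a < 17) -> ints s3 a = ints s2 a.
    by move=> ha; rewrite /=; do 2 (case: eqP => [?|?] //=; try lia).
  have hn a : ints s3 (TB + a) = ints s2 (TB + a) by apply: hg; lia.
  have s3_11 : ints s3 11 = (ints s1 11)./2 by [].
  split.
  + by split; rewrite ?hg // ?hf // ?low_neq_work // hr.
  + by rewrite s3_11; lia.
  + rewrite s3_11; case: (k) v1k => [|k']; first by rewrite /= expn0; lia.
    by rewrite /= expnS; lia.
  + rewrite s3_11 => v v_in v_ne; rewrite /balanced !hn !hf; [|lia..].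
    rewrite !eqn_add2l.
    have -> : (v + v == ints s1 11) = false by lia.
    have -> : ((v + v).+1 == ints s1 11) = false by lia.
    by case: eqP => [->//|/eqP nv]; exact: bal1.
  + move=> a ha hT; rewrite hg // hf; last by lia.
    by case: eqP => [?|_]; [lia | exact: fr1].
move=> k s1 [[_ _ _ em1] _ _ bal1 fr1] /=; rewrite -leqNgt leqn0 => /eqP e11.
split=> //; first by move=> v v_in; apply: bal1 => //; rewrite e11; lia.
by case: env0 => _ _ _ ->.
Qed.

(* Cell 5 holds the number N of keys, cell 6 the address kb of the first key
   (key x is in real cell kb + 2x), and cell 7 the address TB of the work area:
   a tree with nodes 1, ..., 2N-1 where node N+x is the leaf of key x, the
   parents of the nodes, the ranks of the keys, and the sorted keys. *)
Definition setup : cmd :=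
  block (addi 8 (cell 7) (cell 5)) [:: addi 8 (cell 8) (cell 5);
    addi 9 (cell 8) (cell 5); addi 9 (cell 9) (cell 5); addi 10 (cell 9) (cell 5); movi 11 0].

Definition init_leaves : cmd :=
  While (ILt (cell 11) (cell 5)) (block (addi 15 (cell 7) (cell 5))
    [:: addi 15 (cell 15) (cell 11); movi (Ind 15) (cell 11); addi 11 (cell 11) 1]).

(** Nodes are treated from N - 1 down to 1, so the children are ready. Each node v records itself as
    the parent of 2v and 2v + 1, which fills the table of halves by additions only. *)
Definition build : cmd :=
  Seq (block (addi 15 (cell 8) 1) [:: movi (Ind 15) 0; ISet 11 ISub (cell 5) 1])
  (While (ILt 0 (cell 11))
    (Seq node (block (addi 15 (cell 8) (cell 11)) [:: addi 15 (cell 15) (cell 11);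
       movi (Ind 15) (cell 11); addi 15 (cell 15) 1; movi (Ind 15) (cell 11);
       ISet 11 ISub (cell 11) 1]))).

Definition load (d b o : nat) : cmd := block (addi 15 (cell b) (cell o)) [:: movi d (at_ 15)].

Definition store (b o v : nat) : cmd := block (addi 15 (cell b) (cell o)) [:: movi (Ind 15) (cell v)].

(** With x the winner at the root and k the count in cell 17: the sorted list gets x at position k,
    the rank of x becomes k, the leaf of x becomes the dummy, and cell 11 gets the parent of that
    leaf. *)
Definition pop : cmd :=
  Seq (Instr (movi 16 1)) (Seq (load 12 7 16) (Seq (store 10 17 12) (Seq (store 9 12 17)
  (Seq (Instr (addi 11 (cell 5) (cell 12))) (Seq (store 7 11 5) (load 11 8 11)))))).

Definition extract : cmd := Seq pop (Seq update (Instr (addi 17 (cell 17) 1))).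

Definition sort_keys : cmd :=
  Seq setup (Seq init_leaves (Seq build (Seq (Instr (movi 17 0))
    (While (ILt (cell 17) (cell 5)) extract)))).

Definition env2 (s : state R) : Prop :=
  [/\ env s, ints s 8 = TB + (N + N), ints s 9 = TB + (N + N + N + N)
    & ints s 10 = TB + (N + N + N + N + N)].

Definition frame (s s' : state R) : Prop :=
  reals s' = reals s /\
  forall a, ~ (8 <= a < 18) -> ~ (TB <= a < TB + (N + N + N + N + N + N)) -> ints s' a = ints s a.

Lemma run_setup s : env s ->
  run orc setup s 6 (fun s' => [/\ env2 s', frame s s' & ints s' 11 = 0]).
Proof.
move=> [e5 e6 e7 em]; apply: run_block => //=; rewrite /set_int /= /upd /=.
split=> //.
  by split=> //=; rewrite e7 e5; lia.
split=> //= a ha _; do 6 (case: eqP => [?|?] //=; try lia).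
Qed.

Lemma run_init_leaves s : env2 s -> ints s 11 = 0 ->
  run orc init_leaves s (N * 5).+1 (fun s' => [/\ env2 s', frame s s' &
     forall x, x < N -> ints s' (TB + (N + x)) = x]).
Proof.
move=> env0 e11.
pose Inv m s1 := [/\ env2 s1, frame s s1, ints s1 11 + m = N &
   forall x, x < ints s1 11 -> ints s1 (TB + (N + x)) = x].
rewrite /init_leaves; apply: (@run_while _ _ _ _ Inv).
- by split=> //; rewrite e11.
- move=> m s1 [[[e5 e6 e7 em] e8 e9 e10] [fr1 fr2] em1 lv] /=; rewrite e5 => lt1.
  split; first by lia.
  apply: run_block => //=; rewrite /set_int /= /upd /= e5 e7.
  have -> : (11 == TB + N + ints s1 11) = false by lia.
  rewrite addn0 /=.
  set s2 := State _ _.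
  have hg a : ~ (11 <= a < 16) -> ints s2 a = if a == TB + N + ints s1 11 then ints s1 11 else ints s1 a.
    move=> ha; rewrite /=; case: eqP => [?|_]; first by lia.
    by case: eqP => // _; do 2 (case: eqP => [?|?] //=; try lia).
  have lo k : k < 40 -> (k == TB + N + ints s1 11) = false by lia.
  have s2_11 : ints s2 11 = ints s1 11 + 1 by [].
  split.
  + by split; [split|..]; rewrite ?hg // ?lo //.
  + split; first by [].
    move=> a ha hT; rewrite hg; last by lia.
    by case: eqP => [?|_]; [lia | exact: fr2].
  + by rewrite s2_11; lia.
  + rewrite s2_11 => x hx; rewrite hg; last by lia.
    by case: eqP => [?|?]; [lia | apply: lv; lia].
- move=> m s1 [env1 fr1 em1 lv] /=; have [[e5 _ _ _] _ _ _] := env1; rewrite e5 -leqNgt => le1.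
  by split=> // x xN; apply: lv; lia.
Qed.

Lemma frame_trans s1 s2 s3 : frame s1 s2 -> frame s2 s3 -> frame s1 s3.
Proof.
move=> [r1 f1] [r2 f2]; split; first by rewrite r2.
by move=> a h1 h2; rewrite f2 // f1.
Qed.

Definition parents (s : state R) : Prop :=
  forall v, 0 < v < N + N -> ints s (TB + (N + N) + v) = v./2.

Definition balanced_at (s : state R) (v : nat) : Prop := balanced (fun u => ints s (TB + u)) v.

Lemma run_build s : 0 < N -> env2 s -> (forall x, x < N -> ints s (TB + (N + x)) = x) ->
  run orc build s (3 + (N.-1 * 24).+1) (fun s' => [/\ env2 s', frame s s',
     forall x, x < N -> ints s' (TB + (N + x)) = x,
     forall v, 0 < v < N -> balanced_at s' v & parents s']).
Proof.
move=> N0 env0 lv0.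
pose Inv m s1 := [/\ env2 s1, frame s s1, ints s1 11 = m /\ m < N,
   forall x, x < N -> ints s1 (TB + (N + x)) = x &
   (forall v, m < v < N -> balanced_at s1 v) /\
   (forall v, 0 < v < N + N -> v = 1 \/ m + m + 1 < v -> ints s1 (TB + (N + N) + v) = v./2)].
rewrite /build; apply: run_seq.
apply: run_block => //=; rewrite /set_int /= /upd /=.
have [[e5 e6 e7 em] e8 e9 e10] := env0; rewrite e8 e5.
set s1 := State _ _.
have hg a : ~ (11 <= a < 16) -> ints s1 a = if a == TB + (N + N) + 1 then 0 else ints s a.
  move=> ha; rewrite /=; case: eqP => [?|_]; first by lia.
  by case: eqP => // _; case: eqP => [?|?] //=; lia.
have lo x k : k < 40 -> (k == TB + (N + N) + x) = false by lia.
apply: (@run_while _ _ _ _ Inv).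
- split.
  + by split; [split|..]; rewrite ?hg // ?lo.
  + split; first by [].
    by move=> a h1 h2; rewrite hg; [case: eqP => // ?; lia | lia].
  + by rewrite /= ?lo // ?e5; lia.
  + by move=> x xN; rewrite hg; [case: eqP => [?|_]; [lia | exact: lv0] | lia].
  + split=> v hv; first by lia.
    case=> [->|?]; last by lia.
    by rewrite hg ?eqxx //; lia.
- move=> m s2 [[env1 f8 f9 f10] fr [e11 mN] lv [bal par]] /= vpos.
  split; first by lia.
  apply: (@run_seq _ _ _ _ _ 17 6).
  apply: (run_weaken (run_node env1)) => // s3 [hr hf].
  apply: run_block => //=; rewrite /set_int /= /upd /=.
  rewrite e11 in hf.
  have h8 : ints s3 8 = TB + (N + N) by rewrite hf // low_neq_work.
  have h11 : ints s3 11 = m by rewrite hf // low_neq_work.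
  rewrite h8 h11 !addn0 (_ : (15 == TB + (N + N) + m + m) = false); last by lia.
  rewrite (_ : (11 == TB + (N + N) + m + m) = false); last by lia.
  rewrite (_ : (11 == TB + (N + N) + m + m + 1) = false); last by lia.
  rewrite e11 in vpos.
  set s4 := State _ _.
  have gg a : ~ (11 <= a < 17) -> ints s4 a =
     if (a == TB + (N + N) + m + m + 1) || (a == TB + (N + N) + m + m) then m else ints s3 a.
    move=> ha; rewrite /=; case: eqP => [?|_]; first by lia.
    case: eqP => //= _; case: eqP => [?|_]; first by lia.
    by case: eqP => //= _; do 2 (case: eqP => [?|?] //=; try lia).
  have gt a : TB <= a < TB + (N + N) -> ints s4 a = if a == TB + m
     then best (ints s2 (TB + (m + m))) (ints s2 (TB + (m + m).+1)) else ints s2 a.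
    by move=> ha; rewrite gg; [rewrite ifF; [apply: hf; lia | lia] | lia].
  have gl a : a < TB -> ~ (11 <= a < 17) -> ints s4 a = ints s2 a.
    by move=> h1 h2; rewrite gg // ifF; [rewrite hf; [rewrite ifF //; lia | lia] | lia].
  have [e5' e6' e7' em'] := env1.
  split.
  + have lowk k : k < 11 -> ints s4 k = ints s2 k by move=> ?; apply: gl; lia.
    by split; [split|..]; rewrite ?lowk // -em' -hr.
  + apply: (frame_trans fr); split; first by rewrite /= hr.
    move=> a h1 h2; rewrite gg; last by lia.
    by rewrite ifF; [rewrite hf; [rewrite ifF //; lia | lia] | lia].
  + by split; [rewrite /= subn1 | lia].
  + move=> x xN; rewrite gt; last by lia.
    by rewrite ifF; [exact: lv | lia].
  + split=> [v hv|v hv h].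
      rewrite /balanced_at /balanced !gt; [|lia..].
      rewrite !eqn_add2l.
      have -> : (v + v == m) = false by lia.
      have -> : ((v + v).+1 == m) = false by lia.
      by case: eqP => [->//|ne]; apply: bal; lia.
    rewrite gg; last by lia.
    case: ifP => [e|ne]; first by lia.
    rewrite hf; last by lia.
    by rewrite ifF; [apply: par => //; lia | lia].
- move=> m s2 [env1 fr [e11 mN] lv [bal par]] /=; rewrite e11 -leqNgt leqn0 => /eqP m0.
  split=> //.
  + by move=> v hv; apply: bal; lia.
  + by move=> v hv; apply: par => //; lia.
Qed.

(* xs lists the keys extracted so far; the leaf of an extracted key holds the
   dummy key N, which is larger than every key. *)
Definition extracted (xs : seq nat) (s : state R) : Prop :=
  [/\ env2 s, (forall v, 0 < v < N -> balanced_at s v) /\ parents s,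
     forall x, x < N -> ints s (TB + (N + x)) = if x \in xs then N else x,
     ints s 17 = size xs
   & [/\ uniq xs, {in xs, forall x, x < N}, pairwise ple xs,
        forall x y, x \in xs -> y < N -> y \notin xs -> ple x y
      & forall i, i < size xs -> ints s (TB + (N + N + N + N + N) + i) = nth 0 xs i
         /\ ints s (TB + (N + N + N + N) + nth 0 xs i) = i]].

Lemma uncovered (xs : seq nat) : uniq xs -> size xs < N -> exists2 y, y < N & y \notin xs.
Proof.
move=> ux sx.
have : ~~ all (mem xs) (iota 0 N).
  apply/negP => /allP sub; have := uniq_leq_size (iota_uniq 0 N) sub.
  by rewrite size_iota leqNgt sx.
by case/allPn => y; rewrite mem_iota add0n => /andP[_ yN] yx; exists y.
Qed.

Lemma run_load d b o s : b != 15 -> o != 15 -> ints s b + ints s o != 15 ->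
  run orc (load d b o) s 2 (fun s' => reals s' = reals s /\
    forall a, a != 15 -> ints s' a = if a == d then ints s (ints s b + ints s o) else ints s a).
Proof.
move=> b15 o15 bo; apply: run_block => //=; rewrite /set_int /= /upd /=; split=> // a a15.
by rewrite (negbTE bo) (negbTE a15) addn0.
Qed.

Lemma run_store b o v s : v != 15 -> ints s b + ints s o != 15 ->
  run orc (store b o v) s 2 (fun s' => reals s' = reals s /\
    forall a, a != 15 -> ints s' a = if a == ints s b + ints s o then ints s v else ints s a).
Proof.
move=> v15 bo; apply: run_block => //=; rewrite /set_int /= /upd /=; split=> // a a15.
by rewrite (negbTE v15) (negbTE a15) addn0.
Qed.

Lemma run_pop s k x : env2 s -> parents s -> ints s 17 = k -> ints s (TB + 1) = x ->
  x < N -> k < N ->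
  run orc pop s 12 (fun s' => [/\ reals s' = reals s, ints s' 11 = (N + x)./2 &
   forall a, ~ (11 <= a < 17) -> ints s' a = if a == TB + (N + x) then N
     else if a == TB + (N + N + N + N) + x then k
     else if a == TB + (N + N + N + N + N) + k then x else ints s a]).
Proof.
move=> [[e5 e6 e7 em] e8 e9 e10] par e17 ex xN kN.
have lo y z c : c < 40 -> (c == TB + y + z) = false by lia.
rewrite /pop; apply: (@run_seq _ _ _ _ _ 1 11); apply: run_instr.
rewrite /= /set_int /= /upd /=; set s1 := State _ _.
have h1 a : a != 16 -> ints s1 a = ints s a by move=> ?; rewrite /= ifN.
apply: (@run_seq _ _ _ _ _ 2 9).
have : ints s1 7 + ints s1 16 != 15 by rewrite /= e7; lia.
move/(@run_load 12 7 16 s1 isT isT) => r2; apply: (run_weaken r2) => // s2 [r2' h2] {r2}.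
have b12 : ints s2 12 = x by rewrite h2 //= e7 addn0 ifN //; lia.
have l2 a : a != 15 -> a != 16 -> a != 12 -> ints s2 a = ints s a.
  by move=> a5 a6 a2; rewrite h2 // ifN // h1.
apply: (@run_seq _ _ _ _ _ 2 7).
have : ints s2 10 + ints s2 17 != 15 by rewrite !l2 // e10; lia.
move/(@run_store 10 17 12 s2 isT) => r3; apply: (run_weaken r3) => // s3 [r3' h3] {r3}.
rewrite b12 !l2 // e10 e17 in h3.
apply: (@run_seq _ _ _ _ _ 2 5).
have c9 : ints s3 9 = TB + (N + N + N + N) by rewrite h3 // lo // l2.
have c12 : ints s3 12 = x by rewrite h3 // lo.
have c17 : ints s3 17 = k by rewrite h3 // lo // l2.
have : ints s3 9 + ints s3 12 != 15 by rewrite c9; lia.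
move/(@run_store 9 12 17 s3 isT) => r4; apply: (run_weaken r4) => // s4 [r4' h4] {r4}.
rewrite c9 c12 c17 in h4.
have l4 a : a < 15 -> a != 12 -> ints s4 a = ints s a.
  by move=> a1 a2; rewrite h4 ?lo ?h3 ?lo ?l2 //; lia.
have d12 : ints s4 12 = x by rewrite h4 // lo.
apply: (@run_seq _ _ _ _ _ 1 4); apply: run_instr.
rewrite /= /set_int /= /upd /= l4 // e5 d12; set s5 := State _ _.
have h5 a : a != 11 -> ints s5 a = ints s4 a by move=> ?; rewrite /= ifN.
apply: (@run_seq _ _ _ _ _ 2 2).
have : ints s5 7 + ints s5 11 != 15 by rewrite /= l4 // e7; lia.
move/(@run_store 7 11 5 s5 isT) => r6; apply: (run_weaken r6) => // s6 [r6' h6] {r6}.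
rewrite /= !l4 // e7 e5 in h6.
have f8 : ints s6 8 = TB + (N + N) by rewrite h6 //= low_neq_work //= l4.
have f11 : ints s6 11 = N + x by rewrite h6 //= low_neq_work.
have : ints s6 8 + ints s6 11 != 15 by rewrite f8; lia.
move/(@run_load 11 8 11 s6 isT isT) => r7; apply: (run_weaken r7) => // s7 [r7' h7] {r7}.
rewrite f8 f11 in h7.
split; first by rewrite r7' r6' /= r4' r3' r2'.
  rewrite h7 //= h6; last by lia.
  rewrite ifF; last by lia.
  rewrite ifF; last by lia.
  rewrite h4; last by lia.
  rewrite ifF; last by lia.
  rewrite h3; last by lia.
  rewrite ifF; last by lia.
  by rewrite l2 ?par //; lia.
move=> a ha; rewrite h7; last by lia.
rewrite ifF; last by lia.
rewrite h6; last by lia.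
case: eqP => // _; rewrite ifF; last by lia.
rewrite h4; last by lia.
case: eqP => // _; rewrite h3; last by lia.
by case: eqP => // _; rewrite l2 //; lia.
Qed.

Lemma run_extract xs s M : N < 2 ^ M -> extracted xs s -> size xs < N ->
  run orc extract s (M * 20 + 14) (fun s' => exists2 xs', extracted xs' s' /\ frame s s' &
    size xs' = (size xs).+1).
Proof.
move=> NM [[env0 e8 e9 e10] [bal par] lv e17 [ux xsN srt sep arr]] sxN.
have [e5 e6 e7 em] := env0.
have [y yN yxs] := uncovered ux sxN.
have N0 : 0 < N by lia.
have rl := root_le bal; have [x xN rx] := root_leaf bal N0.
have ry := rl (N + y) ltac:(lia).
rewrite lv // (negbTE yxs) in ry.
(* The key [y] still competes and beats the dummy, so the root is a genuine key that has not been
   extracted. *)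
have r1N : ints s (TB + 1) != N.
  apply/eqP => e; move: ry; rewrite e /ple eqxx /= orbF => /eqP; lia.
have xxs : x \notin xs.
  by apply: contraNN r1N => h; rewrite rx lv // h.
have rxx : ints s (TB + 1) = x by rewrite rx lv // (negbTE xxs).
rewrite /extract (_ : M * 20 + 14 = 12 + ((M * 20).+1 + 1)); last by lia.
apply: run_seq.
have := @run_pop s _ _ (And4 env0 e8 e9 e10) par e17 rxx xN sxN.
move/run_weaken; apply => // s1 [r1 h11 h1].
have lo y' z c : c < 40 -> (c == TB + y' + z) = false by lia.
have low1 a : ~ (11 <= a < 17) -> a < 40 -> ints s1 a = ints s a.
  by move=> a1 a40; rewrite h1 // low_neq_work // !lo.
have env1 : env s1 by split; rewrite ?r1 // low1.
have lv1 z : z < N -> ints s1 (TB + (N + z)) = if z \in rcons xs x then N else z.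
  move=> zN; rewrite h1; last by lia.
  rewrite mem_rcons in_cons !eqn_add2l.
  case: eqP => //= _; rewrite ifF; last by lia.
  by rewrite ifF; [exact: lv | lia].
have tr1 v : 0 < v < N + N -> v != N + x -> ints s1 (TB + v) = ints s (TB + v).
  move=> hv vx; rewrite h1; last by lia.
  by rewrite eqn_add2l (negbTE vx) !ifF //; lia.
have par1 : parents s1.
  by move=> v hv; rewrite h1; [rewrite !ifF ?par //; lia | lia].
(* A changed leaf can unbalance only its parent, and this is where [update] starts. *)
have bal1 v : 0 < v < N -> v != ints s1 11 -> balanced (fun u => ints s1 (TB + u)) v.
  rewrite h11 => hv vx; rewrite /balanced !tr1; [exact: bal|lia..].
apply: run_seq.
have vN : ints s1 11 < N by rewrite h11; lia.
have par1' v : 0 < v < N -> ints s1 (TB + (N + N) + v) = v./2 by move=> hv; apply: par1; lia.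
have e8' : ints s1 8 = TB + (N + N) by rewrite low1.
have := run_update env1 vN (ltn_trans vN NM) par1' e8' bal1.
move/run_weaken; apply => // s2 [bal2 r2 h2].
apply: run_instr; rewrite /= /set_int /= /upd /=; set s3 := State _ _.
have h3 a : a != 17 -> ints s3 a = ints s2 a by move=> ?; rewrite /= ifN.
have h32 a : ~ (11 <= a < 18) -> ~ (TB < a < TB + N) -> ints s3 a = ints s1 a.
  by move=> a1 a2; rewrite h3 ?h2 //; lia.
have low3 a : a < 11 -> ints s3 a = ints s a.
  by move=> a11; rewrite h32 ?low1 //; lia.
exists (rcons xs x); last by rewrite size_rcons.
split; last first.
  split; first by rewrite /= r2 r1.
  move=> a a1 a2; rewrite h32; [|lia..].
  by rewrite h1; [rewrite !ifF //; lia | lia].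
split.
- by split; [split|..]; rewrite ?low3 // /= r2 r1.
- split=> v hv.
    rewrite /balanced_at /balanced !h3; [exact: bal2|lia..].
  by rewrite h32; [exact: par1|lia..].
- by move=> z zN; rewrite h32; [exact: lv1|lia..].
- by rewrite size_rcons /= h2 ?low1 ?e17 ?addn1 //; exact: low_out.
- split.
  + by rewrite rcons_uniq xxs.
  + by move=> z; rewrite mem_rcons in_cons => /orP[/eqP->|/xsN].
  + rewrite pairwise_rcons srt andbT; apply/allP => z zx; exact: sep.
  + move=> a c; rewrite !mem_rcons !in_cons negb_or => /orP[/eqP->|axs] cN /andP[cx cxs].
      rewrite -rxx; have := rl (N + c) ltac:(lia).
      by rewrite lv // (negbTE cxs).
    exact: sep.
  + move=> i; rewrite size_rcons ltnS leq_eqVlt => /orP[/eqP->|ix].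
      rewrite nth_rcons ltnn eqxx !h32; [|lia..].
      rewrite !h1; [|lia..]; rewrite !eqxx; split.
        by rewrite !ifF //; lia.
      by rewrite ifF //; lia.
    have [a1 a2] := arr i ix.
    have xiN : nth 0 xs i < N by apply/xsN/mem_nth.
    have xix : nth 0 xs i != x by apply: contraNneq xxs => <-; exact: mem_nth.
    rewrite nth_rcons ix !h32; [|lia..].
    by rewrite !h1; [rewrite !ifF ?a1 ?a2 //; lia | lia..].
Qed.

Lemma run_sort_keys s M : 0 < N -> N < 2 ^ M -> env s ->
  run orc sort_keys s (N * (M * 20 + 44) + 10) (fun s' => frame s s' /\ exists xs,
    [/\ perm_eq xs (iota 0 N), pairwise ple xs
      & forall i, i < N -> ints s' (TB + (N + N + N + N + N) + i) = nth 0 xs i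
         /\ ints s' (TB + (N + N + N + N) + nth 0 xs i) = i]).
Proof.
move=> N0 NM env0; rewrite /sort_keys.
apply: (@run_le _ _ _ _ (6 + ((N * 5).+1 + ((3 + (N.-1 * 24).+1) +
   (1 + (N * (M * 20 + 14).+1).+1))))); first by lia.
apply: run_seq; apply: (run_weaken (run_setup env0)) => // s1 [env1 fr1 e11].
apply: run_seq; apply: (run_weaken (run_init_leaves env1 e11)) => // s2 [env2' fr2 lv2].
apply: run_seq; apply: (run_weaken (run_build N0 env2' lv2)) => // s3 [env3 fr3 lv3 bal3 par3].
apply: run_seq; apply: run_instr; rewrite /= /set_int /= /upd /=; set s4 := State _ _.
have h4 a : a != 17 -> ints s4 a = ints s3 a by move=> ?; rewrite /= ifN.
have fr4 : frame s s4.
  apply: (frame_trans fr1); apply: (frame_trans fr2); apply: (frame_trans fr3).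
  by split=> // a a1 a2; rewrite h4 //; lia.
pose Inv m s5 := exists xs, [/\ extracted xs s5, frame s s5 & size xs + m = N].
apply: (@run_while _ _ _ _ Inv).
- exists [::]; split=> //; split=> //.
  + split=> v hv; last by rewrite h4; [exact: par3|lia].
    by rewrite /balanced_at /balanced !h4; [exact: bal3|lia..].
  + by move=> x xN; rewrite h4; [exact: lv3 | lia].
- move=> m s5 [xs [ex fr sm]] /= lt17.
  have [[[e5 _ _ _] _ _ _] _ _ e17 _] := ex.
  rewrite e5 e17 in lt17; split; first by lia.
  have := run_extract NM ex lt17; move/run_weaken; apply=> // s6 [xs' [ex' fr'] sx'].
  by exists xs'; split=> //; [exact: frame_trans fr' | lia].
- move=> m s5 [xs [ex fr sm]] /=.
  have [[[e5 _ _ _] _ _ _] _ _ e17 [ux xN pw _ arr]] := ex.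
  rewrite e5 e17 -leqNgt => sN.
  split=> //; exists xs; split=> //; last by move=> i iN; apply: arr; lia.
  apply: uniq_perm; rewrite ?iota_uniq //.
  have sub : {subset xs <= iota 0 N} by move=> x /xN xN'; rewrite mem_iota.
  by have [] := uniq_min_size ux sub; rewrite ?size_iota.
Qed.
End Best.

(** * The decomposition program *)

(* Cell 20 holds n, cells 21 to 24 the addresses of the layers, of the bags, of
   the edges and of the work area, and cell 25 is the loop index. Real cell 2,
   an angle that is not needed, holds the upper end of the current layer. *)
Definition emit (v : nat) : cmd := block (movi (Ind 30) (cell v)) [:: addi 30 (cell 30) 1].

(** From cell 40 on: n cells for the layers, 3n for the bags, 4n for the edges, and the work area
    from 40 + 8n. *)
Definition layout : cmd :=
  Seq (block (movi 20 (cell 0)) [:: movi 21 40; addi 22 (cell 21) (cell 20);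
    addi 23 (cell 22) (cell 20); addi 23 (cell 23) (cell 20); addi 23 (cell 23) (cell 20)])
  (block (addi 5 (cell 20) (cell 20)) [:: addi 24 (cell 23) (cell 5);
    addi 24 (cell 24) (cell 5); movi 7 (cell 24); movi 25 0]).

(** Angle key x goes to real cell 2n + 1 + 2x. The stride 2 is that of the radii in the input, so
    one sorting program serves both, and the radii, in cells up to 2n - 1, survive. *)
Definition read_angles : cmd :=
  While (ILt (cell 25) (cell 20))
    (Seq (block (addi 26 (cell 5) 1) [:: addi 26 (cell 26) (cell 25); addi 26 (cell 26) (cell 25);
       AngleBound (Ind 26) false (cell 25); addi 26 (cell 26) (cell 5)])
     (block (AngleBound (Ind 26) true (cell 25)) [:: addi 25 (cell 25) 1])).

Definition sort_radii : cmd :=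
  Seq (block (movi 5 (cell 20)) [:: movi 6 1]) sort_keys.

(** Cell 27 points to the disks sorted by radius and cell 28 holds the current layer. The
    instruction [movi 15 0] stands for doing nothing. *)
Definition layers : cmd :=
  Seq (block (movi 27 (cell 24)) [:: addi 27 (cell 27) (cell 20); addi 27 (cell 27) (cell 20);
      addi 27 (cell 27) (cell 20); addi 27 (cell 27) (cell 20); addi 27 (cell 27) (cell 20);
      movi 28 0; movi 25 0; RSet 2 RAdd (RCell 0) (RCell 0)])
  (While (ILt (cell 25) (cell 20))
    (Seq (load 29 27 25)
    (Seq (block (addi 30 (cell 29) (cell 29)) [:: addi 30 (cell 30) 1])
    (Seq (If (RLt (RCell (Ind 30)) (RCell 2)) (Instr (movi 15 0))
      (block (addi 28 (cell 28) 1) [:: RSet 2 RAdd (RCell (Ind 30)) (RCell 0);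
         RSet 2 RAdd (RCell 2) (RCell 0)]))
    (Seq (store 21 29 28) (Instr (addi 25 (cell 25) 1))))))).

(* Key u < n is the infimum of the angles of disk u and key n + u the supremum.
   Ties are broken by index, so an infimum precedes an equal supremum. *)
Definition sort_angles : cmd :=
  Seq (block (addi 5 (cell 20) (cell 20)) [:: addi 6 (cell 5) 1]) sort_keys.

(** Cell 27 points to the ranks of the 2n angle keys; the interval of disk u runs from the rank of
    key u to that of key n + u. *)
Definition bags : cmd :=
  Seq (block (addi 27 (cell 24) (cell 5)) [:: addi 27 (cell 27) (cell 5); addi 27 (cell 27) (cell 5);
     addi 27 (cell 27) (cell 5); movi 25 0; movi 30 (cell 22)])
  (While (ILt (cell 25) (cell 20))
    (Seq (emit 25) (Seq (load 29 27 25) (Seq (emit 29) (Seq (Instr (addi 31 (cell 25) (cell 20)))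
    (Seq (load 29 27 31) (Seq (emit 29) (Instr (addi 25 (cell 25) 1))))))))).

(** This writes 2n pairs although the path has 2n - 1 edges; [out_edge] does not read the last
    one. *)
Definition edges : cmd :=
  Seq (block (movi 25 0) [:: movi 30 (cell 23)])
  (While (ILt (cell 25) (cell 5))
    (Seq (emit 25) (Seq (Instr (addi 25 (cell 25) 1)) (emit 25)))).

Definition outputs : cmd :=
  block (movi 0 (cell 5)) [:: movi 1 (cell 23); movi 2 (cell 20); movi 3 (cell 22); movi 4 (cell 21)].

Definition decompose : cmd :=
  Seq layout (Seq read_angles (Seq sort_radii (Seq layers (Seq sort_angles
    (Seq bags (Seq edges outputs)))))).

(** * Verification of the program, phase by phase *)

Section Program.
Variables (R : realType) (orc : bool -> nat -> R) (n : nat).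
Implicit Types s : state R.

Lemma run_emit v s : v != 30 -> 40 <= ints s 30 ->
  run orc (emit v) s 2 (fun s' => [/\ reals s' = reals s, ints s' 30 = (ints s 30).+1 &
    forall a, a != 30 -> ints s' a = if a == ints s 30 then ints s v else ints s a]).
Proof.
move=> v30 p40; apply: run_block => //=; rewrite /set_int /= /upd /=; split=> //.
  by rewrite ifF ?addn1 //; lia.
by move=> a a30; rewrite (negbTE a30) addn0.
Qed.

Definition base s : Prop :=
  [/\ ints s 20 = n, ints s 21 = 40, ints s 22 = 40 + n & ints s 23 = 40 + 4 * n]
  /\ ints s 24 = 40 + 8 * n.

Lemma run_layout s : ints s 0 = n ->
  run orc layout s 11 (fun s' => [/\ base s', ints s' 5 = n + n, ints s' 7 = 40 + 8 * n,
    ints s' 25 = 0 & reals s' = reals s]).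
Proof.
move=> s0; apply: (@run_seq _ _ _ _ _ 6 5).
apply: run_block => //; rewrite /= /set_int /= /upd /= s0 !addn0.
set s1 := State _ _.
have h23 : ints s1 23 = 40 + 4 * n by rewrite /=; lia.
have h22 : ints s1 22 = 40 + n by [].
have [h20 h21] : ints s1 20 = n /\ ints s1 21 = 40 by [].
have r1 : reals s1 = reals s by [].
move: s1 h23 h22 h20 h21 r1 => s1 h23 h22 h20 h21 r1.
apply: run_block => //; rewrite /= /set_int /= /upd /= h20 h23.
by split=> //; rewrite /base /=; first [lia | split; [split|]; lia].
Qed.

Definition loaded (mem : nat -> R) s : Prop :=
  [/\ forall j, j <= n + n -> reals s j = mem j &
      forall i, i < n -> reals s (n + n + 1 + i + i) = orc false i /\
                        reals s (n + n + 1 + (n + i) + (n + i)) = orc true i].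

Lemma run_read_angles s : base s -> ints s 5 = n + n -> ints s 25 = 0 -> ints s 7 = 40 + 8 * n ->
  run orc read_angles s (n * 8).+1 (fun s' => [/\ base s', ints s' 7 = 40 + 8 * n
     & loaded (reals s) s']).
Proof.
move=> base0 e5 e25 e7.
pose Inv m s1 := [/\ base s1, ints s1 5 = n + n, ints s1 7 = 40 + 8 * n, ints s1 25 + m = n &
  (forall j, j <= n + n -> reals s1 j = reals s j) /\
  forall i, i < ints s1 25 -> reals s1 (n + n + 1 + i + i) = orc false i /\
                        reals s1 (n + n + 1 + (n + i) + (n + i)) = orc true i].
apply: (@run_while _ _ _ _ Inv).
- by split=> //; [rewrite e25|split=> // i; rewrite e25].
- move=> m s1 [base1 f5 f7 em [lo rd]] /=; have [[f20 f21 f22 f23] f24] := base1.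
  rewrite f20 => lt1; split; first by lia.
  apply: (@run_seq _ _ _ _ _ 5 2); apply: run_block => //; rewrite /= /set_int /set_real /= /upd /= f5.
  set s2 := State _ _.
  apply: run_block => //; rewrite /= /set_int /set_real /= /upd /=.
  set i := ints s1 25.
  split=> //=.
  + by rewrite addn1 addSn; lia.
  + split=> [j hj|j].
      by rewrite !ifF ?lo //; lia.
    rewrite addn1 ltnS leq_eqVlt => /orP[/eqP->|ji].
      split; last by rewrite ifT //; lia.
      by rewrite ifF ?ifT //; lia.
    by have [r1 r2] := rd j ji; rewrite !ifF //; lia.
- move=> m s1 [base1 f5 f7 em [lo rd]] /=; have [[f20 _ _ _] _] := base1.
  by rewrite f20 -leqNgt => le1; split=> //; split=> // i work_neq_low; apply: rd; lia.
Qed.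

End Program.

Section Phases.
Variables (R : realType) (orc : bool -> nat -> R) (n : nat).
Implicit Types s : state R.

Lemma ple_key (key : nat -> R) N xs i j : perm_eq xs (iota 0 N) -> pairwise (ple key N) xs ->
  i <= j < N -> (key (nth 0%N xs i) <= key (nth 0%N xs j))%R.
Proof.
move=> pxs pw /andP[ij jN].
have sN : size xs = N by rewrite (perm_size pxs) size_iota.
case: (ltngtP i j) ij => // [ij _|-> _]; last exact: lexx.
have /pairwiseP := pw => /(_ 0%N i j).
rewrite !inE sN => /(_ (ltn_trans ij jN) jN ij).
have jn : nth 0%N xs j < N.
  have : nth 0%N xs j \in iota 0 N by rewrite -(perm_mem pxs) mem_nth // sN.
  by rewrite mem_iota.
rewrite /ple ltn_eqF //= => /andP[_ /orP[/ltW //|/andP[/eqP-> _]]].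
exact: lexx.
Qed.

Lemma run_sort_radii s M : 0 < n -> n < 2 ^ M -> base n s -> ints s 7 = 40 + 8 * n ->
  run orc sort_radii s (2 + (n * (M * 20 + 44) + 10)) (fun s' =>
  [/\ base n s', ints s' 7 = 40 + 8 * n, reals s' = reals s & exists xs,
   [/\ perm_eq xs (iota 0 n),
    forall i j, i <= j < n -> (reals s (nth 0 xs i + nth 0 xs i + 1)%N
          <= reals s (nth 0 xs j + nth 0 xs j + 1)%N)%R
    & forall i, i < n -> ints s' (40 + 13 * n + i) = nth 0 xs i]]).
Proof.
move=> n0 nM [[f20 f21 f22 f23] f24] f7.
apply: run_seq; apply: run_block => //; rewrite /= /set_int /= /upd /= f20.
set s1 := State _ _.
have e1 : env n 1 (40 + 8 * n) (reals s) s1 by split=> //=; lia.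
have TB : 40 <= 40 + 8 * n by lia.
have := run_sort_keys orc TB (fun x => erefl) n0 nM e1; move/run_weaken; apply=> // s2.
move=> [[r2 h2] [xs [pxs pw arr]]].
have lo a : 18 <= a < 40 \/ a < 8 -> ints s2 a = ints s1 a by move=> ha; apply: h2; lia.
split.
- by split; [split|]; rewrite lo //=; lia.
- by rewrite lo //; lia.
- by rewrite r2.
- exists xs; split=> // [i j ij|i ni].
    have := ple_key pxs pw ij.
    by rewrite /= ![(1 + _)%N]addnC ![(_ + 1 + _)%N]addnAC.
  by have [<- _] := arr i ni; congr ints; lia.
Qed.

Definition layer_body : cmd :=
  Seq (load 29 27 25)
    (Seq (block (addi 30 (cell 29) (cell 29)) [:: addi 30 (cell 30) 1])
    (Seq (If (RLt (RCell (Ind 30)) (RCell 2)) (Instr (movi 15 0))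
      (block (addi 28 (cell 28) 1) [:: RSet 2 RAdd (RCell (Ind 30)) (RCell 0);
         RSet 2 RAdd (RCell 2) (RCell 0)]))
    (Seq (store 21 29 28) (Instr (addi 25 (cell 25) 1))))).

Lemma run_layer_body s x : base n s -> 40 <= ints s 27 -> x < n ->
  ints s (ints s 27 + ints s 25) = x ->
  let p := (reals s (x + x + 1) < reals s 2)%R in
  let L := if p then ints s 28 else (ints s 28).+1 in
  run orc layer_body s 11 (fun s' =>
  [/\ reals s' 2 = if p then reals s 2 else (reals s (x + x + 1)%N + reals s 0 + reals s 0)%R,
      forall j, j != 2 -> reals s' j = reals s j,
      ints s' 28 = L, ints s' 25 = (ints s 25).+1 &
      forall a, a \notin [:: 15; 25; 28; 29; 30] -> ints s' a = if a == 40 + x then L else ints s a]).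
Proof.
move=> [[f20 f21 f22 f23] f24] f27 xn ex p L.
have nin a : a \notin [:: 15; 25; 28; 29; 30] -> [/\ a != 15, a != 25, a != 28, a != 29 & a != 30].
  by rewrite !inE !negb_or => /and5P[].
apply: (@run_seq _ _ _ _ _ 2 9).
have : ints s 27 + ints s 25 != 15 by lia.
move/(@run_load _ orc 29 27 25 s isT isT) => r1; apply: (run_weaken r1) => // s1 [r1' h1] {r1}.
rewrite ex in h1.
apply: (@run_seq _ _ _ _ _ 2 7); apply: run_block => //; rewrite /= /set_int /= /upd /= h1 //=.
set s2 := State _ _.
have h2 a : a != 15 -> a != 29 -> a != 30 -> ints s2 a = ints s a.
  by move=> a1 a2 a3; rewrite /= !ifN // h1 // ifN.
have s2_29 : ints s2 29 = x by rewrite /= h1.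
have s2_30 : ints s2 30 = x + x + 1 by [].
apply: (@run_seq _ _ _ _ _ 4 3).
have pE : test_val s2 (RLt (RCell (Ind 30)) (RCell 2)) = p by rewrite /= r1'.
apply: (@run_weaken _ _ _ _ 4 4 (fun s3 => [/\
   reals s3 2 = if p then reals s 2 else (reals s (x + x + 1)%N + reals s 0 + reals s 0)%R,
   forall j, j != 2 -> reals s3 j = reals s j, ints s3 28 = L &
   forall a, a != 15 -> a != 28 -> ints s3 a = ints s2 a])) => //.
  apply: run_if; rewrite pE /L => hp.
    apply: run_instr; rewrite hp /= /set_int /= /upd /=; split=> //; rewrite ?r1' ?h1 //.
    by move=> a a15 _; rewrite ifN.
  rewrite (negbTE hp).
  apply: run_block => //; rewrite /= /set_int /set_real /= /upd /= r1'; split=> //.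
  - by move=> j j2; rewrite ifN // ifN.
  - by rewrite h1 //= addn1.
  - by move=> a _ a28; rewrite ifN.
move=> s3 [r3 r3' l3 h3].
apply: (@run_seq _ _ _ _ _ 2 1).
have c21 : ints s3 21 = 40 by rewrite h3 // h2.
have c29 : ints s3 29 = x by rewrite h3.
have : ints s3 21 + ints s3 29 != 15 by rewrite c21 c29; lia.
move/(@run_store _ orc 21 29 28 s3 isT) => r4; apply: (run_weaken r4) => // s4 [r4' h4] {r4}.
rewrite c21 c29 l3 in h4.
apply: run_instr; rewrite /= /set_int /= /upd /= r4'; split=> //.
- by rewrite h4 // l3 low_neq_work.
- by rewrite h4 // low_neq_work // h3 // h2 // addn1.
- move=> a /nin[a1 a2 a3 a4 a5]; rewrite ifN // h4 //.
  by case: eqP => // _; rewrite h3 // h2.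
Qed.

End Phases.

Section Layers.
Variables (R : realType) (orc : bool -> nat -> R) (n : nat).
Implicit Types s : state R.

(** Layer i opens at radius [rho i]. The gaps of at least 2r make this a layering and, with
    [rho 0 = 0], give the alternative rho = 0 or rho >= 2r. *)
Definition greedy_layers (b : nat -> R) (r : R) (L : nat -> nat) : Prop :=
  exists rho : nat -> R, [/\ rho 0 = 0%R, forall i, (rho i + 2 * r <= rho i.+1)%R
    & forall u, u < n -> (rho (L u) <= b u < rho (L u) + 2 * r)%R].

Lemma run_layers s (b : nat -> R) (r : R) xs : base n s -> ints s 7 = 40 + 8 * n ->
  (0 < r)%R -> reals s 0 = r -> (forall u, u < n -> reals s (u + u + 1) = b u) ->
  (forall u, u < n -> (0 <= b u)%R) -> perm_eq xs (iota 0 n) ->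
  (forall i j, i <= j < n -> (b (nth 0%N xs i) <= b (nth 0%N xs j))%R) ->
  (forall i, i < n -> ints s (40 + 13 * n + i) = nth 0 xs i) ->
  run orc layers s (9 + (n * 12).+1) (fun s' => [/\ base n s', ints s' 7 = 40 + 8 * n,
    forall j, j != 2 -> reals s' j = reals s j
    & greedy_layers b r (fun u => ints s' (40 + u))]).
Proof.
move=> base0 f7 r0 rE bE b0 pxs srt arr.
have [[f20 f21 f22 f23] f24] := base0.
have sxs : size xs = n by rewrite (perm_size pxs) size_iota.
have uxs : uniq xs by rewrite (perm_uniq pxs) iota_uniq.
have xlt j : j < n -> nth 0 xs j < n.
  move=> jn; have : nth 0 xs j \in iota 0 n by rewrite -(perm_mem pxs) mem_nth // sxs.
  by rewrite mem_iota.
pose Inv m s1 := [/\ base n s1 /\ ints s1 7 = 40 + 8 * n,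
  ints s1 27 = 40 + 13 * n /\ forall i, i < n -> ints s1 (40 + 13 * n + i) = nth 0 xs i,
  forall j, j != 2 -> reals s1 j = reals s j, ints s1 25 + m = n &
  exists rho : nat -> R,
   [/\ rho 0 = 0%R, forall i, (rho i + 2 * r <= rho i.+1)%R,
     reals s1 2 = (rho (ints s1 28) + 2 * r)%R,
     forall j, ints s1 25 <= j < n -> (rho (ints s1 28) <= b (nth 0%N xs j))%R
   & forall j, j < ints s1 25 -> let l := ints s1 (40 + nth 0 xs j) in
       l <= ints s1 28 /\ (rho l <= b (nth 0%N xs j) < rho l + 2 * r)%R]].
rewrite /layers; apply: run_seq; apply: run_block => //.
rewrite /= /set_int /set_real /= /upd /=.
set s0 := State _ _.
apply: (@run_while _ _ _ _ Inv).
- split=> //=.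
  + by split=> [|i ni]; [rewrite f24 f20; lia | exact: arr].
  + by move=> j j2; rewrite ifN.
  (* Layers that are not yet open get provisional starts at distances 2r, so that [rho] is defined
     everywhere. *)
  + exists (fun i => i%:R * (2 * r))%R; split=> //=.
    * by rewrite mul0r.
    * by move=> i; rewrite -(addn1 i) natrD; lra.
    * by rewrite rE; lra.
    * by move=> j jn; rewrite mul0r b0 // xlt; lia.
- move=> m s1 [[base1 g7] [g27 garr] greal g25 [rho [rho0 rhoS lim rest done_]]] /=.
  have [[g20 _ _ _] _] := base1; rewrite g20 => lt1.
  split; first by lia.
  set k := ints s1 25 in lt1 g25 rest done_.
  have c27 : 40 <= ints s1 27 by rewrite g27; lia.
  have xn := xlt _ lt1.
  have cx : ints s1 (ints s1 27 + ints s1 25) = nth 0 xs k by rewrite g27 garr.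
  have := run_layer_body orc base1 c27 xn cx; rewrite /= (greal (_ + 1)); last by lia.
  rewrite (greal 0) // rE bE //; set x := nth 0 xs k in xn cx *.
  move/run_weaken; apply=> // s2 [l2 r2 L2 k2 h2].
  have h2' a : a < 15 \/ 15 < a < 25 \/ 25 < a < 28 \/ 30 < a < 40 \/ 40 + n <= a -> ints s2 a = ints s1 a.
    by move=> ha; rewrite h2 ?ifF //; rewrite ?inE; lia.
  have [[q20 q21 q22 q23] q24] := base1.
  split.
  + by split; [split; [split|]|]; rewrite h2' //; lia.
  + split; first by rewrite h2' //; lia.
    by move=> i ni; rewrite h2' ?garr //; lia.
  + by move=> j j2; rewrite r2 // greal.
  + by rewrite k2; lia.
  have x_new j : j < k -> (40 + nth 0 xs j == 40 + x) = false.
    by move=> jk; rewrite eqn_add2l nth_uniq ?sxs //; lia.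
  have cell40 u : u < n -> ints s2 (40 + u) = if 40 + u == 40 + x then ints s2 28 else ints s1 (40 + u).
    by move=> un; rewrite h2 ?L2 // !inE; lia.
  case: ifP l2 L2 => [bx l2 L2|bx l2 L2].
    exists rho; rewrite l2 L2 k2; split=> // [j jn|j]; first by apply: rest; lia.
    rewrite ltnS leq_eqVlt => /orP[/eqP->|jk]; cbv zeta.
      rewrite cell40 // eqxx L2 leqnn; split=> //.
      by rewrite rest ?leqnn //= -lim.
    by rewrite cell40 ?x_new //; [exact: done_ | apply: xlt; lia].
  have {bx} bx : (rho (ints s1 28) + 2 * r <= b x)%R by rewrite -lim leNgt bx.
  pose l := ints s1 28.
  (* A new layer opens at [b x], and the provisional starts of the later ones move along. *)
  exists (fun i => if i <= l then rho i else (b x + (i - l.+1)%N%:R * (2 * r))%R).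
  rewrite l2 L2 k2; split=> //.
  + move=> i; case: (ltngtP i l) => [il|il|->].
    * by [].
    * have -> : i.+1 - l.+1 = (i - l.+1) + 1 by lia.
      by rewrite natrD mulrDl mul1r; lra.
    * by rewrite subnn mul0r addr0.
  + by rewrite ltnn subnn mul0r addr0; lra.
  + by move=> j jn; rewrite ltnn subnn mul0r addr0; apply: srt; lia.
  + move=> j; rewrite ltnS leq_eqVlt => /orP[/eqP->|jk]; cbv zeta.
      by rewrite cell40 // eqxx L2 ltnn subnn mul0r addr0 lexx /= leqnn; split=> //; lra.
    rewrite cell40 ?x_new //; last by apply: xlt; lia.
    have [d1 d2] := done_ j jk; split; first by apply: leqW.
    by rewrite d1.
- move=> m s1 [[base1 g7] [g27 garr] greal g25 [rho [rho0 rhoS lim rest done_]]] /=.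
  have [[g20 _ _ _] _] := base1; rewrite g20 -leqNgt => le1.
  split=> //; exists rho; split=> // u un.
  have ux : u \in xs by rewrite (perm_mem pxs) mem_iota.
  have iu : index u xs < n by rewrite -sxs index_mem.
  have [] := done_ (index u xs) ltac:(lia).
  by rewrite nth_index.
Qed.

End Layers.

Section Output.
Variables (R : realType) (orc : bool -> nat -> R) (n : nat).
Implicit Types s : state R.

Lemma run_sort_angles s M : 0 < n -> n + n < 2 ^ M -> base n s -> ints s 7 = 40 + 8 * n ->
  let key x := reals s (n + n + 1 + x + x) in
  run orc sort_angles s (2 + ((n + n) * (M * 20 + 44) + 10)) (fun s' =>
  [/\ base n s', ints s' 5 = n + n, forall a, 40 <= a < 40 + n -> ints s' a = ints s a
   & exists xs, [/\ perm_eq xs (iota 0 (n + n)), pairwise (ple key (n + n)) xs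
    & forall x, x < n + n -> ints s' (40 + 16 * n + x) = index x xs]]).
Proof.
move=> n0 nM [[f20 f21 f22 f23] f24] f7 key.
apply: run_seq; apply: run_block => //; rewrite /= /set_int /= /upd /= f20.
set s1 := State _ _.
have e1 : env (n + n) (n + n + 1) (40 + 8 * n) (reals s) s1 by split=> //=; lia.
have TB : 40 <= 40 + 8 * n by lia.
have nn0 : 0 < n + n by lia.
have := run_sort_keys orc TB (fun x => erefl (key x)) nn0 nM e1; move/run_weaken; apply=> // s2.
move=> [[r2 h2] [xs [pxs pw arr]]].
have lo a : 18 <= a < 40 \/ a < 8 -> ints s2 a = ints s1 a by move=> ha; apply: h2; lia.
split.
- by split; [split|]; rewrite lo //=; lia.
- by rewrite lo //; lia.
- by move=> a ha; rewrite h2 /= ?ifF //; lia.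
- exists xs; split=> // x xn.
  have xx : x \in xs by rewrite (perm_mem pxs) mem_iota.
  have ix : index x xs < n + n by rewrite -(size_iota 0 (n + n)) -(perm_size pxs) index_mem.
  have [_] := arr _ ix; rewrite nth_index // => e; rewrite -[RHS]e; congr ints; lia.
Qed.

Lemma run_bags s (rank : nat -> nat) : base n s -> ints s 5 = n + n ->
  (forall x, x < n + n -> ints s (40 + 16 * n + x) = rank x) ->
  run orc bags s (6 + (n * 13).+1) (fun s' => [/\ base n s', ints s' 5 = n + n,
    forall a, 40 <= a < 40 + n -> ints s' a = ints s a
    & forall i, i < n -> [/\ ints s' (40 + n + 3 * i) = i,
        ints s' (40 + n + 3 * i).+1 = rank i & ints s' (40 + n + 3 * i).+2 = rank (n + i)]]).
Proof.
move=> base0 f5 rk; have [[f20 f21 f22 f23] f24] := base0.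
pose Inv m s1 := [/\ base n s1 /\ ints s1 5 = n + n, ints s1 27 = 40 + 16 * n /\
    ints s1 30 = 40 + n + 3 * ints s1 25,
    forall a, 40 <= a < 40 + n \/ 40 + 4 * n <= a -> ints s1 a = ints s a,
    ints s1 25 + m = n
  & forall i, i < ints s1 25 -> [/\ ints s1 (40 + n + 3 * i) = i,
        ints s1 (40 + n + 3 * i).+1 = rank i & ints s1 (40 + n + 3 * i).+2 = rank (n + i)]].
rewrite /bags; apply: run_seq; apply: run_block => //; rewrite /= /set_int /= /upd /=.
set s0 := State _ _.
apply: (@run_while _ _ _ _ Inv).
- split=> //=; first by rewrite f24 f5 f22; lia.
  by move=> a ha; rewrite !ifF //; lia.
- move=> m s1 [[base1 g5] [g27 g30] fr g25 out] /=.
  have [[g20 g21 g22 g23] g24] := base1; rewrite g20 => lt1; split; first by lia.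
  set i := ints s1 25 in lt1 g25 g30 out; set p := 40 + n + 3 * i in g30.
  apply: (@run_seq _ _ _ _ _ 2 10).
  have : 40 <= ints s1 30 by rewrite g30; lia.
  move/(@run_emit _ orc 25 s1 isT) => r1; apply: (run_weaken r1) => // s2 [r2 q2 h2] {r1}.
  rewrite g30 in q2 h2.
  have l2 a : a < 40 -> a != 30 -> ints s2 a = ints s1 a.
    by move=> a1 a2; rewrite h2 // ifF //; lia.
  apply: (@run_seq _ _ _ _ _ 2 8).
  have : ints s2 27 + ints s2 25 != 15 by rewrite l2 // g27; lia.
  move/(@run_load _ orc 29 27 25 s2 isT isT) => r1; apply: (run_weaken r1) => // s3 [r3 h3] {r1}.
  have h3' a : a != 15 -> a != 29 -> ints s3 a = ints s2 a.
    by move=> a1 a2; rewrite h3 // ifN.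
  have c29 : ints s3 29 = rank i.
    rewrite h3 // eqxx (l2 27) // (l2 25) // g27 h2; last by lia.
    by rewrite ifF; [rewrite fr; [rewrite rk //; lia | lia] | lia].
  apply: (@run_seq _ _ _ _ _ 2 6).
  have e30 : ints s3 30 = p.+1 by rewrite h3.
  have : 40 <= ints s3 30 by rewrite e30; lia.
  move/(@run_emit _ orc 29 s3 isT) => r1; apply: (run_weaken r1) => // s4 [r4 q4 h4] {r1}.
  rewrite e30 c29 in q4 h4.
  have l4 a : a < 40 -> a \notin [:: 15; 29; 30] -> ints s4 a = ints s1 a.
    move=> a1; rewrite !inE !negb_or => /and3P[a2 a3 a4].
    rewrite h4 // ifF; last by lia.
    by rewrite h3 // (negbTE a3) l2.
  apply: (@run_seq _ _ _ _ _ 1 5); apply: run_instr; rewrite /= /set_int /= /upd /= !l4 // g20.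
  set s5 := State _ _.
  have h5 a : a != 31 -> ints s5 a = ints s4 a by move=> ?; rewrite /= ifN.
  apply: (@run_seq _ _ _ _ _ 2 3).
  have e27 : ints s5 27 = 40 + 16 * n by rewrite h5 // l4.
  have e31 : ints s5 31 = i + n by [].
  have : ints s5 27 + ints s5 31 != 15 by rewrite e27; lia.
  move/(@run_load _ orc 29 27 31 s5 isT isT) => r1; apply: (run_weaken r1) => // s6 [r6 h6] {r1}.
  rewrite e27 e31 in h6.
  have h6' a : a != 15 -> a != 29 -> ints s6 a = ints s5 a.
    by move=> a1 a2; rewrite h6 // ifN.
  have c29' : ints s6 29 = rank (n + i).
    rewrite h6 // eqxx h5; last by lia.
    rewrite h4; last by lia.
    rewrite ifF; last by lia.
    rewrite h3'; [|lia..].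
    rewrite h2; last by lia.
    rewrite ifF; last by lia.
    by rewrite fr; [rewrite (addnC i n) rk //; lia | lia].
  have e30' : ints s6 30 = p.+2 by rewrite h6 // h5.
  apply: (@run_seq _ _ _ _ _ 2 1).
  have : 40 <= ints s6 30 by rewrite e30'; lia.
  move/(@run_emit _ orc 29 s6 isT) => r1; apply: (run_weaken r1) => // s7 [r7 q7 h7] {r1}.
  rewrite e30' c29' in q7 h7.
  apply: run_instr; rewrite /= /set_int /= /upd /=; set s8 := State _ _.
  have h8 a : a != 25 -> ints s8 a = ints s7 a by move=> ?; rewrite /= ifN.
  have l8 a : a < 40 -> a \notin [:: 15; 25; 29; 30; 31] -> ints s8 a = ints s1 a.
    move=> a1; rewrite !inE !negb_or => /and5P[a2 a3 a4 a5 a6].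
    rewrite h8 // h7 // ifF; last by lia.
    by rewrite h6 // (negbTE a4) h5 // l4 // !inE !negb_or a2 a4.
  have big a : 40 <= a -> ints s8 a = if a == p.+2 then rank (n + i) else
      if a == p.+1 then rank i else if a == p then i else ints s1 a.
    move=> a40; rewrite h8; last by lia.
    rewrite h7; last by lia.
    case: eqP => // _; rewrite h6'; [|lia..].
    rewrite h5; last by lia.
    rewrite h4; last by lia.
    case: eqP => // _; rewrite h3'; [|lia..].
    by rewrite h2 //; lia.
  have k8 : ints s8 25 = i.+1.
    have e7 : ints s7 25 = i.
      rewrite h7; last by [].
      have -> : (25 == p.+2) = false by lia.
      by rewrite h6' // h5 // l4.
    by rewrite /= e7 addn1.
  split.
  + by split; [split; [split|]|]; rewrite l8.
  + by split; [rewrite l8 | rewrite k8 h8 // q7 /p; lia].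
  + by move=> a ha; rewrite big; [rewrite !ifF ?fr //; lia | lia].
  + by rewrite k8; lia.
  + rewrite k8 => j; rewrite ltnS leq_eqVlt => /orP[/eqP->|ji].
      by rewrite -/p !big; [split; rewrite ?eqxx // ?ifF //; lia | lia..].
    have [w1 w2 w3] := out j ji.
    by rewrite !big; [split; rewrite !ifF //; lia | lia..].
- move=> m s1 [[base1 g5] _ fr g25 out] /=; have [[g20 _ _ _] _] := base1.
  rewrite g20 -leqNgt => le1; split=> //.
    by move=> a ha; apply: fr; lia.
  by move=> j jn; apply: out; lia.
Qed.

Lemma run_edges s : base n s -> ints s 5 = n + n ->
  run orc edges s (2 + ((n + n) * 6).+1) (fun s' => [/\ base n s', ints s' 5 = n + n,
    forall a, 40 <= a < 40 + 4 * n -> ints s' a = ints s a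
    & forall e, e < n + n -> ints s' (40 + 4 * n + 2 * e) = e /\
        ints s' (40 + 4 * n + 2 * e).+1 = e.+1]).
Proof.
move=> base0 f5; have [[f20 f21 f22 f23] f24] := base0.
pose Inv m s1 := [/\ base n s1 /\ ints s1 5 = n + n, ints s1 30 = 40 + 4 * n + 2 * ints s1 25,
    forall a, 40 <= a < 40 + 4 * n -> ints s1 a = ints s a, ints s1 25 + m = n + n
  & forall e, e < ints s1 25 -> ints s1 (40 + 4 * n + 2 * e) = e /\
        ints s1 (40 + 4 * n + 2 * e).+1 = e.+1].
rewrite /edges; apply: run_seq; apply: run_block => //; rewrite /= /set_int /= /upd /=.
set s0 := State _ _.
apply: (@run_while _ _ _ _ Inv).
- split=> //=; first by rewrite f23; lia.
  by move=> a ha; rewrite !ifF //; lia.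
- move=> m s1 [[base1 g5] g30 fr g25 out] /=.
  have [[g20 g21 g22 g23] g24] := base1; rewrite g5 => lt1; split; first by lia.
  set i := ints s1 25 in lt1 g25 g30 out; set p := 40 + 4 * n + 2 * i in g30.
  apply: (@run_seq _ _ _ _ _ 2 3).
  have : 40 <= ints s1 30 by rewrite g30; lia.
  move/(@run_emit _ orc 25 s1 isT) => r1; apply: (run_weaken r1) => // s2 [r2 q2 h2] {r1}.
  rewrite g30 in q2 h2.
  have e25 : ints s2 25 = i.
    rewrite h2; last by [].
    by have -> : (25 == p) = false by lia.
  apply: (@run_seq _ _ _ _ _ 1 2); apply: run_instr; rewrite /= /set_int /= /upd /= e25 addn1.
  set s3 := State _ _.
  have h3 a : a != 25 -> ints s3 a = ints s2 a by move=> ?; rewrite /= ifN.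
  have e30 : ints s3 30 = p.+1 by [].
  have : 40 <= ints s3 30 by rewrite e30; lia.
  move/(@run_emit _ orc 25 s3 isT) => r1; apply: (run_weaken r1) => // s4 [r4 q4 h4] {r1}.
  rewrite e30 in q4 h4.
  have k4 : ints s4 25 = i.+1.
    rewrite h4; last by [].
    by have -> : (25 == p.+1) = false by lia.
  have h42 a : a != 25 -> a != 30 -> ints s4 a = if a == p.+1 then i.+1 else if a == p then i else ints s1 a.
    by move=> a1 a2; rewrite h4 // (h3 a) // h2 //.
  have l4 a : a < 40 -> a != 25 -> a != 30 -> ints s4 a = ints s1 a.
    by move=> a0 a1 a2; rewrite h42 // !ifF //; lia.
  split.
  + by split; [split; [split|]|]; rewrite l4.
  + by rewrite k4 q4; lia.
  + by move=> a ha; rewrite h42; [rewrite !ifF ?fr //; lia | lia..].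
  + by rewrite k4; lia.
  + rewrite k4 => j; rewrite ltnS leq_eqVlt => /orP[/eqP->|ji].
      by rewrite -/p !h42; [split; rewrite ?eqxx // ?ifF //; lia | lia..].
    have [w1 w2] := out j ji.
    by rewrite !h42; [split; rewrite !ifF //; lia | lia..].
- move=> m s1 [[base1 g5] _ fr g25 out] /=.
  rewrite g5 -leqNgt => le1; split=> //.
  by move=> j jn; apply: out; lia.
Qed.

Lemma run_outputs s : base n s -> ints s 5 = n + n ->
  run orc outputs s 5 (fun s' => [/\ ints s' 0 = n + n,
    [/\ ints s' 1 = 40 + 4 * n, ints s' 2 = n, ints s' 3 = 40 + n & ints s' 4 = 40]
    & forall a, 40 <= a -> ints s' a = ints s a]).
Proof.
move=> [[f20 f21 f22 f23] f24] f5.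
apply: run_block => //; rewrite /= /set_int /= /upd /=; split; [lia|by split; lia|].
by move=> a ha; rewrite !ifF //; lia.
Qed.

End Output.

Section Decompose.
Variables (R : realType) (orc : bool -> nat -> R) (n : nat).

Lemma run_decompose (r : R) (b theta : 'I_n -> R) M : 0 < n -> n + n < 2 ^ M -> (0 < r)%R ->
  (forall i, (0 <= b i)%R) ->
  run orc decompose (input r b theta) (300 * (n * M)) (fun s =>
  [/\ [/\ ints s 0 = n + n, ints s 1 = 40 + 4 * n, ints s 2 = n, ints s 3 = 40 + n
       & ints s 4 = 40],
   greedy_layers n (at_index b) r (fun u => ints s (40 + u)),
   forall e, e < n + n -> ints s (40 + 4 * n + 2 * e) = e /\
        ints s (40 + 4 * n + 2 * e).+1 = e.+1
   & exists (key : nat -> R) xs, [/\ perm_eq xs (iota 0 (n + n)), pairwise (ple key (n + n)) xs,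
      forall i, i < n -> key i = orc false i /\ key (n + i) = orc true i
      & forall i, i < n -> [/\ ints s (40 + n + 3 * i) = i,
        ints s (40 + n + 3 * i).+1 = index i xs
        & ints s (40 + n + 3 * i).+2 = index (n + i) xs]]]).
Proof.
move=> n0 nM r0 b0; set s0 := input r b theta.
have M0 : 0 < M by rewrite lt0n; apply: contraTneq nM => ->; rewrite expn0; lia.
have nM1 : n < 2 ^ M by lia.
(* The sum is 60 n M + 177 n + 61, where n and 1 are at most n M. *)
apply: (@run_le _ _ _ _ (11 + ((n * 8).+1 + ((2 + (n * (M * 20 + 44) + 10)) + ((9 + (n * 12).+1) +
  ((2 + ((n + n) * (M * 20 + 44) + 10)) + ((6 + (n * 13).+1) + ((2 + ((n + n) * 6).+1) + 5)))))))).
  have : n <= n * M by rewrite leq_pmulr.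
  have : M <= n * M by rewrite leq_pmull.
  move: M0 n0; clear; move=> M0 n0 h1 h2; nia.
have e0 : ints s0 0 = n by [].
apply: run_seq; apply: (run_weaken (run_layout orc e0)) => // s1 [base1 f5 f7 f25 r1].
apply: run_seq; apply: (run_weaken (run_read_angles orc base1 f5 f25 f7)) => // s2 [base2 g7 [lo2 an2]].
apply: run_seq; apply: (run_weaken (run_sort_radii orc n0 nM1 base2 g7)) => // s3.
move=> [base3 h7 r3 [ys [pys srt arr]]].
have bE u : u < n -> reals s2 (u + u + 1) = at_index b u.
  move=> un; rewrite lo2; last by lia.
  rewrite r1 /= ifF; last by lia.
  rewrite ifT; last by lia.
  by congr at_index; lia.
have bE3 u : u < n -> reals s3 (u + u + 1) = at_index b u by rewrite r3; exact: bE.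
have yn i : i < n -> nth 0 ys i < n.
  move=> ni; have : nth 0 ys i \in iota 0 n.
    by rewrite -(perm_mem pys) mem_nth // (perm_size pys) size_iota.
  by rewrite mem_iota.
have srt3 i j : i <= j < n -> (at_index b (nth 0%N ys i) <= at_index b (nth 0%N ys j))%R.
  by move=> ij; rewrite -!bE; [exact: srt | apply: yn; lia..].
have rE3 : reals s3 0 = r by rewrite r3 lo2 // r1.
have bge u : u < n -> (0 <= at_index b u)%R by move=> un; rewrite /at_index insubT /=.
apply: run_seq.
apply: (run_weaken (run_layers orc base3 h7 r0 rE3 bE3 bge pys srt3 arr)) => // s4 [base4 k7 r4 lay].
have nM2 := nM.
apply: run_seq; apply: (run_weaken (run_sort_angles orc n0 nM2 base4 k7)) => // s5.
move=> [base5 l5 fr5 [xs [pxs pw rk]]].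
apply: run_seq; apply: (run_weaken (run_bags orc base5 l5 rk)) => // s6 [base6 m5 fr6 bag].
apply: run_seq; apply: (run_weaken (run_edges orc base6 m5)) => // s7 [base7 n5 fr7 edg].
apply: (run_weaken (run_outputs orc base7 n5)) => // s8 [z0 zz fr8].
split.
- by case: zz.
- have [rho [rho0 rhoS rhoL]] := lay; exists rho; split=> // u un.
  have -> : ints s8 (40 + u) = ints s4 (40 + u); last exact: rhoL.
  by rewrite fr8; [rewrite fr7; [rewrite fr6; [rewrite fr5 //; lia | lia] | lia] | lia].
- by move=> e en; rewrite !fr8; [exact: edg | lia..].
- exists (fun x => reals s4 (n + n + 1 + x + x)), xs; split=> //.
    move=> i ni; have [a1 a2] := an2 i ni.
    by rewrite !r4; [rewrite r3 | lia..].
  move=> i ni; have [b1 b2 b3] := bag i ni.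
  by rewrite !fr8; [rewrite !fr7; [split|lia..] | lia..].
Qed.

End Decompose.

End RealRAM.

(** * Correctness *)

Section Correctness.
Variable R : realType.

Lemma at_indexE n (f : 'I_n -> R) (u : 'I_n) : at_index f u = f u.
Proof. by rewrite /at_index valK. Qed.

Lemma greedy_layers_lt (r : R) (rho : nat -> R) : 0 < r ->
  (forall i, rho i + 2 * r <= rho i.+1) -> forall i j, (i < j)%N -> rho i + 2 * r <= rho j.
Proof.
move=> r0 rhoS i j; elim: j => // j IH; rewrite ltnS leq_eqVlt => /orP[/eqP->//|/IH h].
by have := rhoS j; lra.
Qed.

Lemma out_is_line (s : state R) (m a : nat) : ints s 0 = m -> ints s 1 = a ->
  (forall e, (e < m)%N -> ints s (a + 2 * e)%N = e /\ ints s (a + 2 * e).+1 = e.+1) ->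
  is_line (T := out_tree s) (@nat_of_ord _) m.
Proof.
move=> s0 s1 edg.
have edgeE i j : (j < m)%N -> out_edge s i j = (i.+1 == j).
  move=> jm; apply/existsP/eqP => [[e]|ij].
    rewrite s1 => /andP[/eqP ei /eqP ej].
    have em : (e < m)%N by have := ltn_ord e; have : out_size s = m := s0; lia.
    by have [h1 h2] := edg e em; rewrite -ei h1 -ej h2.
  have im : (i < (out_size s).-1)%N by rewrite /out_size s0; lia.
  have [|h1 h2] := edg i; first by lia.
  by exists (Ordinal im); rewrite /= s1 h1 h2 ij !eqxx.
have lt_m (u : 'I_(out_size s)) : (u < m)%N by rewrite -s0; exact: ltn_ord.
split.
- exact: val_inj.
- move=> u v; rewrite /= /out_adj /= !edgeE //.
  case: eqP => //= uv; rewrite uv; lia.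
- exact: lt_m.
- move=> k km; rewrite -s0 in km; by exists (Ordinal km).
Qed.

Lemma in_bagE (s : state R) (n c u t lo hi : nat) : ints s 2 = n -> ints s 3 = c -> (u < n)%N ->
  (forall i, (i < n)%N -> ints s (c + 3 * i)%N = i) ->
  ints s (c + 3 * u).+1 = lo -> ints s (c + 3 * u).+2 = hi ->
  in_bag s u t = (lo <= t <= hi)%N.
Proof.
move=> s2 s3 un hid hlo hhi; apply/existsP/idP => [[j]|h].
  rewrite s3 hid; last by apply: leq_trans (ltn_ord j) _; rewrite s2.
  by case/andP => /eqP ->; rewrite hlo hhi.
have un' : (u < ints s 2)%N by rewrite s2.
by exists (Ordinal un'); rewrite /= s3 hid // eqxx hlo hhi.
Qed.

Lemma index_ple (key : nat -> R) (N : nat) (xs : seq nat) x y :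
  perm_eq xs (iota 0 N) -> pairwise (ple key N) xs -> (x < N)%N -> (y < N)%N ->
  (index y xs < index x xs)%N -> ple key N y x.
Proof.
move=> pxs pw xN yN yx.
have sN : size xs = N by rewrite (perm_size pxs) size_iota.
have xin z : (z < N)%N -> z \in xs by move=> zN; rewrite (perm_mem pxs) mem_iota.
have := pairwiseP 0%N pw (index y xs) (index x xs).
by rewrite !inE !index_mem !nth_index ?xin //; apply.
Qed.

Section DiskGraph.
Variables (r : R) (n : nat) (F : polar_frame R) (p : 'I_n -> H2 R) (b theta : 'I_n -> R).
Hypothesis r0 : 0 < r.
Hypothesis polar_p : forall i, polar F (p i) (b i) (theta i).
Variables (key : nat -> R) (xs : seq nat).
Hypothesis perm_xs : perm_eq xs (iota 0 (n + n)).
Hypothesis sorted_xs : pairwise (ple key (n + n)) xs.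
Hypothesis keyE : forall u : 'I_n, key u = inf (angles F (disk r (p u))) /\
  key (n + u)%N = sup (angles F (disk r (p u))).

(** The common angle gives inf <= a <= sup, and on equality the smaller index u < n + v comes first.
    For u = v this says that the interval of a disk is nonempty. *)
Lemma order_of_common_angle (u v : 'I_n) a :
  angles F (disk r (p u)) a -> angles F (disk r (p v)) a ->
  (index (val u) xs <= index (n + v)%N xs)%N.
Proof.
move=> au av; rewrite leqNgt; apply/negP => lt_vu.
have un := ltn_ord u; have vn := ltn_ord v.
have := index_ple perm_xs sorted_xs _ _ lt_vu; rewrite /ple.
move/(_ ltac:(rewrite /=; lia) ltac:(rewrite /=; lia)).
have -> : (val u == n + n)%N = false by rewrite /=; lia.
have -> : (n + v <= val u)%N = false by rewrite /=; lia.
rewrite andbF orbF /= => /andP[_]; apply/negP; rewrite -leNgt.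
have [-> _] := keyE u; have [_ ->] := keyE v.
have /andP[h1 _] := angles_inf_sup (ltW r0) (polar_p u) au.
have /andP[_ h2] := angles_inf_sup (ltW r0) (polar_p v) av.
exact: le_trans h1 h2.
Qed.

Lemma own_angle u : angles F (disk r (p u)) (theta u).
Proof.
exists (p u), (b u); split=> //; rewrite /disk /= hdist_le ?(ltW r0) // H2_mdot opprK.
exact: cosh_ge1.
Qed.

(** Node [t] of the path stands for the angle [key (nth 0 xs t)], which lies between the two ends of
    the range of [u]. *)
Lemma bag_near_ray (u : 'I_n) (t : nat) :
  (index (val u) xs <= t <= index (n + u)%N xs)%N -> r < b u ->
  near_ray r (b u) (key (nth 0%N xs t) - theta u) \/ near_ray r (b u) (0 - theta u).
Proof.
move=> /andP[ut tu] rb; have un := ltn_ord u.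
have xin z : (z < n + n)%N -> z \in xs by move=> zN; rewrite (perm_mem perm_xs) mem_iota.
have sN : size xs = (n + n)%N by rewrite (perm_size perm_xs) size_iota.
have hi_lt : (index (n + u)%N xs < n + n)%N by rewrite -sN index_mem xin //; lia.
apply: (near_ray_of_angle r0 rb (polar_p u)).
have [<- <-] := keyE u; apply/andP; split.
  have := ple_key (i := index (val u) xs) (j := t) perm_xs sorted_xs.
  rewrite ut (leq_ltn_trans tu hi_lt) nth_index; last by apply: xin; rewrite /=; lia.
  exact.
have := ple_key (i := t) (j := index (n + u)%N xs) perm_xs sorted_xs.
rewrite tu hi_lt nth_index; last by apply: xin; lia.
exact.
Qed.

Variable L : nat -> nat.
Hypothesis greedy : greedy_layers n (at_index b) r L.

(** If two layers are not consecutive, some layer start lies between them, at least 2r below the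
    farther center and strictly above the nearer one. The radii of intersecting disks differ by at
    most 2r. *)
Lemma greedy_is_layering : is_layering (G := disk_graph r p) (fun i => [set u : 'I_n | L u == i]%SET).
Proof.
have [rho [_ rhoS rhoL]] := greedy.
split=> [u|u v i j].
  by exists (L u); split=> [|i]; rewrite inE // => /eqP.
rewrite /= => /andP[_ /asboolP meet] /[!inE] /eqP <- /eqP <-.
have := disks_meet_radius (ltW r0) (polar_p u) (polar_p v) meet.
have /andP[h1 h2] := rhoL u (ltn_ord u); have /andP[h3 h4] := rhoL v (ltn_ord v).
rewrite !at_indexE in h1 h2 h3 h4.
rewrite ler_norml => /andP[h5 h6].
by apply/andP; split; rewrite leqNgt; apply/negP => /(greedy_layers_lt r0 rhoS);
  [have := rhoS (L v) | have := rhoS (L u)]; lra.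
Qed.

Lemma card_bag_layer (K t i : nat) (A : {set disk_graph r p}) : (1 < K)%N -> r < K%:R ->
  (forall u, u \in A -> (index (val u) xs <= t <= index (n + val u)%N xs)%N /\ L (val u) = i) ->
  stable A -> (#|A| <= 6 * K)%N.
Proof.
move=> K1 rK inA /forall_inP stA.
have [rho [rho0 rhoS rhoL]] := greedy.
apply: (card_bag (F := F) (p := p) (b := b) (t := theta) (rho := rho i) r0 K1 rK
  polar_p _ _ (a := key (nth 0%N xs t))).
- move=> u v uA vA uv meet; have /negP := forall_inP (stA u uA) v vA; apply.
  by apply/andP; split; [exact: uv | exact/asboolP].
- move=> u /inA[_ <-]; have := rhoL u (ltn_ord u); by rewrite at_indexE.
- case: i {inA} => [|i]; first by left.
  right; rewrite -[2 * r]add0r -{1}rho0.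
  exact: (greedy_layers_lt r0 rhoS).
- by move=> u /inA[ut _]; exact: bag_near_ray.
Qed.

End DiskGraph.

End Correctness.

(** As exp 2 <= 16 = 2^4, ln 2 is at least 1/2. *)
Lemma trunc_log_le_ln (R : realType) (n : nat) : (0 < n)%N ->
  (trunc_log 2 n)%:R <= 2 * ln n%:R :> R.
Proof.
move=> n0.
have ln2 : 1 / 2 <= ln 2 :> R.
  rewrite -ler_expR lnK ?posrE // -(@ler_pXn2r _ 4) ?nnegrE ?expR_ge0 //.
  rewrite -expRM_natl (_ : 4%:R * (1 / 2) = 2 :> R); last lra.
  by apply: (le_trans (expR2_le R)); lra.
have : (2 ^+ trunc_log 2 n : R) <= n%:R by rewrite -natrX ler_nat trunc_logP.
rewrite -ler_ln ?posrE ?exprn_gt0 ?ltr0n // lnXn // -[ln 2 *+ _]mulr_natl => h.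
have : (0 : R) <= (trunc_log 2 n)%:R by [].
nra.
Qed.

Lemma polar_frame_inhabited (R : realType) : inhabited (polar_frame R).
Proof.
have m0 : mdot (delta_mx 0 0) (delta_mx 0 0 : 'rV[R]_3) = -1.
  by rewrite /mdot !mxE /=; ring.
have g0 : 0 < (delta_mx 0 0 : 'rV[R]_3) 0 0 by rewrite mxE.
constructor; apply: (@PolarFrame R (HPoint m0 g0) (delta_mx 0 1) (delta_mx 0 2%:R));
  by rewrite /mdot !mxE /=; ring.
Qed.

Lemma decompose_correct (R : realType) (r : R) (n : nat) (F : polar_frame R) (p : 'I_n -> H2 R)
    (b theta : 'I_n -> R) :
  0 < r -> (0 < n)%N -> (forall i : 'I_n, polar F (p i) (b i) (theta i)) ->
  exists (t : nat) (s : state R),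
    [/\ exec (angle_oracle F r p) decompose (input r b theta) t s,
        (2 <= n)%N -> t%:R <= 1800%:R * (n%:R * ln n%:R) :> R
      & [/\ @is_tree_decomposition (disk_graph r p) (out_tree s) (@out_bag R n s),
            (#|out_tree s| <= 2 * n)%N,
            @is_layering (disk_graph r p) (out_layer n s)
          & @witness_ltin (disk_graph r p) (out_tree s) (@out_bag R n s) (out_layer n s)
              (6 * `|Num.ceil (r / tanh r)|)%N]].
Proof.
move=> r0 n0 pp.
have nM : (n + n < 2 ^ (trunc_log 2 n).+2)%N.
  by rewrite expnS mul2n -addnn; have := trunc_log_ltn n (isT : (1 < 2)%N); lia.
have b0 i : 0 <= b i by case: (pp i).
have [t [s [ex tT]]] := run_decompose (angle_oracle F r p) theta n0 nM r0 b0.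
move=> [[s0 s1 s2 s3 s4] lay edg [key [xs [pxs pw keys bag]]]].
have keyE (u : 'I_n) : key u = inf (angles F (disk r (p u))) /\
    key (n + u)%N = sup (angles F (disk r (p u))).
  by have [-> ->] := keys u (ltn_ord u); rewrite /angle_oracle !at_indexE.
have inX (t' : out_tree s) (u : 'I_n) :
    (u \in out_bag n t') = (index (val u) xs <= t' <= index (n + val u)%N xs)%N.
  rewrite inE; have [_ b1 b2] := bag u (ltn_ord u).
  by apply: (in_bagE _ s2 s3 (ltn_ord u) _ b1 b2) => i /bag[].
have sN : size xs = (n + n)%N by rewrite (perm_size pxs) size_iota.
exists t, s; split=> // [n2|].
  (* The constant is 1800 = 300 * 6: for n >= 2 the exponent is at most three times the truncated
     logarithm, which is at most 2 ln n. *)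
  have : t%:R <= (300 * (n * (trunc_log 2 n).+2))%:R :> R by rewrite ler_nat.
  rewrite !natrM => /le_trans; apply.
  have l1 : (1 <= trunc_log 2 n)%N by rewrite trunc_log_gt0.
  have l3 : (trunc_log 2 n).+2%:R <= 3 * (trunc_log 2 n)%:R :> R.
    by rewrite -natrM ler_nat; lia.
  have := trunc_log_le_ln R n0; have : (0 : R) <= n%:R by [].
  have -> : 1800%:R = 300%:R * 6 :> R by rewrite -natrM.
  rewrite -mulrA ler_pM2l ?ltr0n // mulrCA => nn l6.
  apply: ler_wpM2l => //; lra.
have lo_le := order_of_common_angle r0 pp pxs pw keyE.
split.
- apply: (@interval_decomposition (disk_graph r p) (out_tree s) (@nat_of_ord _) (n + n)%N
    (fun u : 'I_n => index (val u) xs) (fun u : 'I_n => index (n + val u)%N xs)).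
  + exact: out_is_line s0 s1 edg.
  + by rewrite addn_gt0 n0.
  + exact: inX.
  + move=> u; have au := own_angle r0 pp u.
    rewrite (lo_le u u _ au au) -sN index_mem (perm_mem pxs) mem_iota /=.
    by have := ltn_ord u; lia.
  + move=> u v /andP[_ /asboolP/(disks_meet_angle F)[a au av]].
    exact: lo_le au av.
- by rewrite card_ord /out_size s0 addnn mul2n.
- have -> : out_layer n s = (fun i => [set u : 'I_n | ints s (40 + u)%N == i]%SET).
    by apply/funext => i; rewrite /out_layer s4.
  exact: (greedy_is_layering r0 pp lay).
- move=> t' i; have [K1 rK] := ceil_bounds r0.
  apply: alpha_induced_le => A /fintype.subsetP AS stA.
  apply: (card_bag_layer r0 pp pxs pw keyE lay (t := t') (i := i) K1 rK _ stA).
  move=> u /AS /[!inE] /andP[ut /eqP <-]; rewrite s4; split=> //.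
  by rewrite -inX inE.
Qed.

Theorem theorem3p12 (R : realType) :
  (exists (prog : cmd) (C n0 : nat),
     forall (r : R) (n : nat) (F : polar_frame R) (p : 'I_n -> H2 R)
            (b theta : 'I_n -> R),
       0 < r -> (0 < n)%N ->
       (forall i : 'I_n, polar F (p i) (b i) (theta i)) ->
       exists (t : nat) (s : state R),
         [/\ exec (angle_oracle F r p) prog (input r b theta) t s,
             (n0 <= n)%N -> t%:R <= C%:R * (n%:R * ln n%:R) :> R
           & [/\ @is_tree_decomposition (disk_graph r p) (out_tree s)
                    (@out_bag R n s),
                 (#|out_tree s| <= 2 * n)%N,
                 @is_layering (disk_graph r p) (out_layer n s)
               & @witness_ltin (disk_graph r p) (out_tree s)
                   (@out_bag R n s) (out_layer n s)
                   (6 * `|Num.ceil (r / tanh r)|)%N]])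
  /\
  (forall (r : R) (G : sgraph),
     0 < r -> hyperbolic_uniform_disk_graph r G ->
     (ltin G <= 6 * `|Num.ceil (r / tanh r)|)%N).
Proof.
split=> [|r G r0 [q qE]].
  by exists decompose, 1800%N, 2%N => r n F p b theta; exact: decompose_correct.
apply: ltin_le.
have [G0|G0] := posnP #|G|; first exact: has_ltin_witness_empty.
(* The existence claim follows from a run of the program on an enumeration of [G], in an arbitrary
   polar frame. *)
have [F] := polar_frame_inhabited R.
pose p (i : 'I_#|G|) := q (enum_val i).
have [b bP] := choice (fun i => polar_exists F (p i)).
have [theta pP] := choice bP.
have [_ [s [_ _ [dec _ lay wit]]]] := decompose_correct r0 G0 pP.
apply: (@has_ltin_witness_inj _ (disk_graph r p) (@enum_rank G)).
- exact: enum_rank_inj.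
- move=> u v; rewrite /= /disk_adj /= /p !enum_rankK (inj_eq enum_rank_inj).
  by apply/andP/idP => [[uv /asboolP meet]|/qE[uv meet]]; [apply/qE | split=> //; apply/asboolP].
- by exists (out_tree s), (@out_bag R _ s), (out_layer _ s).
Qed.
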